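(* Let $m\ge 2$ and let $F_\theta\in\mathcal{F}_m$, i.e. $F_\theta(\mathbf{x})=\prod_{j=1}^m x_j+\theta\,\Omega_m(\mathbf{x})$, $\mathbf{x}\in I^m=[0,1]^m$, for all sufficiently small $\theta\ge 0$, with dependence function $\Omega_m$ satisfying conditions (C1)–(C4) listed in the context. Then the sequence of test statistics $\{S_{m,n}\}_{n\ge 1}$ is Pitman optimal (for testing $\theta=0$ against $\theta>0$) if and only if there is a constant $C>0$ such that $$\Omega_m(\mathbf{x})=C\prod_{j=1}^m x_j\left(\prod_{j=1}^m(2-x_j)+\sum_{j=1}^m x_j-(m+1)\right),\qquad \mathbf{x}=(x_1,\ldots,x_m)\in I^m.$$
   Context: Model. Fix $m\ge 2$ and $I^m=[0,1]^m$; $\lambda_m$ is Lebesgue measure on $\mathbb{R}^m$. $\mathcal{F}_m=\{F_\theta\}$ is the class of absolutely continuous cdfs on $I^m$ which, for sufficiently small $\theta\ge 0$, have the form $F_\theta(\mathbf{x})=\prod_{j=1}^m x_j+\theta\,\Omega_m(\mathbf{x})$, where the dependence function $\Omega_m$ satisfies: (C1) $\Omega_m(\mathbf{x})\ge 0$ for $\mathbf{x}\in I^m$; (C2) $\Omega_m(\mathbf{x})|_{x_k=0}=0$ and $\Omega_m(1,\ldots,1,x_k,1,\ldots,1)=0$ for $x_k\in[0,1]$, $1\le k\le m$; (C3) $\Omega_m(\mathbf{x})|_{x_k=1}=\Omega_{m-1}(x_1,\ldots,x_{k-1},x_{k+1},\ldots,x_m)$, $1\le k\le m$, where $\Omega_{m-1}$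 is the dependence function of the corresponding $(m-1)$-dimensional model (for $m=2$, $\Omega_1\equiv 0$, in accordance with (C2)); (C4) there exists a non-zero mixed derivative $\omega_m(\mathbf{x})=\dfrac{\partial^m\Omega_m(\mathbf{x})}{\partial x_{i_1}\cdots\partial x_{i_m}}$ for $\lambda_m$-almost all $\mathbf{x}\in I^m$, with $\omega_m\in L_2(I^m)$, where $(i_1,\ldots,i_m)$ is an arbitrary permutation of $\{1,\ldots,m\}$. The distribution $\mathbf{P}_\theta$ with cdf $F_\theta$ has uniform $[0,1]$ margins and density $f_\theta=1+\theta\omega_m$ with respect to $\lambda_m$. One observes i.i.d. vectors $\mathbf{X}_i=(X_{i1},\ldots,X_{im})$, $i=1,\ldots,n$, with distribution $\mathbf{P}_\theta$. Test statistic. $R_{ij}$ is the rank of $X_{ij}$ among $X_{1j},\ldots,X_{nj}$, and $$S_{m,n}=\frac{1}{C_m}\left\{n^{-1}\sum_{i=1}^n\prod_{j=1}^m(n+1-R_{ij})-\left(\frac{n+1}{2}\right)^m\right\},\qquad C_m=n^{-1}\sum_{i=1}^n i^m-\left(\frac{n+1}{2}\right)^m.$$ For $\alpha\in(0,1)$ the test based on $S_{m,n}$ of approximate level $\alpha$ rejects $\theta=0$ when $\sqrt{n}\,S_{m,n}/\sigma_m(0)>z_\alpha$, where $z_\alpha=\Phi^{-1}(1-\alpha)$, $\Phi$ is the standard normal cdf, and $$\sigma_m^2(0)=\frac{(m+1)^2}{(2^m-(m+1))^2}\left(\left(\tfrac43\right)^m-\tfrac m3-1\right).$$ Its power function is $\gamma_{m,n}(\theta)=\mathbf{P}^n_\theta(\sqrt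 n\,S_{m,n}/\sigma_m(0)>z_\alpha)$. Pitman optimality. The sequence of tests has slope $s$ if $\gamma_{m,n}(h/\sqrt n)\to 1-\Phi(z_\alpha-hs)$ as $n\to\infty$ for every $h\ge 0$. By local asymptotic normality of the model at $\theta=0$, the largest possible slope is $\sqrt{I_0}$, where $I_0=\int_{I^m}\omega_m^2(\mathbf{x})\,d\mathbf{x}$ is the Fisher information at $\theta=0$. The sequence $\{S_{m,n}\}_{n\ge1}$ is called Pitman optimal if its slope equals $\sqrt{I_0}$. *)

(* Defs.v *)
From HB Require Import structures.
From mathcomp Require Import all_boot all_order all_algebra.
From mathcomp Require Import all_classical all_reals all_analysis.

Set Implicit Arguments.
Unset Strict Implicit.
Unset Printing Implicit Defensive.
Import Order.TTheory GRing.Theory Num.Theory.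
Import numFieldNormedType.Exports.

Local Open Scope classical_set_scope.
Local Open Scope ring_scope.

Section tuple_cons_measure.
Context d (T : measurableType d) (R : realType) (n : nat).

Definition tuple_cons (p : T * n.-tuple T) : n.+1.-tuple T :=
  [tuple of p.1 :: p.2].

Definition tuple_uncons (t : n.+1.-tuple T) : T * n.-tuple T :=
  (thead t, [tuple of behead t]).

Lemma tuple_consK : cancel tuple_cons tuple_uncons.
Proof. by move=> [x t]; congr pair; apply/val_inj. Qed.

Lemma tuple_unconsK : cancel tuple_uncons tuple_cons.
Proof. by move=> t; rewrite [RHS]tuple_eta; apply/val_inj. Qed.

Lemma measurable_tuple_cons : measurable_fun [set: T * n.-tuple T] tuple_cons.
Proof. exact: measurable_cons. Qed.

Lemma measurable_tuple_uncons :
  measurable_fun [set: n.+1.-tuple T] tuple_uncons.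
Proof.
apply/measurable_fun_pairP; split; last exact: measurable_behead.
exact: (measurable_tnth ord0).
Qed.

Variables (mu : {sigma_finite_measure set T -> \bar R})
  (nu : {sigma_finite_measure set (n.-tuple T) -> \bar R}).

Definition cons_measure : set (n.+1.-tuple T) -> \bar R :=
  pushforward (mu \x nu)%E tuple_cons.

Let cons_measure0 : cons_measure set0 = 0%E.
Proof. by rewrite /cons_measure /pushforward preimage_set0 measure0. Qed.

Let cons_measure_ge0 A : (0 <= cons_measure A)%E.
Proof. by rewrite /cons_measure /pushforward; exact: measure_ge0. Qed.

Let cons_measure_sigma_additive : semi_sigma_additive cons_measure.
Proof.
exact: (@measure_semi_sigma_additive _ _ _
  (@measure_function_pushforward__canonical__measure_function_Measure
    _ _ _ _ _ (mu \x nu)%E _ measurable_tuple_cons)).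
Qed.

HB.instance Definition _ := isMeasure.Build _ _ _ cons_measure
  cons_measure0 cons_measure_ge0 cons_measure_sigma_additive.

Let cons_measure_sigma_finite : sigma_finite setT cons_measure.
Proof.
have /sigma_finiteP[F [TF ndF Foo]] := sigma_finiteT mu.
have /sigma_finiteP[G [TG ndG Goo]] := sigma_finiteT nu.
exists (fun k => tuple_uncons @^-1` (F k `*` G k)).
  rewrite -preimage_bigcup (_ : \bigcup_k _ = setT) ?preimage_setT//.
  rewrite -subTset => -[x y] _.
  have [i _ Fi] : (\bigcup_k F k) x by rewrite -TF.
  have [j _ Gj] : (\bigcup_k G k) y by rewrite -TG.
  exists (maxn i j) => //; split => /=.
    by move: Fi; exact/subsetPset/ndF/leq_maxl.
  by move: Gj; exact/subsetPset/ndG/leq_maxr.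
move=> k; have [? ?] := Foo k; have [? ?] := Goo k; split.
  by rewrite -[X in measurable X]setTI; apply: measurable_tuple_uncons => //;
     exact: measurableX.
rewrite /cons_measure /pushforward -comp_preimage.
rewrite (_ : _ \o _ = id) ?preimage_id; last first.
  by apply/funext => p /=; exact: tuple_consK.
by rewrite product_measure1E// lte_mul_pinfty// ge0_fin_numE.
Qed.

HB.instance Definition _ := Measure_isSigmaFinite.Build _ _ _ cons_measure
  cons_measure_sigma_finite.

End tuple_cons_measure.

(* The n-fold product measure, on n.-tuple T with its product sigma-algebra. *)
Fixpoint power_measure d (T : measurableType d) (R : realType)
    (mu : {sigma_finite_measure set T -> \bar R}) (n : nat) :
    {sigma_finite_measure set (n.-tuple T) -> \bar R} :=
  match n with
  | 0 => dirac [tuple]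
  | n'.+1 => cons_measure mu (power_measure mu n')
  end.

(* lebesgue_measure lives on measurableTypeR R; the same set function on R
   itself, whose measurable sets are by definition those of measurableTypeR R. *)
Section lebesgue_measure_on_R.
Context (R : realType).

Definition lebesgueR : set R -> \bar R := @lebesgue_measure R.

HB.instance Definition _ := isMeasure.Build _ _ _ lebesgueR
  (measure0 (@lebesgue_measure R)) (measure_ge0 (@lebesgue_measure R))
  (@measure_semi_sigma_additive _ _ _ (@lebesgue_measure R)).

HB.instance Definition _ := Measure_isSigmaFinite.Build _ _ _ lebesgueR
  (sigma_finiteT (@lebesgue_measure R)).

End lebesgue_measure_on_R.

Section model.
Context (R : realType).

Definition lebesgue_tuple (m : nat) :
    {sigma_finite_measure set (m.-tuple R) -> \bar R} :=
  power_measure (@lebesgueR R) m.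

Definition cube (m : nat) : set (m.-tuple R) :=
  [set x | forall j, 0 <= tnth x j <= 1].

Definition orthant (m : nat) (x : m.-tuple R) : set (m.-tuple R) :=
  [set y | forall j, tnth y j <= tnth x j].

Definition set_coord (m : nat) (x : m.-tuple R) (i : 'I_m) (t : R) :
    m.-tuple R :=
  [tuple if j == i then t else tnth x j | j < m].

Definition del_coord (m : nat) (x : m.-tuple R) (i : 'I_m) : m.-1.-tuple R :=
  [tuple tnth x (lift i j) | j < m.-1].

Definition partial (m : nat) (i : 'I_m) (f : m.-tuple R -> R) :
    m.-tuple R -> R :=
  fun x => derive1 (fun t => f (set_coord x i t)) (tnth x i).

Definition mixed_partial (m : nat) (s : seq 'I_m) (f : m.-tuple R -> R) :
    m.-tuple R -> R :=
  foldr (@partial m) f s.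

(* As partial returns a junk value where a derivative does not exist, existence
   of an iterated partial derivative at x asks for existence of the inner one
   on a neighbourhood of x along the line in which it is differentiated. *)
Fixpoint mixed_derivable (m : nat) (s : seq 'I_m) (f : m.-tuple R -> R)
    (x : m.-tuple R) : Prop :=
  if s is i :: s' then
    (\forall t \near tnth x i, mixed_derivable s' f (set_coord x i t)) /\
    derivable (fun t => mixed_partial s' f (set_coord x i t)) (tnth x i) 1
  else True.

(* Omega k is the dependence function of the k-dimensional model, k <= m; only
   its values on the cube matter. *)
Record dependence_conditions (m : nat) (Omega : forall k, k.-tuple R -> R)
    (omega : m.-tuple R -> R) : Prop := {
  dep_ge0 : forall k (x : k.-tuple R), (1 <= k <= m)%N ->
    cube x -> 0 <= Omega k x ;
  dep_face0 : forall k (x : k.-tuple R) (i : 'I_k), (1 <= k <= m)%N ->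
    cube x -> tnth x i = 0 -> Omega k x = 0 ;
  dep_edge1 : forall k (i : 'I_k) (t : R), (1 <= k <= m)%N ->
    0 <= t <= 1 -> Omega k (set_coord [tuple 1 | _ < k] i t) = 0 ;
  dep_face1 : forall k (x : k.-tuple R) (i : 'I_k), (2 <= k <= m)%N ->
    cube x -> tnth x i = 1 -> Omega k x = Omega k.-1 (del_coord x i) ;
  dep_mixed : {ae lebesgue_tuple m, forall x, cube x ->
    forall s : seq 'I_m, perm_eq s (enum 'I_m) ->
    mixed_derivable s (Omega m) x /\ mixed_partial s (Omega m) x = omega x} ;
  dep_measurable : measurable_fun (@cube m) omega ;
  dep_L2 : (\int[lebesgue_tuple m]_(x in @cube m) ((omega x ^+ 2)%:E) < +oo)%E ;
  dep_neq0 : ~ {ae lebesgue_tuple m, forall x, cube x -> omega x = 0} }.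

(* P theta has cdf F_theta and, with respect to Lebesgue measure, density
   1 + theta * omega on the cube and 0 outside. *)
Definition is_model (m : nat) (Omega : forall k, k.-tuple R -> R)
    (omega : m.-tuple R -> R) (P : R -> probability (m.-tuple R) R) : Prop :=
  dependence_conditions Omega omega /\
  exists2 theta0 : R, 0 < theta0 & forall theta, 0 <= theta <= theta0 ->
    (forall x, cube x -> P theta (orthant x) =
       (\prod_(j < m) tnth x j + theta * Omega m x)%:E) /\
    (forall A, measurable A -> P theta A =
       \int[lebesgue_tuple m]_(x in A `&` @cube m) (1 + theta * omega x)%:E)%E.

Definition fisher_information (m : nat) (omega : m.-tuple R -> R) : R :=
  \int[lebesgue_tuple m]_(x in @cube m) (omega x ^+ 2).

(* Rank of X_ij among X_1j, ..., X_nj. *)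
Definition rank (m n : nat) (X : n.-tuple (m.-tuple R)) (i : 'I_n) (j : 'I_m) :
    nat :=
  #|[pred k : 'I_n | tnth (tnth X k) j <= tnth (tnth X i) j]|.

Definition spearman_const (m n : nat) : R :=
  n%:R^-1 * \sum_(1 <= i < n.+1) i%:R ^+ m - (n.+1%:R / 2) ^+ m.

Definition spearman_stat (m n : nat) (X : n.-tuple (m.-tuple R)) : R :=
  (spearman_const m n)^-1 *
  (n%:R^-1 * \sum_(i < n) \prod_(j < m) (n.+1%:R - (rank X i j)%:R)
   - (n.+1%:R / 2) ^+ m).

Definition sigma2 (m : nat) : R :=
  m.+1%:R ^+ 2 / (2 ^+ m - m.+1%:R) ^+ 2 *
  ((4 / 3) ^+ m - m%:R / 3 - 1).

Definition Phi (x : R) : R := fine (normal_prob 0 1 `]-oo, x]).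

Definition normal_quantile (p : R) : R := xget 0 [set z | Phi z = p].

Definition power_function (m : nat) (P : R -> probability (m.-tuple R) R)
    (z : R) (n : nat) (theta : R) : R :=
  fine (power_measure (P theta) n
    [set X | z < Num.sqrt n%:R * spearman_stat X / Num.sqrt (sigma2 m)]).

Definition has_slope (gamma : nat -> R -> R) (z s : R) : Prop :=
  forall h, 0 <= h ->
    gamma n (h / Num.sqrt n%:R) @[n --> \oo] --> 1 - Phi (z - h * s).

Definition pitman_optimal (m : nat) (P : R -> probability (m.-tuple R) R)
    (omega : m.-tuple R -> R) (alpha : R) : Prop :=
  let z := normal_quantile (1 - alpha) in
  has_slope (power_function P z) z (Num.sqrt (fisher_information omega)).

End model.

(* Main.v *)
Require Import Defs.
From HB Require Import structures.
From mathcomp Require Import all_boot all_order all_algebra.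
From mathcomp Require Import all_classical all_reals all_analysis.
From mathcomp Require Import measurable_realfun.
From mathcomp Require Import zify ring lra.

Set Implicit Arguments.
Unset Strict Implicit.
Unset Printing Implicit Defensive.
Import Order.TTheory GRing.Theory Num.Theory.
Import numFieldNormedType.Exports.

Local Open Scope classical_set_scope.
Local Open Scope ring_scope.

(** Along theta = h / sqrt n the statistic is asymptotically an average of
    bounded i.i.d. terms, so its limiting power comes from a central limit
    theorem, and optimality becomes the equality case of the Cauchy-Schwarz
    inequality.

    _Linearisation._ Put N = n + 1. Each coordinate is uniform under every
    P theta ([margin_uniform]), so (N - R_ij) / N is close to 1 - X_ij. Expand
    the product of the (N - R_ij) / N to first order around the product of the
    1 - X_ij ([prod_expand]) and project the linear part on the single
    observations. This gives

      sqrt n (n^-1 sum_i prod_j (N - R_ij) / N - 2^-m)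
        = n^(-1/2) sum_i score (X_i) + remainder,

    with a bounded function [score]. The remainder consists of squares and of
    degenerate double sums; by second moments ([expect_sqr_row],
    [expect_sqr_ustat]) its L1 norm is O(n^(-1/2)) directly under the
    alternatives P (h / sqrt n) ([expect_remainder]). The kernels of the double
    sums are centred in one argument under every P theta and in the other under
    P 0 only; since expectations are affine in theta ([expect_theta]), the
    latter costs O(theta), which is small enough.

    _Central limit theorem._ Lindeberg's replacement of the summands by normal
    variables ([lindeberg]) bounds the error for test functions that are
    rescaled cubic splines; squeezing the indicator of a half-line between two
    of them yields the power limit 1 - Phi (z - h s) ([cvg_power_function]).
    Here s tau is the integral of score times omega and tau^2 that of score^2
    ([slope], [score_sd]).

    _Optimality._ Phi is injective, so optimality means s = sqrt I0, that is
    equality in Cauchy-Schwarz, that is omega = k score almost everywhere on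
    the cube with k >= 0 ([ae_eq_of_slope], [slope_eq_of_ae]). The score is
    explicit: 2^m score (x) is prod_j 2 (1 - x_j) - sum_j 2 (1 - x_j) + m - 1
    ([scoreE]), and integrated over the orthant below x this is the polynomial
    of the theorem ([expect0_orthant_score]). As the cdf is affine in theta,
    Omega is the integral of omega over orthants ([Omega_cross]), which gives
    the formula for Omega ([Omega_of_ae]). Conversely the mixed derivative of
    that polynomial is a multiple of the score ([mixed_partial_score],
    [ae_of_Omega]). *)

(** * Bounded measurable functions and their expectations *)

(** The bound holds everywhere, not just almost everywhere, so that a function
    is integrable under all the probability laws of the model at once. *)
Definition bm d (T : measurableType d) (R : realType) (f : T -> R) : Prop :=
  measurable_fun [set: T] f /\ exists M, forall x, `|f x| <= M.

Section bounded_measurable.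
Context d (T : measurableType d) (R : realType).
Implicit Types f g : T -> R.

Lemma bm_cst (c : R) : bm (fun _ : T => c).
Proof. by split=> //; exists `|c|. Qed.

Lemma bmD f g : bm f -> bm g -> bm (fun x => f x + g x).
Proof.
move=> [mf [M fM]] [mg [N gN]]; split; first exact: measurable_funD.
by exists (M + N) => x; rewrite (le_trans (ler_normD _ _))// lerD.
Qed.

Lemma bmM f g : bm f -> bm g -> bm (fun x => f x * g x).
Proof.
move=> [mf [M fM]] [mg [N gN]]; split; first exact: measurable_funM.
by exists (M * N) => x; rewrite normrM ler_pM.
Qed.

Lemma bmN f : bm f -> bm (fun x => - f x).
Proof.
move=> bf; have := bmM (bm_cst (-1)) bf.
by congr bm; apply/funext => x; rewrite mulN1r.
Qed.

Lemma bmB f g : bm f -> bm g -> bm (fun x => f x - g x).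
Proof. by move=> bf bg; apply: bmD => //; exact: bmN. Qed.

Lemma bm_sum I (r : seq I) (P : pred I) (F : I -> T -> R) :
  (forall i, bm (F i)) -> bm (fun x => \sum_(i <- r | P i) F i x).
Proof.
move=> bF; elim: r => [|i r IH].
  by have := bm_cst 0; congr bm; apply/funext => x; rewrite big_nil.
have : bm (fun x => (if P i then F i x else 0) +
    \sum_(j <- r | P j) F j x).
  by apply: bmD => //; case: (P i) => //; exact: bm_cst.
by congr bm; apply/funext => x; rewrite big_cons; case: (P i); rewrite ?add0r.
Qed.

Lemma bm_prod I (r : seq I) (P : pred I) (F : I -> T -> R) :
  (forall i, bm (F i)) -> bm (fun x => \prod_(i <- r | P i) F i x).
Proof.
move=> bF; elim: r => [|i r IH].
  by have := bm_cst 1; congr bm; apply/funext => x; rewrite big_nil.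
have : bm (fun x => (if P i then F i x else 1) *
    \prod_(j <- r | P j) F j x).
  by apply: bmM => //; case: (P i) => //; exact: bm_cst.
by congr bm; apply/funext => x; rewrite big_cons; case: (P i); rewrite ?mul1r.
Qed.

Lemma bmX f n : bm f -> bm (fun x => f x ^+ n).
Proof.
move=> bf; elim: n => [|n IH]; first exact: bm_cst.
by have := bmM bf IH; congr bm; apply/funext => x; rewrite exprS.
Qed.

Lemma bm_norm f : bm f -> bm (fun x => `|f x|).
Proof.
move=> [mf [M fM]]; split; first exact: measurableT_comp.
by exists M => x; rewrite normr_id.
Qed.

Lemma bm_indic (A : set T) : measurable A -> bm (\1_A : T -> R).
Proof.
move=> mA; split; first exact: measurable_indic.
by exists 1 => x; rewrite indicE; case: (_ \in _); rewrite ?normr0 ?normr1.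
Qed.

Lemma bm_comp d' (T' : measurableType d') (h : T' -> T) f :
  measurable_fun setT h -> bm f -> bm (fun x => f (h x)).
Proof.
by move=> mh [mf [M fM]]; split; [exact: measurableT_comp|exists M => x].
Qed.

End bounded_measurable.

Section expectation.
Context d (T : measurableType d) (R : realType).
Variable mu : {measure set T -> \bar R}.
Hypothesis mu1 : mu setT = 1%E.
Implicit Types f g : T -> R.

Lemma bm_integrable f : bm f -> mu.-integrable setT (EFin \o f).
Proof.
move=> [mf [M fM]]; apply: measurable_bounded_integrable => //.
  by rewrite mu1 ltry.
by exists M; split=> [|N MN x _]; [exact: num_real|exact: (le_trans (fM x) (ltW MN))].
Qed.

Lemma bm_EFin f : bm f -> (\int[mu]_x (f x)%:E = (\int[mu]_x f x)%:E)%E.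
Proof.
by move=> /bm_integrable fi; rewrite /Rintegral fineK//; exact: integrable_fin_num.
Qed.

Lemma expect_cst (c : R) : \int[mu]_x c = c.
Proof. by rewrite Rintegral_cst// mu1 mulr1. Qed.

Lemma expectD f g : bm f -> bm g ->
  \int[mu]_x (f x + g x) = \int[mu]_x f x + \int[mu]_x g x.
Proof. by move=> bf bg; rewrite RintegralD//; exact: bm_integrable. Qed.

Lemma expectB f g : bm f -> bm g ->
  \int[mu]_x (f x - g x) = \int[mu]_x f x - \int[mu]_x g x.
Proof. by move=> bf bg; rewrite RintegralB//; exact: bm_integrable. Qed.

Lemma expectZl (c : R) f : bm f -> \int[mu]_x (c * f x) = c * \int[mu]_x f x.
Proof. by move=> bf; rewrite RintegralZl//; exact: bm_integrable. Qed.

Lemma expectZr (c : R) f : bm f -> \int[mu]_x (f x * c) = (\int[mu]_x f x) * c.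
Proof. by move=> bf; rewrite RintegralZr//; exact: bm_integrable. Qed.

Lemma expect_sum I (r : seq I) (P : pred I) (F : I -> T -> R) :
  (forall i, bm (F i)) ->
  \int[mu]_x (\sum_(i <- r | P i) F i x) = \sum_(i <- r | P i) \int[mu]_x F i x.
Proof.
move=> bF; elim: r => [|i r IH].
  by under eq_Rintegral do rewrite big_nil; rewrite big_nil expect_cst.
rewrite big_cons; case: ifPn => Pi.
  under eq_Rintegral do rewrite big_cons Pi.
  by rewrite expectD ?IH//; exact: bm_sum.
by under eq_Rintegral do rewrite big_cons (negbTE Pi).
Qed.

Lemma expect_le f g : bm f -> bm g -> (forall x, f x <= g x) ->
  \int[mu]_x f x <= \int[mu]_x g x.
Proof. by move=> bf bg fg; apply: le_Rintegral => //; exact: bm_integrable. Qed.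

Lemma expect_le_cst f (c : R) : bm f -> (forall x, f x <= c) ->
  \int[mu]_x f x <= c.
Proof.
by move=> bf fc; rewrite -[leRHS]expect_cst; apply: expect_le => //; exact: bm_cst.
Qed.

Lemma expect_norm f : bm f -> `|\int[mu]_x f x| <= \int[mu]_x `|f x|.
Proof. by move=> bf; apply: le_normr_Rintegral => //; exact: bm_integrable. Qed.

Lemma expect_norm_le f (c : R) : bm f -> (forall x, `|f x| <= c) ->
  `|\int[mu]_x f x| <= c.
Proof.
move=> bf fc; rewrite (le_trans (expect_norm bf))//.
by apply: expect_le_cst => //; exact: bm_norm.
Qed.

Lemma expect_indic (A : set T) : measurable A ->
  \int[mu]_x (\1_A x : R) = fine (mu A).
Proof. by move=> mA; rewrite /Rintegral integral_indic// setIT. Qed.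

End expectation.

(** * Iterated expectations *)

Section fubini_bounded.
Context d1 (T1 : measurableType d1) d2 (T2 : measurableType d2) (R : realType).
Variables (mu : {sigma_finite_measure set T1 -> \bar R})
  (nu : {sigma_finite_measure set T2 -> \bar R}).
Hypotheses (mu1 : mu setT = 1%E) (nu1 : nu setT = 1%E).

Lemma product_measure_setT : (mu \x nu)%E setT = 1%E.
Proof.
have e : (mu setT * nu setT = 1)%E by rewrite mu1 nu1 mule1.
by rewrite -setXTT product_measure1E.
Qed.

Lemma bm_section1 (F : T1 * T2 -> R) x : bm F -> bm (fun y => F (x, y)).
Proof. by apply: bm_comp; exact: measurable_pair1. Qed.

Lemma bm_section2 (F : T1 * T2 -> R) y : bm F -> bm (fun x => F (x, y)).
Proof. by apply: bm_comp; exact: measurable_pair2. Qed.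

Let int12 (F : T1 * T2 -> R) : bm F ->
  (mu \x nu)%E.-integrable setT (EFin \o F).
Proof. by move=> bF; apply: bm_integrable => //; exact: product_measure_setT. Qed.

Lemma bm_expect2 (F : T1 * T2 -> R) : bm F ->
  bm (fun x => \int[nu]_y F (x, y)).
Proof.
move=> bF; split.
  apply: (@measurableT_comp _ _ _ _ _ _ fine) => //.
  exact: (measurable_fubini_F (int12 bF)).
have [_ [M FM]] := bF; exists M => x.
by apply: (expect_norm_le nu1) => //; exact: bm_section1.
Qed.

Lemma bm_expect1 (F : T1 * T2 -> R) : bm F ->
  bm (fun y => \int[mu]_x F (x, y)).
Proof.
move=> bF; split.
  apply: (@measurableT_comp _ _ _ _ _ _ fine) => //.
  exact: (measurable_fubini_G (int12 bF)).
have [_ [M FM]] := bF; exists M => x.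
by apply: (expect_norm_le mu1) => //; exact: bm_section2.
Qed.

Lemma expect_prod12 (F : T1 * T2 -> R) : bm F ->
  \int[(mu \x nu)%E]_z F z = \int[mu]_x \int[nu]_y F (x, y).
Proof.
move=> bF; rewrite /Rintegral -(integral12_prod_meas1 (int12 bF)).
congr fine; apply: eq_integral => x _; rewrite /fubini_F /=.
by rewrite (bm_EFin nu1 (bm_section1 _ bF)).
Qed.

Lemma expect_prod21 (F : T1 * T2 -> R) : bm F ->
  \int[(mu \x nu)%E]_z F z = \int[nu]_y \int[mu]_x F (x, y).
Proof.
move=> bF; rewrite /Rintegral -(integral21_prod_meas1 (int12 bF)).
congr fine; apply: eq_integral => y _; rewrite /fubini_G /=.
by rewrite (bm_EFin mu1 (bm_section2 _ bF)).
Qed.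

Lemma expect_swap (F : T1 * T2 -> R) : bm F ->
  \int[mu]_x \int[nu]_y F (x, y) = \int[nu]_y \int[mu]_x F (x, y).
Proof. by move=> bF; rewrite -expect_prod12// expect_prod21. Qed.

End fubini_bounded.

(** * Resampling one observation of an i.i.d. sample *)

Section power_measure_theory.
Context d (T : measurableType d) (R : realType).
Variable mu : {sigma_finite_measure set T -> \bar R}.

Lemma power_measure_setT n : mu setT = 1%E -> power_measure mu n setT = 1%E.
Proof.
move=> mu1; elim: n => [|n IH] /=; first by rewrite diracE in_setT.
by rewrite /cons_measure /pushforward preimage_setT; exact: product_measure_setT.
Qed.

Hypothesis mu1 : mu setT = 1%E.

Lemma expect_cons n (F : n.+1.-tuple T -> R) : bm F ->
  \int[power_measure mu n.+1]_X F X =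
  \int[mu]_x \int[power_measure mu n]_X F (tuple_cons (x, X)).
Proof.
move=> bF; have mc := @measurable_tuple_cons _ T n.
have p1 := power_measure_setT n mu1.
rewrite -(expect_prod12 mu1 p1 (bm_comp mc bF)).
rewrite /Rintegral/=; congr fine.
rewrite /cons_measure integral_pushforward ?preimage_setT//.
  by apply/measurable_EFinP; case: bF.
exact: (bm_integrable (product_measure_setT mu1 p1) (bm_comp mc bF)).
Qed.

Lemma expect_cons21 n (F : n.+1.-tuple T -> R) : bm F ->
  \int[power_measure mu n.+1]_X F X =
  \int[power_measure mu n]_X \int[mu]_x F (tuple_cons (x, X)).
Proof.
move=> bF; rewrite expect_cons//.
have bF' := bm_comp (@measurable_tuple_cons _ T n) bF.
exact: (expect_swap mu1 (power_measure_setT n mu1) bF').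
Qed.

Definition upd n (X : n.-tuple T) (i : 'I_n) (y : T) : n.-tuple T :=
  [tuple if k == i then y else tnth X k | k < n].

Lemma tnth_upd n (X : n.-tuple T) i y k :
  tnth (upd X i y) k = if k == i then y else tnth X k.
Proof. by rewrite tnth_mktuple. Qed.

Lemma measurable_upd n (i : 'I_n) :
  measurable_fun [set: n.-tuple T * T] (fun p => upd p.1 i p.2).
Proof.
apply/measurable_fun_tnthP => k.
have [->|ki] := eqVneq k i.
  by rewrite (_ : _ \o _ = snd)//; apply/funext => p /=; rewrite tnth_upd eqxx.
rewrite (_ : _ \o _ = (fun X => tnth X k) \o fst); last first.
  by apply/funext => p /=; rewrite tnth_upd (negbTE ki).
by apply: measurableT_comp => //; exact: measurable_tnth.
Qed.

Lemma upd_cons0 n x (X : n.-tuple T) y :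
  upd (tuple_cons (x, X)) ord0 y = tuple_cons (y, X).
Proof.
apply: eq_from_tnth => k; rewrite tnth_upd.
case: (unliftP ord0 k) => [j ->|->]; last by rewrite eqxx.
by rewrite eq_sym (negbTE (neq_lift _ _)) /tuple_cons !tnthS.
Qed.

Lemma upd_consS n x (X : n.-tuple T) i y :
  upd (tuple_cons (x, X)) (lift ord0 i) y = tuple_cons (x, upd X i y).
Proof.
apply: eq_from_tnth => k; rewrite tnth_upd.
case: (unliftP ord0 k) => [j ->|->]; last by rewrite (negbTE (neq_lift _ _)).
by rewrite (inj_eq (@lift_inj _ _)) /tuple_cons !tnthS tnth_upd.
Qed.

Lemma bm_upd n (F : n.-tuple T -> R) i : bm F ->
  bm (fun p : n.-tuple T * T => F (upd p.1 i p.2)).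
Proof. by apply: bm_comp; exact: measurable_upd. Qed.

(** A sample in which one observation is replaced by an independent copy has
    the law of the original sample. Conditioning on all the observations but
    one is always expressed in this way below. *)
Lemma expect_resample n (i : 'I_n) (F : n.-tuple T -> R) : bm F ->
  \int[power_measure mu n]_X F X =
  \int[power_measure mu n]_X \int[mu]_y F (upd X i y).
Proof.
elim: n i F => [[]//|n IH] i F bF.
have bF2 : bm (fun X => \int[mu]_y F (upd X i y)).
  exact: (bm_expect2 (power_measure_setT n.+1 mu1) mu1 (bm_upd i bF)).
rewrite (expect_cons bF2).
case: (unliftP ord0 i) => [j ij|i0].
- rewrite expect_cons//; apply: eq_Rintegral => x _.
  have mx : measurable_fun [set: n.-tuple T] (fun X => tuple_cons (x, X)).
    apply: measurableT_comp; first exact: measurable_tuple_cons.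
    exact: measurable_pair1.
  rewrite (IH j _ (bm_comp mx bF)); apply: eq_Rintegral => X _.
  by apply: eq_Rintegral => y _; rewrite ij upd_consS.
- rewrite expect_cons21// i0.
  under [in RHS]eq_Rintegral => x _.
    under eq_Rintegral => X _.
      under eq_Rintegral do rewrite upd_cons0.
      over.
    over.
  by rewrite expect_cst.
Qed.

Lemma bm_tnth n (i : 'I_n) (f : T -> R) : bm f ->
  bm (fun X : n.-tuple T => f (tnth X i)).
Proof. by apply: bm_comp; exact: measurable_tnth. Qed.

Lemma bm_tnth2 n (i k : 'I_n) (f : T * T -> R) : bm f ->
  bm (fun X : n.-tuple T => f (tnth X i, tnth X k)).
Proof.
apply: bm_comp; apply/measurable_fun_pairP.
by split; exact: measurable_tnth.
Qed.

End power_measure_theory.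

(** * Second moments of degenerate double sums *)

Lemma sum_delta (R : pzRingType) n (i : 'I_n) :
  \sum_(j < n) (j == i)%:R = 1 :> R.
Proof. by rewrite (bigD1 i)//= eqxx big1 ?addr0// => j /negbTE ->. Qed.

Section degenerate_sums.
Context d (T : measurableType d) (R : realType).
Variable mu : {sigma_finite_measure set T -> \bar R}.
Hypothesis mu1 : mu setT = 1%E.
Variables (psi : T * T -> R) (B : R).
Hypotheses (bpsi : bm psi) (psiB : forall p, `|psi p| <= B).
Hypothesis psi0 : forall x, \int[mu]_y psi (x, y) = 0.

Let B0 : 0 <= B. Proof. exact: le_trans (normr_ge0 _) (psiB (point, point)). Qed.

Let En n := (power_measure_setT n mu1).

(** Integrating out the k-th observation first annihilates the product. *)
Lemma expect_degenerate n (i k : 'I_n) (G : n.-tuple T -> R) : k != i -> bm G ->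
  (forall X y, G (upd X k y) = G X) ->
  \int[power_measure mu n]_X (psi (tnth X i, tnth X k) * G X) = 0.
Proof.
move=> ki bG Gk; rewrite (expect_resample mu1 k); last first.
  by apply: bmM => //; exact: bm_tnth2.
under eq_Rintegral => X _.
  under eq_Rintegral do rewrite !tnth_upd eqxx eq_sym (negbTE ki) Gk.
  rewrite (expectZr mu1); last exact: bm_section1.
  rewrite psi0 mul0r.
  over.
by rewrite (expect_cst (En n)).
Qed.

(** Given the i-th observation the summands are centred and independent, so
    only the diagonal of the square contributes. *)
Lemma expect_sqr_row n (i : 'I_n) :
  \int[power_measure mu n]_X
    ((\sum_(k < n | k != i) psi (tnth X i, tnth X k)) ^+ 2) <= B ^+ 2 * n%:R.
Proof.
have bp k : bm (fun X : n.-tuple T => psi (tnth X i, tnth X k)).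
  exact: bm_tnth2.
under eq_Rintegral do rewrite expr2 big_distrlr.
rewrite (expect_sum (En n)); last first.
  by move=> k; apply: bm_sum => k'; exact: bmM.
apply: (@le_trans _ _ (\sum_(k < n | k != i) B ^+ 2)); last first.
  have -> : B ^+ 2 * n%:R = \sum_(k < n) B ^+ 2.
    by rewrite sumr_const card_ord mulr_natr.
  by rewrite big_mkcond ler_sum// => k _; case: ifP; rewrite ?sqr_ge0.
apply: ler_sum => k ki; rewrite (expect_sum (En n)); last by move=> k'; exact: bmM.
rewrite (bigD1 k)//= big1 ?addr0 => [|k' /andP[k'i k'k]].
  apply: (expect_le_cst (En n)); first exact: bmM.
  by move=> X; rewrite -expr2 -real_normK ?num_real// ler_sqr ?nnegrE.
under eq_Rintegral do rewrite mulrC.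
apply: expect_degenerate => // X y.
by rewrite !tnth_upd ![_ == k']eq_sym (negbTE k'i) (negbTE k'k).
Qed.

Variable eta : R.
Hypothesis psi_eta : forall y, `|\int[mu]_x psi (x, y)| <= eta.

Let eta0 : 0 <= eta. Proof. exact: le_trans (normr_ge0 _) (psi_eta point). Qed.

Let a n (i k : 'I_n) (X : n.-tuple T) : R :=
  if k == i then 0 else psi (tnth X i, tnth X k).

Let bma n (i k : 'I_n) : bm (@a n i k).
Proof.
rewrite /a; have [_|_] := eqVneq k i; first exact: bm_cst.
exact: bm_tnth2.
Qed.

(** For i <> k and i' <> k' the product has mean zero as soon as k or k' occurs
    only once among the four indices. What remains are equal pairs, swapped
    pairs, and k = k' with i <> i'; in the last case integrating out both i and
    i' leaves the mean of a square bounded by eta ^+ 2. *)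
Let expect_pair n (i k i' k' : 'I_n) :
  \int[power_measure mu n]_X (a i k X * a i' k' X) <=
  B ^+ 2 * ((i' == i)%:R * (k' == k)%:R) +
  B ^+ 2 * ((i' == k)%:R * (k' == i)%:R) + eta ^+ 2 * (k' == k)%:R.
Proof.
set rhs := (X in _ <= X).
have rhs0 : 0 <= rhs.
  by rewrite /rhs !addr_ge0// mulr_ge0 ?sqr_ge0// ?mulr_ge0.
have [ki|ki] := eqVneq k i.
  by under eq_Rintegral do rewrite /a ki eqxx mul0r; rewrite (expect_cst (En n)).
have [ki'|ki'] := eqVneq k' i'.
  by under eq_Rintegral do rewrite {2}/a ki' eqxx mulr0; rewrite (expect_cst (En n)).
have leB2 : \int[power_measure mu n]_X (a i k X * a i' k' X) <= B ^+ 2.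
  apply: (expect_le_cst (En n)); first exact: bmM.
  move=> X; rewrite /a (negbTE ki) (negbTE ki') (le_trans (ler_norm _))//.
  by rewrite normrM expr2 ler_pM.
have [kk'|kk'] := eqVneq k' k; last first.
  have [ik'|ik'] := eqVneq i' k; last first.
    under eq_Rintegral do rewrite {1}/a (negbTE ki).
    rewrite expect_degenerate// => X y.
    by rewrite /a !tnth_upd (negbTE kk') (negbTE ik').
  have [k'i|k'i] := eqVneq k' i.
    rewrite (le_trans leB2)// /rhs ik' k'i !eqxx !mulr1 -addrA addrCA lerDl.
    by rewrite addr_ge0// mulr_ge0 ?sqr_ge0// mulr_ge0.
  under eq_Rintegral do rewrite mulrC {1}/a (negbTE ki').
  rewrite expect_degenerate// => X y.
  by rewrite /a !tnth_upd ![_ == k']eq_sym (negbTE k'i) (negbTE kk').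
have [ii'|ii'] := eqVneq i' i.
  rewrite (le_trans leB2)// /rhs ii' kk' !eqxx !mulr1 -addrA lerDl.
  by rewrite addr_ge0// mulr_ge0 ?sqr_ge0// mulr_ge0.
subst k'.
have bpsi1 : bm (fun y => \int[mu]_x psi (x, y)) by exact: (bm_expect1 mu1 mu1).
rewrite (expect_resample mu1 i); last exact: bmM.
have step X : \int[mu]_y (a i k (upd X i y) * a i' k (upd X i y)) =
    (\int[mu]_x psi (x, tnth X k)) * psi (tnth X i', tnth X k).
  rewrite -(expectZr mu1); last exact: bm_section2.
  apply: eq_Rintegral => y _.
  by rewrite /a (negbTE ki) (negbTE ki') !tnth_upd eqxx (negbTE ki) (negbTE ii').
under eq_Rintegral do rewrite step.
rewrite (expect_resample mu1 i'); last first.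
  by apply: bmM; [exact: (bm_tnth k bpsi1)|exact: bm_tnth2].
have step2 X : \int[mu]_y ((\int[mu]_x psi (x, tnth (upd X i' y) k)) *
    psi (tnth (upd X i' y) i', tnth (upd X i' y) k)) =
    (\int[mu]_x psi (x, tnth X k)) ^+ 2.
  rewrite expr2 -[RHS](expectZl mu1); last exact: bm_section2.
  by apply: eq_Rintegral => y _; rewrite !tnth_upd eqxx (negbTE ki').
under eq_Rintegral do rewrite step2.
apply: (@le_trans _ _ (eta ^+ 2)).
  apply: (expect_le_cst (En n)); first exact: (bmX 2 (bm_tnth k bpsi1)).
  by move=> X; rewrite -real_normK ?num_real// ler_sqr ?nnegrE.
by rewrite /rhs eqxx !mulr1 lerDr addr_ge0// mulr_ge0 ?sqr_ge0// mulr_ge0.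
Qed.

(** Of the n^4 products of two summands, n^2 come from equal pairs, n^2 from
    swapped pairs, and n^3 from pairs with the same second index. The last ones
    are of the same total order n^2 when eta is of order n^(-1/2). *)
Lemma expect_sqr_ustat n :
  \int[power_measure mu n]_X
    ((\sum_(i < n) \sum_(k < n | k != i) psi (tnth X i, tnth X k)) ^+ 2)
  <= 2 * B ^+ 2 * n%:R ^+ 2 + eta ^+ 2 * n%:R ^+ 3.
Proof.
have ba2 (p q : 'I_n * 'I_n) : bm (fun X => a p.1 p.2 X * a q.1 q.2 X).
  exact: bmM.
under eq_Rintegral => X _.
  under eq_bigr do rewrite big_mkcond.
  rewrite pair_bigA expr2 big_distrlr/=.
  under eq_bigr => p _.
    under eq_bigr => q _.
      rewrite (_ : _ * _ = a p.1 p.2 X * a q.1 q.2 X); last first.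
        by rewrite /a !if_neg.
      over.
    over.
  over.
rewrite (expect_sum (En n)); last by move=> p; apply: bm_sum.
apply: (@le_trans _ _ (\sum_(p : 'I_n * 'I_n) \sum_(q : 'I_n * 'I_n)
  (B ^+ 2 * ((q.1 == p.1)%:R * (q.2 == p.2)%:R) +
  B ^+ 2 * ((q.1 == p.2)%:R * (q.2 == p.1)%:R) + eta ^+ 2 * (q.2 == p.2)%:R))).
  apply: ler_sum => p _; rewrite (expect_sum (En n))//.
  by apply: ler_sum => q _; exact: expect_pair.
have delta2 (i k : 'I_n) :
    \sum_(q : 'I_n * 'I_n) ((q.1 == i)%:R * (q.2 == k)%:R) = 1 :> R.
  rewrite -(pair_bigA _ (fun i' k' => (i' == i)%:R * (k' == k)%:R))/=.
  under eq_bigr do rewrite -mulr_sumr sum_delta mulr1.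
  exact: sum_delta.
have delta1 (k : 'I_n) :
    \sum_(q : 'I_n * 'I_n) (q.2 == k)%:R = n%:R :> R.
  rewrite -(pair_bigA _ (fun i' k' => (k' == k)%:R))/=.
  under eq_bigr do rewrite sum_delta.
  by rewrite sumr_const card_ord.
under eq_bigr => p _.
  rewrite !big_split/= -!mulr_sumr !delta2 delta1 !mulr1.
  over.
rewrite sumr_const card_prod card_ord -[_ *+ (n * n)]mulr_natr natrM.
by rewrite le_eqVlt; apply/predU1P; left; ring.
Qed.

End degenerate_sums.

(** * Cubic spline approximations of a step *)

Section cubic_spline.
Context (R : realType).
Implicit Types x y z k : R.

Definition ppart x : R := Num.max x 0.

Lemma ppart_cases x : (0 <= x /\ ppart x = x) \/ (x <= 0 /\ ppart x = 0).
Proof.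
rewrite /ppart; have [x0|x0] := leP 0 x; first by left.
by right; rewrite ltW.
Qed.

(** The third difference of x_+^3 / 6, which is the distribution function of a
    sum of three independent uniform variables: a twice continuously
    differentiable step that rises from 0 to 1 on [0, 3]. Its two derivatives,
    defined next, are the third differences of x_+^2 / 2 and of x_+. *)
Definition step_spline x : R := (ppart x ^+ 3 - 3 * ppart (x - 1) ^+ 3
  + 3 * ppart (x - 2) ^+ 3 - ppart (x - 3) ^+ 3) / 6.

Definition step_spline1 x : R := (ppart x ^+ 2 - 3 * ppart (x - 1) ^+ 2
  + 3 * ppart (x - 2) ^+ 2 - ppart (x - 3) ^+ 2) / 2.

Definition step_spline2 x : R := ppart x - 3 * ppart (x - 1)
  + 3 * ppart (x - 2) - ppart (x - 3).

Lemma step_spline_le0 x : x <= 0 -> step_spline x = 0.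
Proof.
move=> x0; rewrite /step_spline.
case: (ppart_cases x) => -[? ->]; case: (ppart_cases (x - 1)) => -[? ->];
case: (ppart_cases (x - 2)) => -[? ->]; case: (ppart_cases (x - 3)) => -[? ->];
  try lra.
all: have -> : x = 0 by lra.
all: lra.
Qed.

Lemma step_spline_ge3 x : 3 <= x -> step_spline x = 1.
Proof.
move=> x0; rewrite /step_spline.
case: (ppart_cases x) => -[? ->]; last lra.
case: (ppart_cases (x - 1)) => -[? ->]; last lra.
case: (ppart_cases (x - 2)) => -[? ->]; last lra.
case: (ppart_cases (x - 3)) => -[? ->]; first by field.
have -> : x = 3 by lra.
lra.
Qed.

Lemma step_spline_bounds x : 0 <= step_spline x <= 1.
Proof.
have [x0|x0] := leP x 0; first by rewrite step_spline_le0// lexx ler01.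
have [x3|x3] := leP 3 x; first by rewrite step_spline_ge3// ler01 lexx.
rewrite /step_spline.
case: (ppart_cases x) => -[? ->]; last lra.
case: (ppart_cases (x - 3)) => -[? ->]; first lra.
case: (ppart_cases (x - 1)) => -[? ->]; last first.
  case: (ppart_cases (x - 2)) => -[? ->]; first lra.
  have : 0 <= x ^+ 3 by rewrite exprn_ge0.
  have : x ^+ 3 <= 1 by rewrite exprn_ile1//; lra.
  by lra.
case: (ppart_cases (x - 2)) => -[? ->].
  pose u := x - 2; have -> : x = u + 2 by rewrite /u; ring.
  have u0 : 0 <= u by rewrite /u.
  have u1 : u <= 1 by rewrite /u; lra.
  have : 0 <= (1 - u) ^+ 3 by rewrite exprn_ge0//; lra.
  have : (1 - u) ^+ 3 <= 1 by rewrite exprn_ile1//; lra.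
  have -> : (1 - u) ^+ 3 = 1 - 3 * u + 3 * u ^+ 2 - u ^+ 3 by ring.
  have -> : (u + 2) ^+ 3 - 3 * (u + 2 - 1) ^+ 3 + 3 * (u + 2 - 2) ^+ 3 - 0 ^+ 3
    = 5 + 3 * u - 3 * u ^+ 2 + u ^+ 3 by ring.
  by move=> *; lra.
pose u := x - 1; have -> : x = u + 1 by rewrite /u; ring.
have u0 : 0 <= u by rewrite /u.
have u1 : u <= 1 by rewrite /u; lra.
have : 0 <= u ^+ 2 by rewrite exprn_ge0.
have : u ^+ 2 <= 1 by rewrite exprn_ile1.
have : 0 <= u ^+ 3 by rewrite exprn_ge0.
have : u ^+ 3 <= u ^+ 2 by rewrite exprS ler_piMl// exprn_ge0.
have : 0 <= (1 - u) ^+ 2 * (1 + 2 * u) by rewrite mulr_ge0 ?sqr_ge0//; lra.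
have -> : (1 - u) ^+ 2 * (1 + 2 * u) = 1 - 3 * u ^+ 2 + 2 * u ^+ 3 by ring.
have -> : (u + 1) ^+ 3 - 3 * (u + 1 - 1) ^+ 3 + 3 * 0 ^+ 3 - 0 ^+ 3
    = 1 + 3 * u + 3 * u ^+ 2 - 2 * u ^+ 3 by ring.
by move=> *; lra.
Qed.

(** The second derivative 6 x_+ of x_+^3 is 6-Lipschitz, whence the constant 1.
    Distinguishing the signs of x and x + y makes the bound algebraic. *)
Lemma ppart_taylor x y :
  `|ppart (x + y) ^+ 3 - ppart x ^+ 3 - 3 * ppart x ^+ 2 * y
    - 3 * ppart x * y ^+ 2| <= `|y| ^+ 3.
Proof.
rewrite -normrX.
case: (ppart_cases x) => -[x0 ->]; case: (ppart_cases (x + y)) => -[xy ->].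
- have -> : (x + y) ^+ 3 - x ^+ 3 - 3 * x ^+ 2 * y - 3 * x * y ^+ 2 = y ^+ 3.
    by ring.
  by [].
- have -> : 0 ^+ 3 - x ^+ 3 - 3 * x ^+ 2 * y - 3 * x * y ^+ 2 =
    y ^+ 3 + (- (x + y)) ^+ 3 by ring.
  have u0 : 0 <= - (x + y) by lra.
  have y0 : 0 <= - y by lra.
  have : (- (x + y)) ^+ 3 <= (- y) ^+ 3.
    by rewrite lerXn2r// ?nnegrE//; lra.
  have : 0 <= (- (x + y)) ^+ 3 by rewrite exprn_ge0.
  rewrite -(normrN (y ^+ 3)).
  have -> : - y ^+ 3 = (- y) ^+ 3 by ring.
  have y30 : 0 <= (- y) ^+ 3 by rewrite exprn_ge0.
  rewrite (ger0_norm y30) ler_norml.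
  have -> : y ^+ 3 = - ((- y) ^+ 3) by ring.
  by move=> *; lra.
- have -> : (x + y) ^+ 3 - 0 ^+ 3 - 3 * 0 ^+ 2 * y - 3 * 0 * y ^+ 2 =
    (x + y) ^+ 3 by ring.
  have y0 : 0 <= y by lra.
  rewrite !ger0_norm ?exprn_ge0// lerXn2r// ?nnegrE//; lra.
- by rewrite !(expr0n, mulr0, mul0r, subr0)/= normr0.
Qed.

Lemma step_spline_taylor x y :
  `|step_spline (x + y) - step_spline x - step_spline1 x * y
    - step_spline2 x * y ^+ 2 / 2| <= 4 / 3 * `|y| ^+ 3.
Proof.
have := ppart_taylor (x - 3) y; have := ppart_taylor (x - 2) y.
have := ppart_taylor (x - 1) y; have := ppart_taylor x y.
rewrite /step_spline /step_spline1 /step_spline2.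
have E c : x - c + y = x + y - c by ring.
rewrite !E !ler_norml => /andP[? ?] /andP[? ?] /andP[? ?] /andP[? ?].
by apply/andP; split; lra.
Qed.

Lemma step_spline1_bounded x : `|step_spline1 x| <= 12.
Proof.
rewrite /step_spline1 ler_norml.
case: (ppart_cases x) => -[x0 ->]; last first.
  case: (ppart_cases (x - 1)) => -[? ->]; first lra.
  case: (ppart_cases (x - 2)) => -[? ->]; first lra.
  by case: (ppart_cases (x - 3)) => -[? ->]; lra.
case: (ppart_cases (x - 3)) => -[x3 ->].
  case: (ppart_cases (x - 1)) => -[? ->]; last lra.
  case: (ppart_cases (x - 2)) => -[? ->]; last lra.
  have -> : x ^+ 2 - 3 * (x - 1) ^+ 2 + 3 * (x - 2) ^+ 2 - (x - 3) ^+ 2 = 0.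
    by ring.
  by lra.
have sq t : ppart (x - t) ^+ 2 = 0 \/ 0 <= x - t /\ ppart (x - t) = x - t.
  case: (ppart_cases (x - t)) => -[? E]; [by right|left].
  by rewrite E expr0n.
have bx : 0 <= x ^+ 2 <= 9.
  rewrite sqr_ge0/=; have -> : 9 = 3 ^+ 2 :> R by ring.
  by rewrite lerXn2r// ?nnegrE//; lra.
have b1 : 0 <= ppart (x - 1) ^+ 2 <= 4.
  rewrite sqr_ge0/=; have [->//|[? ->]] := sq 1.
  have -> : 4 = 2 ^+ 2 :> R by ring.
  by rewrite lerXn2r// ?nnegrE//; lra.
have b2 : 0 <= ppart (x - 2) ^+ 2 <= 1.
  rewrite sqr_ge0/=; have [->//|[? ->]] := sq 2.
  by rewrite exprn_ile1//; lra.
by lra.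
Qed.

Lemma step_spline2_bounded x : `|step_spline2 x| <= 12.
Proof.
rewrite /step_spline2 ler_norml.
by case: (ppart_cases x) => -[? ->]; case: (ppart_cases (x - 1)) => -[? ->];
case: (ppart_cases (x - 2)) => -[? ->]; case: (ppart_cases (x - 3)) => -[? ->];
  lra.
Qed.

(** Test functions, with f1 and f2 in the role of the first two derivatives of
    f. They are tied to f by the Taylor bound only: this is what the replacement
    argument uses, and it survives averaging over translations. *)
Definition C3 (K : R) (f f1 f2 : R -> R) : Prop :=
  [/\ measurable_fun setT f, measurable_fun setT f1, measurable_fun setT f2,
     [/\ (forall x, 0 <= f x <= 1), (forall x, `|f1 x| <= K) &
      (forall x, `|f2 x| <= K)] &
     forall x y, `|f (x + y) - f x - f1 x * y - f2 x * y ^+ 2 / 2| <=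
       K * `|y| ^+ 3].

Lemma measurable_ppart (a b n : R) i :
  measurable_fun setT (fun x => ppart (a * (x - b) - n) ^+ i).
Proof.
apply: measurable_funX; apply: measurable_maxr => //.
by apply: measurable_funB => //; apply: measurable_funM => //;
   exact: measurable_funB.
Qed.

(** The constant 12 (1 + k)^3 dominates the bounds 12 k and 12 k^2 on the
    rescaled derivatives and the bound 4 / 3 k^3 on the Taylor remainder. *)
Lemma C3_step z k : 0 <= k ->
  C3 (12 * (1 + k) ^+ 3)
    (fun x => step_spline (k * (x - z)))
    (fun x => k * step_spline1 (k * (x - z)))
    (fun x => k ^+ 2 * step_spline2 (k * (x - z))).
Proof.
move=> k0.
have m0 n i : measurable_fun setT (fun x => ppart (k * (x - z) - n) ^+ i).
  exact: measurable_ppart.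
have m1 i : measurable_fun setT (fun x => ppart (k * (x - z)) ^+ i).
  have := m0 0 i; congr measurable_fun; apply/funext => x; by rewrite subr0.
have k1 : 1 <= (1 + k) by lra.
have k2 : k <= (1 + k) ^+ 3.
  by rewrite (le_trans (_ : k <= 1 + k))//; [lra|rewrite ler_eXnr].
have k3 : k ^+ 2 <= (1 + k) ^+ 3.
  rewrite (le_trans (_ : _ <= (1 + k) ^+ 2))//.
    by rewrite lerXn2r// ?nnegrE//; lra.
  by rewrite ler_weXn2l.
have k4 : k ^+ 3 <= (1 + k) ^+ 3 by rewrite lerXn2r// ?nnegrE//; lra.
split.
- apply: measurable_funM => //; apply: measurable_funB => //.
  apply: measurable_funD; last by apply: measurable_funM.
  by apply: measurable_funB => //; apply: measurable_funM.
- apply: measurable_funM => //; apply: measurable_funM => //.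
  apply: measurable_funB => //.
  apply: measurable_funD; last by apply: measurable_funM.
  by apply: measurable_funB => //; apply: measurable_funM.
- apply: measurable_funM => //.
  have m2 n : measurable_fun setT (fun x => ppart (k * (x - z) - n)).
    exact: (m0 n 1%N).
  apply: measurable_funB => //.
  apply: measurable_funD; last by apply: measurable_funM.
  apply: measurable_funB; first exact: (m1 1%N).
  by apply: measurable_funM.
- split=> x; first exact: step_spline_bounds.
    rewrite normrM mulrC ler_pM// ?step_spline1_bounded// ger0_norm//.
  rewrite normrM mulrC ler_pM// ?step_spline2_bounded// ger0_norm//.
  by rewrite sqr_ge0.
- move=> x y; rewrite (_ : k * (x + y - z) = k * (x - z) + k * y); last ring.
  have := step_spline_taylor (k * (x - z)) (k * y).
  set a := step_spline (k * (x - z) + _); set b := step_spline _.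
  set c := step_spline1 _; set e := step_spline2 _.
  rewrite (_ : c * (k * y) = k * c * y); last ring.
  rewrite (_ : e * (k * y) ^+ 2 = k ^+ 2 * e * y ^+ 2); last ring.
  move=> /le_trans; apply; rewrite normrM exprMn mulrA ler_wpM2r ?exprn_ge0//.
  rewrite (ger0_norm k0).
  have : 0 <= (1 + k) ^+ 3 by rewrite exprn_ge0//; lra.
  by lra.
Qed.

Lemma C3_ge0 K f f1 f2 : C3 K f f1 f2 -> 0 <= K.
Proof. by case=> _ _ _ [_ /(_ 0) h _] _; exact: le_trans h. Qed.

(** Points at distance at least 1 are compared by 0 <= f <= 1, closer ones by
    the Taylor bound. *)
Lemma C3_lipschitz K f f1 f2 x y : C3 K f f1 f2 ->
  `|f y - f x| <= (1 + 3 * K) * `|y - x|.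
Proof.
move=> cf; have K0 := C3_ge0 cf; case: cf => _ _ _ [f01 f1K f2K] T.
have h : `|f y - f x| <= 1.
  by move: (f01 x) (f01 y); rewrite ler_norml; lra.
have [yx|yx] := leP 1 `|y - x|.
  rewrite (le_trans h)// (le_trans yx)// ler_peMl// lerDl; lra.
have := T x (y - x); rewrite subrKC => t.
set u := y - x in yx t *.
have -> : f y - f x = (f y - f x - f1 x * u - f2 x * u ^+ 2 / 2)
  + (f1 x * u + f2 x * u ^+ 2 / 2) by ring.
rewrite (le_trans (ler_normD _ _))//.
have u0 : 0 <= `|u| by [].
have u2 : `|u| ^+ 2 <= `|u| by rewrite expr2 ler_piMl// ltW.
have u3 : `|u| ^+ 3 <= `|u|.
  by rewrite exprS ler_piMr// exprn_ile1// ltW.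
have a1 : `|f1 x * u| <= K * `|u| by rewrite normrM ler_wpM2r.
have a2 : `|f2 x * u ^+ 2 / 2| <= K * `|u|.
  rewrite -mulrA normrM ler_pM//.
  have -> : `|u ^+ 2 / 2| = `|u| ^+ 2 / 2.
    by rewrite ger0_norm ?real_normK ?num_real// divr_ge0 ?sqr_ge0.
  by lra.
have a3 : K * `|u| ^+ 3 <= K * `|u| by rewrite ler_wpM2l.
have := ler_normD (f1 x * u) (f2 x * u ^+ 2 / 2).
by lra.
Qed.

End cubic_spline.

(** * Moments of the centred normal density *)

Section gaussian_moments.
Context (R : realType).
Notation leb := (@lebesgue_measure R).
Variable s : R.
Hypothesis s0 : 0 < s.

Let sn0 : s != 0. Proof. by rewrite gt_eqF. Qed.
Notation p := (normal_pdf 0 s).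

Let pE x : p x = normal_peak s * expR (- x ^+ 2 / (s ^+ 2 *+ 2)).
Proof. by rewrite normal_pdfE// /normal_fun subr0. Qed.

Lemma is_derive_normal_pdf (x : R) : is_derive x 1 p (- (x / s ^+ 2 * p x)).
Proof.
rewrite (_ : p = fun y => normal_peak s *
    expR ((- (s ^+ 2 *+ 2)^-1) * (y * y))); last first.
  by apply/funext => y; rewrite pE mulNr [_ * (y * y)]mulNr [(y * y) * _]mulrC.
apply: is_derive_eq.
rewrite /= !scaler1 /GRing.scale/=.
set e := expR _; field.
by rewrite sn0.
Qed.

(** With u = |x| / s, the cube of u / 2 <= 1 + u^2 / 8 <= exp (u^2 / 8) absorbs
    |x|^3 into the normal density of standard deviation 2 s. In 16 = 2^3 * 2
    the last factor is the ratio of the peaks of the two densities. *)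
Lemma normal_pdf_cube x :
  `|x| ^+ 3 * p x <= 16 * s ^+ 3 * normal_pdf 0 (2 * s) x.
Proof.
rewrite pE normal_pdfE ?mulf_neq0// /normal_fun subr0.
have -> : normal_peak (2 * s) = normal_peak s / 2.
  rewrite /normal_peak.
  have -> : (2 * s) ^+ 2 * pi *+ 2 = 2 ^+ 2 * (s ^+ 2 * pi *+ 2) by ring.
  by rewrite sqrtrM ?sqr_ge0// sqrtr_sqr ger0_norm// invfM mulrC.
pose u := `|x| / s.
have xu : `|x| = u * s by rewrite /u divfK.
have u0 : 0 <= u by rewrite divr_ge0// ltW.
have x2 : x ^+ 2 = (u * s) ^+ 2 by rewrite -xu real_normK ?num_real.
have -> : - x ^+ 2 / (s ^+ 2 *+ 2) = - u ^+ 2 / 2.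
  by rewrite x2; field; rewrite sn0.
have -> : - x ^+ 2 / ((2 * s) ^+ 2 *+ 2) = - u ^+ 2 / 8.
  by rewrite x2; field; rewrite sn0.
rewrite xu; set P := normal_peak s.
have P0 : 0 <= P by exact: normal_peak_ge0.
suff h : u ^+ 3 * expR (- u ^+ 2 / 2) <= 8 * expR (- u ^+ 2 / 8).
  have := ler_wpM2l (mulr_ge0 P0 (exprn_ge0 3 (ltW s0))) h.
  set a := expR _; set b := expR _.
  have -> : P * s ^+ 3 * (u ^+ 3 * a) = (u * s) ^+ 3 * (P * a) by ring.
  by have -> : P * s ^+ 3 * (8 * b) = 16 * s ^+ 3 * (P / 2 * b) by field.
have h1 : u / 2 <= expR (u ^+ 2 / 8).
  apply: le_trans (expR_ge1Dx _).
  have : 0 <= (u - 2) ^+ 2 by rewrite sqr_ge0.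
  have -> : (u - 2) ^+ 2 = u ^+ 2 - 4 * u + 4 by ring.
  by lra.
have h2 : (u / 2) ^+ 3 <= expR (u ^+ 2 / 8) ^+ 3.
  by rewrite lerXn2r// nnegrE ?expR_ge0// divr_ge0.
have -> : - u ^+ 2 / 8 = u ^+ 2 / 8 * 3%:R + (- u ^+ 2 / 2) by field.
rewrite expRD expRM_natr mulrA ler_wpM2r ?expR_ge0//.
have : (u / 2) ^+ 3 = u ^+ 3 / 8 by field.
by move: h2; lra.
Qed.

Lemma integrable_cube_pdf : leb.-integrable setT (EFin \o (fun x => `|x| ^+ 3 * p x)).
Proof.
have := integrableZl measurableT (16 * s ^+ 3) (integrable_normal_pdf 0 (2 * s)).
apply: le_integrable => //.
  apply/measurable_EFinP; apply: measurable_funM; last exact: measurable_normal_pdf.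
  by apply: measurable_funX; exact: normr_measurable.
move=> x _ /=; rewrite lee_fin ger0_norm; last first.
  by rewrite mulr_ge0 ?exprn_ge0// normal_pdf_ge0.
rewrite [leRHS]ger0_norm ?normal_pdf_cube//.
by rewrite !mulr_ge0 ?exprn_ge0 ?normal_pdf_ge0// ltW.
Qed.

Lemma integral_cube_pdf : \int[leb]_x (`|x| ^+ 3 * p x) <= 16 * s ^+ 3.
Proof.
have i2 := integrable_normal_pdf 0 (2 * s).
have -> : 16 * s ^+ 3 = \int[leb]_x (16 * s ^+ 3 * normal_pdf 0 (2 * s) x).
  rewrite RintegralZl//; rewrite /Rintegral integral_normal_pdf/=.
  by rewrite mulr1.
apply: le_Rintegral => //.
- exact: integrable_cube_pdf.
- exact: (integrableZl measurableT (16 * s ^+ 3) i2).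
- by move=> x _; exact: normal_pdf_cube.
Qed.

Lemma integrable_pow_pdf n : (n <= 3)%N ->
  leb.-integrable setT (EFin \o (fun x => x ^+ n * p x)).
Proof.
move=> n3.
have := integrableD measurableT (integrable_normal_pdf 0 s) integrable_cube_pdf.
apply: le_integrable => //.
  apply/measurable_EFinP; apply: measurable_funM; last exact: measurable_normal_pdf.
  exact: measurable_funX.
move=> x _ /=; rewrite lee_fin normrM normrX.
have p0 : 0 <= p x by exact: normal_pdf_ge0.
rewrite [leRHS]ger0_norm ?addr_ge0// ?mulr_ge0 ?exprn_ge0//.
rewrite (ger0_norm p0) -[X in X + _]mul1r -mulrDl ler_wpM2r//.
have [x1|x1] := leP 1 `|x|.
  by rewrite (le_trans (ler_weXn2l _ n3))// lerDr.
by rewrite (le_trans (exprn_ile1 _ _ (ltW x1)))// lerDl exprn_ge0.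
Qed.

Lemma cvg_integral_itv (f : R -> R) : leb.-integrable setT (EFin \o f) ->
  \int[leb]_(x in `[- n%:R, n%:R]) f x @[n --> \oo] --> \int[leb]_x f x.
Proof.
move=> fi; apply: fine_cvg.
rewrite fineK; last exact: (integrable_fin_num measurableT fi).
pose f_ n : R -> \bar R := (EFin \o f) \_ `[- n%:R, n%:R].
have := @dominated_convergence _ _ _ leb setT measurableT f_ (EFin \o f)
  (abse \o (EFin \o f)).
case.
- move=> n; apply: (iffLR (measurable_restrictT _ (measurable_itv _))).
  by apply: measurable_funTS; exact: measurable_int fi.
- exact: measurable_int fi.
- apply: aeW => x _; apply: cvg_near_cst; near=> n.
  rewrite /f_ patchE mem_set//= in_itv/= -ler_norml.
  near: n; exact: nbhs_infty_ger.
- exact: integrable_abse.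
- apply: aeW => x n _; rewrite /f_ patchE; case: ifP => // _.
  by rewrite (_ : point = 0%E) // abse0 abse_ge0.
move=> _ _; apply: cvg_trans; apply: near_eq_cvg; near=> n.
by rewrite [RHS]integral_mkcond.
Unshelve. all: by end_near. Qed.

Lemma Rintegral_FTC (F f : R -> R) (a b : R) : a < b ->
  continuous f -> (forall x : R, is_derive x 1 F (f x)) ->
  \int[leb]_(x in `[a, b]) f x = F b - F a.
Proof.
move=> ab cf dF.
have cF : continuous F.
  by move=> x; apply/differentiable_continuous/derivable1_diffP; apply: ex_derive.
rewrite /Rintegral (@continuous_FTC2 _ f F)//.
- exact: continuous_subspaceT.
- split.
  + by move=> x _; have ? := dF x; apply: ex_derive.
  + by apply: cvg_at_right_filter; exact: cF.
  + by apply: cvg_at_left_filter; exact: cF.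
- by move=> x _; have ? := dF x; rewrite derive1E derive_val.
Qed.

Let cp : continuous p. Proof. exact: continuous_normal_pdf. Qed.

(** The function x p has the even primitive - s^2 p. *)
Lemma integral_id_pdf : \int[leb]_x (x * p x) = 0.
Proof.
have i1 := @integrable_pow_pdf 1 isT.
have /cvg_lim <- // := cvg_integral_itv i1.
apply: cvg_lim => //; apply: cvg_near_cst; near=> n.
have n0 : 0 < n%:R :> R by rewrite ltr0n; near: n; exact: nbhs_infty_gt.
have nn : - n%:R < n%:R :> R by rewrite (lt_trans _ n0)// oppr_lt0.
have cf : continuous (fun x : R => x * p x).
  by move=> x; apply: cvgM; [exact: cvg_id|exact: cp].
have df (x : R) : is_derive x 1 (fun x : R => - s ^+ 2 * p x) (x * p x).
  have ? := is_derive_normal_pdf x.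
  by apply: is_derive_eq; rewrite /GRing.scale/=; field.
by rewrite (Rintegral_FTC nn cf df) !pE sqrrN subrr.
Unshelve. all: by end_near. Qed.

(** The function (x^2 - s^2) p has primitive - s^2 x p, which vanishes at
    infinity by [normal_pdf_cube]. *)
Lemma integral_sqr_pdf : \int[leb]_x (x ^+ 2 * p x) = s ^+ 2.
Proof.
have i0 := @integrable_pow_pdf 0 isT.
have i2 := @integrable_pow_pdf 2 isT.
have ip : leb.-integrable setT (EFin \o (fun x => s ^+ 2 * p x)).
  exact: (integrableZl measurableT (s ^+ 2) (integrable_normal_pdf 0 s)).
have h1 : \int[leb]_x (s ^+ 2 * p x) = s ^+ 2.
  rewrite RintegralZl//; last exact: integrable_normal_pdf.
  by rewrite /Rintegral integral_normal_pdf/= mulr1.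
rewrite -h1; apply/eqP; rewrite -subr_eq0 -RintegralB//; apply/eqP.
have iB := integrableB measurableT i2 ip.
have /cvg_lim <- // := cvg_integral_itv iB.
apply: cvg_lim => //.
have H n : (0 < n)%N -> \int[leb]_(x in `[- n%:R, n%:R])
    (x ^+ 2 * p x - s ^+ 2 * p x) = - (2 * s ^+ 2) * (n%:R * p n%:R).
  move=> n0; have n0' : 0 < n%:R :> R by rewrite ltr0n.
  have nn : - n%:R < n%:R :> R by rewrite (lt_trans _ n0')// oppr_lt0.
  have cf : continuous (fun x : R => x ^+ 2 * p x - s ^+ 2 * p x).
    move=> x; apply: cvgB; apply: cvgM; try exact: cp; try exact: cvg_cst.
    exact: sqr_continuous.
  have df (x : R) : is_derive x 1 (fun x : R => - s ^+ 2 * (x * p x))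
      (x ^+ 2 * p x - s ^+ 2 * p x).
    have ? := is_derive_normal_pdf x.
    by apply: is_derive_eq; rewrite /GRing.scale/=; field.
  by rewrite (Rintegral_FTC nn cf df) !pE sqrrN; ring.
pose K := 16 * s ^+ 3 * normal_peak (2 * s).
have K0 : 0 <= K by rewrite !mulr_ge0 ?normal_peak_ge0 ?exprn_ge0// ltW.
have np n : (0 < n)%N -> 0 <= n%:R * p n%:R <= K * n%:R^-1.
  move=> n0; have n1 : 1 <= n%:R :> R by rewrite ler1n.
  rewrite mulr_ge0 ?normal_pdf_ge0//= ler_pdivlMr; last by rewrite ltr0n.
  have := normal_pdf_cube n%:R; rewrite ger0_norm// => h.
  apply: (@le_trans _ _ (n%:R ^+ 3 * p n%:R)).
    rewrite mulrAC -expr2 ler_wpM2r ?normal_pdf_ge0//.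
    by rewrite ler_weXn2l.
  rewrite (le_trans h)// /K ler_wpM2l ?normal_pdf_ub ?mulf_neq0//.
  by rewrite mulr_ge0// exprn_ge0// ltW.
have lim0 : n%:R * p n%:R @[n --> \oo] --> (0 : R).
  apply: (@squeeze_cvgr _ _ _ _ (fun=> 0) (fun n : nat => K * n%:R^-1)).
  - by near=> n; apply: np; near: n; exact: nbhs_infty_gt.
  - exact: cvg_cst.
  - rewrite -(mulr0 K); apply: cvgM; [exact: cvg_cst|apply/gtr0_cvgV0].
      by near=> n; rewrite ltr0n; near: n; exact: nbhs_infty_gt.
    exact: cvgr_idn.
have lim1 : - (2 * s ^+ 2) * (n%:R * p n%:R) @[n --> \oo] -->
    - (2 * s ^+ 2) * (0 : R) by apply: cvgM => //; exact: cvg_cst.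
rewrite mulr0 in lim1; apply: cvg_trans lim1; apply: near_eq_cvg; near=> n.
have n0 : (0 < n)%N by near: n; exact: nbhs_infty_gt.
by rewrite (H n n0).
Unshelve. all: by end_near. Qed.

End gaussian_moments.

(** * Convolution of centred normal laws *)

(** The measure nu is dominated by mu and p is almost everywhere equal to its
    Radon-Nikodym derivative, for which the change of variables is known. *)
Lemma expect_density d (T : measurableType d) (R : realType)
    (nu : probability T R) (mu : {sigma_finite_measure set T -> \bar R})
    (p : T -> R) (f : T -> R) :
  mu.-integrable setT (EFin \o p) ->
  (forall A, measurable A -> nu A = \int[mu]_(x in A) (p x)%:E)%E ->
  bm f -> \int[nu]_x f x = \int[mu]_x (f x * p x).
Proof.
move=> ip nup bf.
have mp : measurable_fun setT (EFin \o p) := measurable_int _ ip.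
have numu : nu `<< mu.
  apply/null_content_dominatesP => A mA muA0; rewrite nup//.
  apply: null_set_integral => //; exact: measurable_funTS.
have fi : nu.-integrable setT (EFin \o f).
  by apply: bm_integrable => //; exact: probability_setT.
rewrite /Rintegral -(Radon_Nikodym_change_of_variables numu measurableT fi).
congr fine; under [in RHS]eq_integral do rewrite EFinM.
apply: ae_eq_integral => //.
- by apply: emeasurable_funM => //; exact: measurable_int fi.
- by apply: emeasurable_funM => //; exact: measurable_int fi.
apply: ae_eqe_mul2l; apply/ae_eq_sym/integral_ae_eq => //.
move=> E _ mE; rewrite -Radon_Nikodym_integral//=.
by rewrite -nup.
Qed.

Section gaussian_semigroup.
Context (R : realType).
Notation leb := (@lebesgue_measure R).

Lemma normal_prob_setT (s : R) : normal_prob 0 s setT = 1%E.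
Proof. exact: probability_setT. Qed.

Lemma expect_normal (s : R) (f : R -> R) : bm f ->
  \int[normal_prob 0 s]_x f x = \int[leb]_x (f x * normal_pdf 0 s x).
Proof.
apply: (@expect_density _ _ R (normal_prob 0 s) leb (normal_pdf 0 s) f) => //.
exact: integrable_normal_pdf.
Qed.

(** Lebesgue measure is translation invariant because it is determined by its
    values on intervals. *)
Lemma integral_shift (a : R) (F : R -> \bar R) :
  measurable_fun setT F -> (forall x, 0 <= F x)%E ->
  (\int[leb]_x F x = \int[leb]_x F (x - a)%R)%E.
Proof.
move=> mF F0; pose phi : R -> measurableTypeR R := fun x => x - a.
have mphi : measurable_fun setT phi by exact: measurable_funB.
have E (A : set R) : measurable A -> leb A = pushforward leb phi A.
  apply: lebesgue_measure_unique => _ [[b c]] _ <- /=.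
  rewrite /pushforward (_ : phi @^-1` _ = `]b + a, c + a]%classic); last first.
    by apply/seteqP; split => x /=; rewrite !in_itv/= ltrBrDr lerBlDr.
  rewrite !lebesgue_measure_itv/= !lte_fin ltrD2r -!EFinB.
  by rewrite opprD addrACA subrr addr0.
rewrite (eq_measure_integral (pushforward leb phi)); last by move=> A mA _; exact: E.
by rewrite ge0_integral_pushforward ?preimage_setT.
Qed.

(** Completing the square in w: the integrand is the density on the right times
    a normal density in w, of mean u s2^2 / (s1^2 + s2^2) and variance
    s1^2 s2^2 / (s1^2 + s2^2). *)
Lemma normal_pdf_convolution (s1 s2 u : R) : 0 < s1 -> 0 < s2 ->
  (\int[leb]_w (normal_pdf 0 s1 (u - w)%R * normal_pdf 0 s2 w)%:E =
   (normal_pdf 0 (Num.sqrt (s1 ^+ 2 + s2 ^+ 2)) u)%:E)%E.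
Proof.
move=> s10 s20; set t := Num.sqrt _.
have q0 : 0 < s1 ^+ 2 + s2 ^+ 2 by rewrite addr_gt0// exprn_gt0.
have t0 : 0 < t by rewrite sqrtr_gt0.
have t2 : t ^+ 2 = s1 ^+ 2 + s2 ^+ 2 by rewrite sqr_sqrtr// ltW.
pose s := s1 * s2 / t; pose m := u * s2 ^+ 2 / t ^+ 2.
have s0 : 0 < s by rewrite divr_gt0// mulr_gt0.
have E w : normal_pdf 0 s1 (u - w) * normal_pdf 0 s2 w =
    normal_pdf 0 t u * normal_pdf m s w.
  have peakM : normal_peak s1 * normal_peak s2 = normal_peak t * normal_peak s.
    rewrite /normal_peak -!invfM; congr (_^-1).
    have P (a : R) : 0 <= a ^+ 2 * pi *+ 2.
      by rewrite mulrn_wge0// mulr_ge0 ?sqr_ge0// pi_ge0.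
    rewrite -!sqrtrM//; congr Num.sqrt.
    rewrite /s; field; by rewrite gt_eqF.
  rewrite !normal_pdfE ?gt_eqF// /normal_fun !subr0.
  rewrite mulrACA [RHS]mulrACA peakM; congr (_ * _).
  rewrite -!expRD; congr expR.
  rewrite !mulNr.
  have -> : (w - m) ^+ 2 / (s ^+ 2 *+ 2) =
    (w * (s1 ^+ 2 + s2 ^+ 2) - u * s2 ^+ 2) ^+ 2 /
      (s1 ^+ 2 * s2 ^+ 2 * (s1 ^+ 2 + s2 ^+ 2) *+ 2).
    by rewrite /m /s -t2; field; rewrite !gt_eqF.
  rewrite t2; field; by rewrite !gt_eqF// exprn_gt0.
under eq_integral do rewrite E EFinM.
rewrite integralZl//; last exact: integrable_normal_pdf.
by rewrite integral_normal_pdf mule1.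
Qed.

(** The sum of two independent centred normal variables is normal: translate
    the inner integral, exchange the two integrals and convolve the densities. *)
Lemma expect_normal_comp (s1 s2 x : R) (f : R -> R) : 0 < s1 -> 0 < s2 ->
  measurable_fun setT f -> (forall y, 0 <= f y <= 1) ->
  \int[normal_prob 0 s2]_w \int[normal_prob 0 s1]_v f (x + w + v) =
  \int[normal_prob 0 (Num.sqrt (s1 ^+ 2 + s2 ^+ 2))]_u f (x + u).
Proof.
move=> s10 s20 mf f01.
have f0 y : 0 <= f y by case/andP: (f01 y).
have bf : bm f.
  by split=> //; exists 1 => y; rewrite ger0_norm//; case/andP: (f01 y).
have bfx y : bm (fun v : R => f (y + v)).
  by apply: bm_comp bf; apply: measurable_funD.
have bfG : bm (fun w : R => \int[normal_prob 0 s1]_v f (x + w + v)).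
  have := @bm_expect2 _ _ _ _ R (normal_prob 0 s2) (normal_prob 0 s1)
    (normal_prob_setT s2) (normal_prob_setT s1)
    (fun z : R * R => f (x + z.1 + z.2)).
  apply; apply: bm_comp bf; apply: measurable_funD => //.
  exact: measurable_funD.
rewrite (expect_normal s2 bfG) (expect_normal _ (bfx x)) /Rintegral; congr fine.
have mp s : measurable_fun setT (normal_pdf (0 : R) s).
  exact: measurable_normal_pdf.
have inner w : ((\int[normal_prob 0 s1]_v f (x + w + v))%:E =
    \int[leb]_u (f (x + u) * normal_pdf 0 s1 (u - w))%:E)%E.
  rewrite (expect_normal s1 (bfx (x + w))).
  have fi : leb.-integrable setT
      (EFin \o (fun v => f (x + w + v) * normal_pdf 0 s1 v)).
    have mg := measurable_funM (proj1 (bfx (x + w))) (mp s1).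
    apply: le_integrable (integrable_normal_pdf 0 s1); first exact: measurableT.
      exact/measurable_EFinP.
    move=> v _ /=; rewrite lee_fin normrM ler_piMl//.
    by rewrite ger0_norm//; case/andP: (f01 (x + w + v)).
  rewrite /Rintegral fineK; last exact: (integrable_fin_num measurableT fi).
  rewrite (@integral_shift w (fun v => (f (x + w + v) * normal_pdf 0 s1 v)%:E)).
  - apply: eq_integral => u _ /=.
    by have -> : x + w + (u - w) = x + u by ring.
  - exact: measurable_int fi.
  - by move=> v; rewrite lee_fin mulr_ge0// normal_pdf_ge0.
transitivity (\int[leb]_w \int[leb]_u
    (f (x + u) * (normal_pdf 0 s1 (u - w) * normal_pdf 0 s2 w))%:E)%E.
  apply: eq_integral => w _; rewrite EFinM inner.
  rewrite -ge0_integralZr ?lee_fin ?normal_pdf_ge0//.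
  - by apply: eq_integral => u _; rewrite -EFinM mulrA.
  - apply/measurable_EFinP; apply: measurable_funM.
      exact: (proj1 (bfx x)).
    by apply: measurableT_comp => //; exact: measurable_funB.
  - by move=> u _; rewrite lee_fin mulr_ge0// normal_pdf_ge0.
rewrite (@fubini_tonelli _ _ _ _ _ leb leb (fun z : R * R =>
  (f (x + z.2) * (normal_pdf 0 s1 (z.2 - z.1) * normal_pdf 0 s2 z.1))%:E)); last 2 first.
- apply/measurable_EFinP; apply: measurable_funM.
    by apply: measurableT_comp => //; exact: measurable_funD.
  apply: measurable_funM; apply: measurableT_comp => //.
  exact: measurable_funB.
- by move=> z; rewrite lee_fin !mulr_ge0// normal_pdf_ge0.
apply: eq_integral => u _ /=.
under eq_integral do rewrite EFinM.
rewrite ge0_integralZl ?lee_fin//.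
- by rewrite normal_pdf_convolution.
- apply/measurable_EFinP.
  have mu1 : measurable_fun setT (fun w : R => normal_pdf 0 s1 (u - w)).
    by apply: measurableT_comp => //; exact: measurable_funB.
  exact: (measurable_funM mu1 (mp s2)).
- by move=> w _; rewrite lee_fin mulr_ge0// normal_pdf_ge0.
Qed.

End gaussian_semigroup.

(** * Lindeberg's replacement bound *)

Section lindeberg.
Context (R : realType).
Notation leb := (@lebesgue_measure R).

(** The form in which the replacement step takes its test function: unlike in
    [C3] the Taylor coefficients exist point by point, so that Gaussian averages
    of a test function qualify at once. *)
Definition taylor3 (K : R) (h : R -> R) : Prop :=
  [/\ measurable_fun setT h, (forall x, 0 <= h x <= 1) &
    forall x, exists a b, [/\ `|a| <= K, `|b| <= K &
      forall y, `|h (x + y) - h x - a * y - b * y ^+ 2 / 2| <= K * `|y| ^+ 3]].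

Lemma bm_01 (h : R -> R) : measurable_fun setT h ->
  (forall x, 0 <= h x <= 1) -> bm h.
Proof.
move=> mh h01; split=> //; exists 1 => x.
by rewrite ger0_norm; case/andP: (h01 x).
Qed.

Lemma C3_taylor3 (K : R) (f f1 f2 : R -> R) : C3 K f f1 f2 -> taylor3 K f.
Proof.
by case=> mf mf1 mf2 [f01 f1K f2K] T; split=> // x; exists (f1 x), (f2 x).
Qed.

Lemma bm_shift (h : R -> R) (x : R) : bm h -> bm (fun y : R => h (x + y) : R).
Proof. by apply: bm_comp; exact: measurable_funD. Qed.

Lemma C3_bm (K : R) (f f1 f2 : R -> R) : C3 K f f1 f2 -> [/\ bm f, bm f1 & bm f2].
Proof.
case=> mf mf1 mf2 [f01 f1K f2K] _; split; first exact: bm_01.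
  by split=> //; exists K.
by split=> //; exists K.
Qed.

(** The averages of f1 and f2 are Taylor coefficients of the average of f, with
    the same remainder constant. *)
Lemma taylor3_average (K : R) (f f1 f2 : R -> R) (s : R) : C3 K f f1 f2 ->
  taylor3 K (fun x => \int[normal_prob 0 s]_w f (x + w)).
Proof.
move=> cf; have [bf bf1 bf2] := C3_bm cf.
case: cf => mf mf1 mf2 [f01 f1K f2K] T.
have n1 := normal_prob_setT s.
have bs (h : R -> R) x : bm h -> bm (fun w : R => h (x + w)).
  exact: bm_shift.
split.
- have := @bm_expect2 _ _ _ _ R (normal_prob 0 1) (normal_prob 0 s)
    (normal_prob_setT 1) n1 (fun z : R * R => f (z.1 + z.2)).
  case=> //; apply: bm_comp bf; exact: measurable_funD.
- move=> x; rewrite Rintegral_ge0/=; last by move=> w _; case/andP: (f01 (x + w)).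
  apply: (expect_le_cst n1); first exact: bs.
  by move=> w; case/andP: (f01 (x + w)).
move=> x; exists (\int[normal_prob 0 s]_w f1 (x + w)),
  (\int[normal_prob 0 s]_w f2 (x + w)); split.
- by apply: (expect_norm_le n1) => //; exact: bs.
- by apply: (expect_norm_le n1) => //; exact: bs.
move=> y; rewrite -(expectB n1); [|exact: bs..].
rewrite -(expectZr n1); last exact: bs.
rewrite -(expectB n1); last 2 first.
- by apply: bmB; exact: bs.
- by apply: bmM; [exact: bs|exact: bm_cst].
have b2 := bs _ x bf2.
rewrite -mulrA -(expectZr n1) // -(expectB n1); last 2 first.
- apply: bmB; first by apply: bmB; exact: bs.
  by apply: bmM; [exact: bs|exact: bm_cst].
- by apply: bmM; [exact: bs|exact: bm_cst].
apply: (expect_norm_le n1).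
- apply: bmB; last by apply: bmM; [exact: bs|exact: bm_cst].
  apply: bmB; last by apply: bmM; [exact: bs|exact: bm_cst].
  by apply: bmB; exact: bs.
- move=> w; have := T (x + w) y; rewrite -(mulrA (f2 _)).
  by have -> : x + w + y = x + y + w by ring.
Qed.

Section step.
Context d (T : measurableType d).
Variable mu : {sigma_finite_measure set T -> \bar R}.
Hypothesis mu1 : mu setT = 1%E.
Variables (xi : T -> R) (b s delta : R).
Hypotheses (bxi : bm xi) (xib : forall x, `|xi x| <= b) (s0 : 0 < s).
Hypotheses (xi0 : \int[mu]_x xi x = 0)
  (xi2 : `|\int[mu]_x (xi x ^+ 2) - s ^+ 2| <= delta).

Let eps K := K * (delta / 2 + b ^+ 3 + 16 * s ^+ 3).

(** Expand h at x to second order in both integrals: the first moments vanish,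
    the second moments differ by at most delta, and the cubic remainders are at
    most K b^3 and 16 K s^3. *)
Lemma lindeberg_step (K : R) (h : R -> R) (x : R) : taylor3 K h ->
  `|\int[mu]_y h (x + xi y) - \int[normal_prob 0 s]_w h (x + w)| <= eps K.
Proof.
move=> [mh h01 /(_ x)[a [c [aK cK T3]]]].
have K0 : 0 <= K := le_trans (normr_ge0 _) aK.
have b0 : 0 <= b := le_trans (normr_ge0 _) (xib point).
have bh := bm_01 mh h01.
have bhx : bm (fun y => h (x + xi y)).
  by apply: (bm_comp _ bh); apply: measurable_funD => //; case: bxi.
pose r1 := \int[mu]_y (h (x + xi y) - h x - a * xi y - c / 2 * xi y ^+ 2).
have r1E : r1 = \int[mu]_y h (x + xi y) - h x - c / 2 * \int[mu]_y (xi y ^+ 2).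
  have bx2 : bm (fun y => xi y ^+ 2) by exact: bmX.
  rewrite /r1 (expectB mu1); last 2 first.
  - apply: bmB; last by apply: bmM => //; exact: bm_cst.
    by apply: bmB => //; exact: bm_cst.
  - by apply: bmM => //; exact: bm_cst.
  rewrite (expectB mu1); last 2 first.
  - by apply: bmB => //; exact: bm_cst.
  - by apply: bmM => //; exact: bm_cst.
  rewrite (expectB mu1)//; last exact: bm_cst.
  by rewrite (expect_cst mu1) !(expectZl mu1)// xi0 mulr0 subr0.
have r1b : `|r1| <= K * b ^+ 3.
  apply: (expect_norm_le mu1).
    apply: bmB; last by apply: bmM; [exact: bm_cst|exact: bmX].
    apply: bmB; last by apply: bmM => //; exact: bm_cst.
    by apply: bmB => //; exact: bm_cst.
  move=> y; have := T3 (xi y); rewrite -mulrA [_ ^+ 2 / 2]mulrC mulrA.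
  move=> /le_trans; apply; rewrite ler_wpM2l// lerXn2r// nnegrE//.
have ip n : (n <= 3)%N -> leb.-integrable setT
    (EFin \o (fun w : R => w ^+ n * normal_pdf 0 s w)).
  exact: integrable_pow_pdf.
have iZ n (k : R) : (n <= 3)%N -> leb.-integrable setT
    (EFin \o (fun w : R => k * (w ^+ n * normal_pdf 0 s w))).
  by move=> n3; exact: (integrableZl measurableT k (ip n n3)).
have bhs : bm (fun w : R => h (x + w)) by exact: bm_shift.
have ih : leb.-integrable setT
    (EFin \o (fun w : R => h (x + w) * normal_pdf 0 s w)).
  have mg := measurable_funM (proj1 bhs) (@measurable_normal_pdf R 0 s).
  apply: le_integrable (integrable_normal_pdf 0 s); first exact: measurableT.
    exact/measurable_EFinP.
  move=> v _ /=; rewrite lee_fin normrM ler_piMl//.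
  by rewrite ger0_norm; case/andP: (h01 (x + v)).
pose r2 := \int[leb]_w (h (x + w) * normal_pdf 0 s w
  - h x * (w ^+ 0 * normal_pdf 0 s w) - a * (w ^+ 1 * normal_pdf 0 s w)
  - c / 2 * (w ^+ 2 * normal_pdf 0 s w)).
have i2 := integrableB measurableT ih (iZ 0 (h x) isT).
have i3 := integrableB measurableT i2 (iZ 1 a isT).
have i4 := integrableB measurableT i3 (iZ 2 (c / 2) isT).
have r2E : r2 = \int[normal_prob 0 s]_w h (x + w) - h x - c / 2 * s ^+ 2.
  rewrite /r2 (RintegralB measurableT i3 (iZ 2 (c / 2) isT)).
  rewrite (RintegralB measurableT i2 (iZ 1 a isT)).
  rewrite (RintegralB measurableT ih (iZ 0 (h x) isT)).
  rewrite (RintegralZl (h x) measurableT (ip 0 isT)).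
  rewrite (RintegralZl a measurableT (ip 1 isT)).
  rewrite (RintegralZl (c / 2) measurableT (ip 2 isT)).
  have -> : \int[leb]_w (w ^+ 0 * normal_pdf 0 s w) = 1.
    under eq_Rintegral do rewrite expr0 mul1r.
    by rewrite /Rintegral integral_normal_pdf.
  have -> : \int[leb]_w (w ^+ 1 * normal_pdf 0 s w) = 0.
    exact: integral_id_pdf.
  by rewrite (integral_sqr_pdf s0) (expect_normal s bhs) mulr0 mulr1 subr0.
have r2b : `|r2| <= K * (16 * s ^+ 3).
  apply: (le_trans (le_normr_Rintegral measurableT i4)).
  apply: (le_trans _ (ler_wpM2l K0 (integral_cube_pdf s0))).
  rewrite -(RintegralZl K measurableT (integrable_cube_pdf s0)).
  apply: le_Rintegral => //.
  - exact: (integrable_norm i4).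
  - exact: (integrableZl measurableT K (integrable_cube_pdf s0)).
  move=> w _; rewrite expr0 mul1r expr1.
  have -> : h (x + w) * normal_pdf 0 s w - h x * normal_pdf 0 s w
    - a * (w * normal_pdf 0 s w) - c / 2 * (w ^+ 2 * normal_pdf 0 s w)
    = (h (x + w) - h x - a * w - c * w ^+ 2 / 2) * normal_pdf 0 s w by field.
  rewrite normrM [leRHS]mulrA (ger0_norm (normal_pdf_ge0 _ _ _)).
  by rewrite ler_wpM2r// normal_pdf_ge0.
have -> : \int[mu]_y h (x + xi y) - \int[normal_prob 0 s]_w h (x + w) =
    r1 - r2 + c / 2 * (\int[mu]_x (xi x ^+ 2) - s ^+ 2).
  by rewrite r1E r2E; ring.
have -> : eps K = K * b ^+ 3 + K * (16 * s ^+ 3) + K * (delta / 2).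
  by rewrite /eps; ring.
apply: (le_trans (ler_normD _ _)); apply: lerD.
  by rewrite (le_trans (ler_normB _ _))// lerD.
have -> : K * (delta / 2) = (K / 2) * delta by ring.
rewrite normrM ler_pM// normrM (_ : `|2^-1| = 2^-1 :> R) ?ler_wpM2r//.
by rewrite ger0_norm.
Qed.

(** The mean of f at x plus k independent normal steps of standard deviation s.
    The case k = 0 is separate because [normal_prob 0 0] is not a point mass:
    [normal_pdf] takes the density of a uniform law as default value there. *)
Definition gauss_smooth k (f : R -> R) (x : R) : R :=
  if k is 0 then f x
  else \int[normal_prob 0 (s * Num.sqrt k%:R)]_w f (x + w).

(** By induction on k: once the last k observations have been replaced by
    normal steps, the first one sees the test function [gauss_smooth k f] and
    is itself replaced by [lindeberg_step]. The normal law being stable under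
    convolution, this adds one step to the average. *)
Lemma lindeberg (K : R) (f f1 f2 : R -> R) k (x : R) : C3 K f f1 f2 ->
  `|\int[power_measure mu k]_X f (x + \sum_(i < k) xi (tnth X i)) -
    gauss_smooth k f x| <= k%:R * eps K.
Proof.
move=> cf; have [bf _ _] := C3_bm cf.
have [mf _ _ [f01 _ _] _] := cf.
have bsum n (y : R) :
    bm (fun X : n.-tuple T => f (y + \sum_(i < n) xi (tnth X i))).
  apply: (bm_comp _ bf); apply: measurable_funD => //.
  by case: (bm_sum (index_enum 'I_n) xpredT (fun i => bm_tnth i bxi)).
elim: k x => [|k IH] x.
  under eq_Rintegral do rewrite big_ord0 addr0.
  rewrite (expect_cst (power_measure_setT 0 mu1)) /= subrr normr0.
  by rewrite mul0r.
have tg : taylor3 K (gauss_smooth k f).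
  by case: k {IH} => [|k]; [exact: C3_taylor3 cf|exact: taylor3_average cf].
have comp : \int[normal_prob 0 s]_w gauss_smooth k f (x + w) =
    gauss_smooth k.+1 f x.
  case: k {IH tg} => [|k] /=; first by rewrite sqrtr1 mulr1.
  rewrite (expect_normal_comp _ _ s0 mf f01); last first.
    by rewrite mulr_gt0// sqrtr_gt0 ltr0n.
  have -> : (s * Num.sqrt k.+1%:R) ^+ 2 + s ^+ 2 =
      (s * Num.sqrt k.+2%:R) ^+ 2.
    by rewrite !exprMn !sqr_sqrtr ?ler0n// -[k.+2%:R]natr1; ring.
  by rewrite sqrtr_sqr gtr0_norm// mulr_gt0// sqrtr_gt0 ltr0n.
have bF := bsum k.+1 x.
have consE y (X : k.-tuple T) :
    x + \sum_(i < k.+1) xi (tnth (tuple_cons (y, X)) i) =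
    x + xi y + \sum_(i < k) xi (tnth X i).
  by rewrite big_ord_recl addrA; congr (_ + _); apply: eq_bigr => i _; rewrite tnthS.
rewrite (expect_cons mu1 bF).
under eq_Rintegral => y _ do under eq_Rintegral do rewrite consE.
rewrite -comp.
set A := \int[mu]_y _; set C := \int[normal_prob 0 s]_w _.
pose B := \int[mu]_y gauss_smooth k f (x + xi y).
have -> : A - C = (A - B) + (B - C) by ring.
have -> : k.+1%:R * eps K = k%:R * eps K + eps K by rewrite -natr1; ring.
apply: (le_trans (ler_normD _ _)); apply: lerD; last exact: lindeberg_step.
have bG : bm (fun y => gauss_smooth k f (x + xi y)).
  have [mg g01 _] := tg.
  have mh : measurable_fun setT (fun y => x + xi y).
    apply: measurable_funD; [exact: measurable_cst|exact: (proj1 bxi)].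
  exact: (bm_comp mh (bm_01 mg g01)).
have bA : bm (fun y => \int[power_measure mu k]_X
    f (x + xi y + \sum_(i < k) xi (tnth X i))).
  have := bm_expect2 mu1 (power_measure_setT k mu1)
    (bm_comp (@measurable_tuple_cons _ T k) bF).
  congr bm; apply/funext => y; apply: eq_Rintegral => X _.
  by rewrite consE.
rewrite /A /B -(expectB mu1 bA bG).
apply: (expect_norm_le mu1); first exact: (bmB bA bG).
move=> y; exact: (IH (x + xi y)).
Qed.

End step.

End lindeberg.

(** * Lebesgue integrals of products on a power of the line *)

Section lebesgue_product.
Context (R : realType).
Notation leb := (@lebesgue_measure R).

Lemma measurable_coord m (i : 'I_m) (A : set R) : measurable A ->
  measurable [set x : m.-tuple R | A (tnth x i)].
Proof.
move=> mA; rewrite -[X in measurable X]setTI.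
exact: (measurable_tnth i).
Qed.

Lemma measurable_forall m (A : 'I_m -> set R) : (forall i, measurable (A i)) ->
  measurable [set x : m.-tuple R | forall i, A i (tnth x i)].
Proof.
move=> mA; rewrite (_ : [set _ | _] =
    \bigcap_(i in [set: 'I_m]) [set x | A i (tnth x i)]); last first.
  by apply/seteqP; split => x /= h i; [move=> _; exact: h|exact: (h i I)].
apply: fin_bigcap_measurable => //.
by move=> i _; exact: measurable_coord.
Qed.

Lemma measurable_cube m : measurable (@cube R m).
Proof.
have -> : @cube R m = [set x | forall i, `[0, 1]%classic (tnth x i)].
  by apply/seteqP; split => x h i; have := h i; rewrite /= in_itv.
by apply: (@measurable_forall m (fun=> `[0, 1]%classic)) => i; exact: measurable_itv.
Qed.

Lemma measurable_orthant m (x : m.-tuple R) : measurable (orthant x).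
Proof.
have -> : orthant x = [set y | forall i, `]-oo, tnth x i]%classic (tnth y i)].
  by apply/seteqP; split => y h i; have := h i; rewrite /= in_itv.
by apply: (@measurable_forall m (fun i => `]-oo, tnth x i]%classic)) => i;
   exact: measurable_itv.
Qed.

Lemma measurable_prod_coord m (F : 'I_m -> R -> R) :
  (forall l, measurable_fun setT (F l)) ->
  measurable_fun setT (fun x : m.-tuple R => \prod_(l < m) F l (tnth x l)).
Proof.
move=> mF; apply: measurable_prod => l _.
by apply: measurableT_comp; [exact: mF|exact: measurable_tnth].
Qed.

(** The two types have the same measurable sets, so that the identity pushes
    one measure forward to the other. *)
Lemma integral_lebesgueR (F : R -> \bar R) :
  measurable_fun setT F -> (forall x, 0 <= F x)%E ->
  (\int[lebesgueR (R:=R)]_x F x = \int[leb]_x F x)%E.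
Proof.
move=> mF F0; pose phi : measurableTypeR R -> R := idfun.
have mphi : measurable_fun setT phi by move=> _ A mA; rewrite setTI.
rewrite (eq_measure_integral (pushforward leb phi)) => [|A mA _]; last first.
  exact: erefl.
by rewrite ge0_integral_pushforward.
Qed.

Lemma integral_lebesgue_tuple_prod m (F : 'I_m -> R -> R) (I : 'I_m -> R) :
  (forall l, measurable_fun setT (F l)) -> (forall l x, 0 <= F l x) ->
  (forall l, \int[leb]_x (F l x)%:E = (I l)%:E)%E ->
  (\int[lebesgue_tuple R m]_x (\prod_(l < m) F l (tnth x l))%:E =
   (\prod_(l < m) I l)%:E)%E.
Proof.
elim: m F I => [|m IH] F I mF F0 FI.
  under eq_integral do rewrite big_ord0.
  by rewrite integral_cst// big_ord0 mul1e /= diracE in_setT.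
have mp := measurable_prod_coord mF.
have mt := @measurable_prod_coord m (fun l => F (lift ord0 l)) (fun l => mF _).
have consE (z : R * m.-tuple R) :
    \prod_(l < m.+1) F l (tnth (tuple_cons z) l) =
    F ord0 z.1 * \prod_(l < m) F (lift ord0 l) (tnth z.2 l).
  by rewrite big_ord_recl; congr (_ * _); apply: eq_bigr => l _; rewrite tnthS.
rewrite /lebesgue_tuple /= /cons_measure ge0_integral_pushforward//; first last.
- by move=> x _; rewrite lee_fin prodr_ge0.
- exact/measurable_EFinP.
- exact: measurable_tuple_cons.
rewrite preimage_setT.
under eq_integral do rewrite /= consE.
rewrite (@fubini_tonelli1 _ _ _ _ R (lebesgueR (R:=R)) (lebesgue_tuple R m)
  (fun z => (F ord0 z.1 * \prod_(l < m) F (lift ord0 l) (tnth z.2 l))%:E)); last 2 first.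
- apply/measurable_EFinP; apply: measurable_funM.
    by apply: measurableT_comp; [exact: mF|exact: measurable_fst].
  by apply: (measurableT_comp mt); exact: measurable_snd.
- by move=> z; rewrite lee_fin mulr_ge0// prodr_ge0.
transitivity (\int[lebesgueR (R:=R)]_x
    ((F ord0 x)%:E * (\prod_(l < m) I (lift ord0 l))%:E))%E.
  apply: eq_integral => x _; rewrite /fubini_F /=.
  under eq_integral do rewrite EFinM.
  rewrite ge0_integralZl ?lee_fin//.
  - by rewrite (IH (fun l => F (lift ord0 l)) (fun l => I (lift ord0 l))).
  - exact/measurable_EFinP.
  - by move=> y _; rewrite lee_fin prodr_ge0.
rewrite ge0_integralZr ?lee_fin//.
- rewrite big_ord_recl EFinM; congr (_ * _)%E.
  rewrite -FI integral_lebesgueR//; first exact/measurable_EFinP.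
  by move=> x; rewrite lee_fin.
- by apply/measurable_EFinP; exact: mF.
- by move=> x _; rewrite lee_fin.
- apply: prodr_ge0 => l _.
  by rewrite -lee_fin -FI integral_ge0// => x _; rewrite lee_fin.
Qed.

Lemma integral_poly2 (a b u v w : R) : a <= b ->
  \int[leb]_(x in `[a, b]) (u + v * x + w * x ^+ 2) =
  u * (b - a) + v * (b ^+ 2 - a ^+ 2) / 2 + w * (b ^+ 3 - a ^+ 3) / 3.
Proof.
rewrite le_eqVlt => /predU1P[<-|ab].
  by rewrite set_itv1 Rintegral_set1 !subrr !mulr0 !mul0r !addr0.
pose F (x : R) := u * x + v / 2 * (x * x) + w / 3 * (x * (x * x)).
have cf : continuous (fun x : R => u + v * x + w * x ^+ 2).
  move=> x; apply: cvgD; last first.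
    by apply: cvgM; [exact: cvg_cst|exact: sqr_continuous].
  apply: cvgD; first exact: cvg_cst.
  by apply: cvgM; [exact: cvg_cst|exact: cvg_id].
have dF (x : R) : is_derive x 1 F (u + v * x + w * x ^+ 2).
  by apply: is_derive_eq; rewrite /= /GRing.scale/=; field.
by rewrite (Rintegral_FTC ab cf dF) /F; field.
Qed.

End lebesgue_product.

(** * Coordinates clamped to the unit interval *)

(** Observations lie in the cube almost surely. Clamped coordinates do so
    everywhere, so that polynomials in them are bounded functions. *)
Definition clamp (R : realType) (t : R) : R := Num.min (Num.max t 0) 1.

Section clamp_theory.
Context (R : realType).
Implicit Types t : R.

Lemma clamp_01 t : 0 <= clamp t <= 1.
Proof. by rewrite /clamp ge_min lexx orbT andbT le_min le_max lexx orbT ler01. Qed.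

Lemma clamp_id t : 0 <= t <= 1 -> clamp t = t.
Proof. by move=> /andP[t0 t1]; rewrite /clamp max_l// min_l. Qed.

Lemma clamp_le0 t : t <= 0 -> clamp t = 0.
Proof. by move=> t0; rewrite /clamp max_r// min_l. Qed.

Lemma clamp_ge1 t : 1 <= t -> clamp t = 1.
Proof.
move=> t1; rewrite /clamp max_l ?min_r//.
exact: le_trans ler01 t1.
Qed.

Lemma measurable_clamp : measurable_fun setT (@clamp R).
Proof. by apply: measurable_minr => //; apply: measurable_maxr. Qed.

Lemma bm_clamp : bm (@clamp R).
Proof.
by apply: bm_01; [exact: measurable_clamp|exact: clamp_01].
Qed.

Lemma bm_ler d (T : measurableType d) (f g : T -> R) :
  measurable_fun setT f -> measurable_fun setT g ->
  bm (fun x => (f x <= g x)%R%:R : R).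
Proof.
move=> mf mg; split; last first.
  by exists 1 => x; rewrite ger0_norm ?ler0n// lern1 leq_b1.
rewrite (_ : (fun _ => _) = (fun x => if f x <= g x then 1 else 0)).
  by apply: measurable_fun_ifT => //; exact: measurable_fun_ler.
by apply/funext => x; case: ifP.
Qed.

End clamp_theory.

Lemma integrable_indic_lty d (T : measurableType d) (R : realType)
    (mu : {measure set T -> \bar R}) (A : set T) :
  measurable A -> (mu A < +oo)%E -> mu.-integrable setT (EFin \o (\1_A : T -> R)).
Proof.
move=> mA Aoo; apply/integrableP; split.
  by apply/measurable_EFinP; exact: measurable_indic.
under eq_integral do rewrite /= ger0_norm//.
by rewrite integral_indic// setIT.
Qed.

(** * Expectations in the model *)

Definition model_upto (R : realType) (m : nat)
    (Omega : forall k : nat, k.-tuple R -> R) (omega : m.-tuple R -> R)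
    (P : R -> probability (m.-tuple R) R) (theta0 : R) : Prop :=
  forall theta, 0 <= theta <= theta0 ->
    (forall x, cube x -> P theta (orthant x) =
       (\prod_(j < m) tnth x j + theta * Omega m x)%:E) /\
    (forall A, measurable A -> P theta A =
       \int[lebesgue_tuple R m]_(x in A `&` @cube R m) (1 + theta * omega x)%:E)%E.

Section model_expectations.
Context (R : realType) (m : nat) (hm : (2 <= m)%N).
Context (Omega : forall k : nat, k.-tuple R -> R) (omega : m.-tuple R -> R).
Context (P : R -> probability (m.-tuple R) R).
Hypothesis hdep : dependence_conditions Omega omega.
Variable theta0 : R.
Hypothesis theta0_gt0 : 0 < theta0.
Hypothesis hP : model_upto Omega omega P theta0.
Notation lam := (lebesgue_tuple R m).
Notation cubem := (@cube R m).
Implicit Types (f : m.-tuple R -> R) (theta : R).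

Let mcube : measurable cubem := @measurable_cube R m.

Lemma P_setT theta : P theta setT = 1%E. Proof. exact: probability_setT. Qed.

Let zero_ok : 0 <= (0 : R) <= theta0. Proof. by rewrite lexx ltW. Qed.

(** The law P 0 is Lebesgue measure restricted to the cube. *)
Lemma lebesgue_cube : lam cubem = 1%E.
Proof.
have [_ /(_ _ (@measurableT _ _))] := hP zero_ok.
rewrite P_setT setTI; under eq_integral do rewrite mul0r addr0.
by rewrite integral_cst// mul1e.
Qed.

Let lebesgue_cube_lty : (lam cubem < +oo)%E.
Proof. by rewrite lebesgue_cube ltry. Qed.

Lemma integrable_omega2 : lam.-integrable cubem (EFin \o (fun x => omega x ^+ 2)).
Proof.
apply/integrableP; split.
  by apply/measurable_EFinP; apply: measurable_funX; exact: (dep_measurable hdep).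
under eq_integral do rewrite /= ger0_norm ?sqr_ge0//.
exact: (dep_L2 hdep).
Qed.

Lemma integrable_omega : lam.-integrable cubem (EFin \o omega).
Proof.
have i1 : lam.-integrable cubem (EFin \o (fun=> 1)).
  apply: measurable_bounded_integrable => //.
  by exists 1; split=> [|N N1 x _]; [exact: num_real|rewrite /= normr1 ltW].
have := integrableD mcube i1 integrable_omega2.
apply: le_integrable => //.
  by apply/measurable_EFinP; exact: (dep_measurable hdep).
move=> x _ /=; rewrite lee_fin [leRHS]ger0_norm ?addr_ge0 ?sqr_ge0//.
rewrite -(real_normK (num_real (omega x))).
have : 0 <= (`|omega x| - 1) ^+ 2 by rewrite sqr_ge0.
rewrite sqrrB1; have : 0 <= `|omega x| by []; lra.
Qed.

(** Extension by 0 makes integrals against omega run over the whole space. *)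
Definition om x : R := omega x * \1_cubem x.

Lemma integrable_om : lam.-integrable setT (EFin \o om).
Proof.
have := integrable_omega; rewrite integrable_mkcond//.
congr integrable; apply/funext => x /=.
by rewrite patchE /om indicE; case: (_ \in _); rewrite ?mulr1 ?mulr0.
Qed.

Lemma integrable_mul_om f : bm f -> lam.-integrable setT (EFin \o (fun x => f x * om x)).
Proof.
move=> [mf [M fM]]; have := integrableZl measurableT M integrable_om.
apply: le_integrable => //.
  apply/measurable_EFinP; apply: measurable_funM => //.
  by apply/measurable_EFinP; exact: measurable_int integrable_om.
move=> x _; rewrite /= lee_fin !normrM ler_wpM2r//.
by rewrite (le_trans (fM x))// ler_norm.
Qed.

Lemma integrable_mul_cube f : bm f ->
  lam.-integrable setT (EFin \o (fun x => f x * \1_cubem x)).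
Proof.
move=> [mf [M fM]].
have mi : measurable_fun setT (fun x => f x * \1_cubem x).
  by apply: measurable_funM => //; exact: measurable_indic.
have ic : lam.-integrable setT (EFin \o (\1_cubem : _ -> R)).
  exact: integrable_indic_lty.
have := integrableZl measurableT M ic.
apply: le_integrable => //; first exact/measurable_EFinP.
move=> x _; rewrite /= lee_fin !normrM ler_wpM2r//.
by rewrite (le_trans (fM x))// ler_norm.
Qed.

(** The derivative in theta of the expectation of f under P theta. *)
Definition cross f : R := \int[lam]_x (f x * om x).

Lemma expect_theta_lebesgue theta f : 0 <= theta <= theta0 -> bm f ->
  \int[P theta]_x f x = \int[lam]_x (f x * \1_cubem x) + theta * cross f.
Proof.
move=> th bf.
have ic : lam.-integrable setT (EFin \o (\1_cubem : _ -> R)).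
  exact: integrable_indic_lty.
rewrite (@expect_density _ _ R (P theta) lam (fun x => \1_cubem x + theta * om x))//.
- rewrite /cross -RintegralZl//; last exact: integrable_mul_om.
  rewrite -RintegralD//; [|exact: integrable_mul_cube|].
    by apply: eq_Rintegral => x _; ring.
  exact: (integrableZl measurableT theta (integrable_mul_om bf)).
- exact: (integrableD measurableT ic (integrableZl measurableT theta integrable_om)).
- move=> A mA; have [_ ->//] := hP th.
  rewrite integral_mkcondr; apply: eq_integral => x _.
  rewrite patchE /om indicE; case: (_ \in _); rewrite ?mulr1//.
  by rewrite !mulr0 addr0.
Qed.

Lemma expect0_lebesgue f : bm f ->
  \int[P 0]_x f x = \int[lam]_x (f x * \1_cubem x).
Proof. by move=> bf; rewrite expect_theta_lebesgue// mul0r addr0. Qed.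

(** The density is affine in theta, hence so is every expectation. *)
Lemma expect_theta theta f : 0 <= theta <= theta0 -> bm f ->
  \int[P theta]_x f x = \int[P 0]_x f x + theta * cross f.
Proof. by move=> th bf; rewrite expect0_lebesgue// expect_theta_lebesgue. Qed.

Definition om_norm : R := \int[lam]_x `|om x|.

Lemma om_norm_ge0 : 0 <= om_norm. Proof. exact: Rintegral_ge0. Qed.

Lemma cross_norm f M : bm f -> (forall x, `|f x| <= M) ->
  `|cross f| <= M * om_norm.
Proof.
move=> bf fM; have i1 := integrable_mul_om bf.
have io := integrable_norm integrable_om.
apply: (le_trans (le_normr_Rintegral measurableT i1)).
rewrite /om_norm -(RintegralZl M measurableT io).
apply: le_Rintegral => //.
- exact: integrable_norm i1.
- exact: (integrableZl measurableT M io).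
- by move=> x _; rewrite normrM ler_wpM2r.
Qed.

(** Under P 0 the coordinates are independent and uniform. *)
Lemma expect0_prod (F : 'I_m -> R -> R) : (forall l, bm (F l)) ->
  (forall l x, 0 <= F l x) ->
  \int[P 0]_x (\prod_(l < m) F l (tnth x l)) =
  \prod_(l < m) \int[@lebesgue_measure R]_(x in `[0, 1]) F l x.
Proof.
move=> bF F0.
have mp := measurable_prod_coord (fun l => proj1 (bF l)).
rewrite expect0_lebesgue; last first.
  by apply: bm_prod => l; apply: (bm_comp _ (bF l)); exact: measurable_tnth.
pose G l x := F l x * \1_`[0, 1] x.
have mG l : measurable_fun setT (G l).
  by apply: measurable_funM; [case: (bF l)|exact: measurable_indic].
have G0 l x : 0 <= G l x by rewrite mulr_ge0.
have E x : \prod_(l < m) F l (tnth x l) * \1_cubem x = \prod_(l < m) G l (tnth x l).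
  rewrite big_split/=; congr (_ * _); rewrite indicE.
  have [xc|xc] := boolP (x \in cubem).
    rewrite big1// => l _; rewrite indicE mem_set//=.
    by move: xc; rewrite inE => /(_ l); rewrite in_itv.
  apply/esym/eqP; rewrite prodf_seq_eq0; apply/hasP.
  apply: contrapT => h; move/negP : xc; apply; rewrite inE => l.
  apply: contrapT => xl; apply: h; exists l; rewrite ?mem_index_enum//=.
  rewrite indicE memNset//= in_itv/=; exact: xl.
under eq_Rintegral do rewrite E.
rewrite /Rintegral (@integral_lebesgue_tuple_prod _ _ G
  (fun l => \int[@lebesgue_measure R]_(x in `[0, 1]) F l x))//.
move=> l; rewrite Rintegral_mkcond.
have bG : bm (G l) by apply: bmM => //; exact: bm_indic.
have [_ [M FM]] := bF l.
have iG : (@lebesgue_measure R).-integrable setT (EFin \o G l).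
  have iI : (@lebesgue_measure R).-integrable setT
      (EFin \o (\1_`[0%R, 1%R] : R -> R)).
    apply: integrable_indic_lty => //.
    have -> // : (@lebesgue_measure R `[0%R, 1%R]%classic < +oo)%E.
    by rewrite lebesgue_measure_itv/= lte01 -EFinB ltry.
  have mGl := mG l; have := integrableZl measurableT M iI.
  apply: le_integrable; first exact: measurableT.
    exact/measurable_EFinP.
  move=> x _ /=; rewrite lee_fin !normrM ler_wpM2r//.
  by rewrite (le_trans (FM x))// ler_norm.
rewrite -[LHS]fineK; last exact: (integrable_fin_num measurableT iG).
congr (fine _)%:E; apply: eq_integral => x _ /=.
by rewrite patchE /G indicE; case: (_ \in _); rewrite ?mulr1 ?mulr0.
Qed.

(** Omega vanishes on the edge where all coordinates but the j-th are 1, so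
    that the cdf does not depend on theta there. Outside the unit interval the
    density decides. *)
Lemma margin_uniform theta j (t : R) : 0 <= theta <= theta0 ->
  \int[P theta]_y ((tnth y j <= t)%R%:R : R) = clamp t.
Proof.
move=> th; pose A := [set y : m.-tuple R | tnth y j <= t].
have mA : measurable A.
  have := @measurable_coord R m j `]-oo, t]%classic (measurable_itv _).
  by congr measurable; apply/seteqP; split => y /=; rewrite in_itv.
transitivity (\int[P theta]_y (\1_A y : R)).
  apply: eq_Rintegral => y _; rewrite indicE.
  by have [yt|yt] := boolP (tnth y j <= t); [rewrite mem_set|rewrite memNset//; exact/negP].
rewrite expect_indic//; suff h : P theta A = (clamp t)%:E by exact: (congr1 fine h).
have [cdf dens] := hP th; have m0 : (1 <= m <= m)%N by rewrite leqnn (leq_trans _ hm).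
have [t0|t0] := ltP t 0.
  rewrite clamp_le0 ?ltW// dens// (_ : A `&` cubem = set0) ?integral_set0//.
  apply/seteqP; split => // y [/= yt /(_ j) /andP[y0 _]].
  by have := le_lt_trans (le_trans y0 yt) t0; rewrite ltxx.
have [t1|t1] := ltP 1 t.
  rewrite clamp_ge1 ?ltW// -(P_setT theta).
  rewrite !dens//; congr integral; apply/seteqP; split => y [/= ya yc] //.
  by split=> //; have /andP[_ y1] := yc j; exact: (le_trans y1 (ltW t1)).
rewrite clamp_id ?t0//.
pose xt := set_coord [tuple 1 | _ < m] j t.
have xtE l : tnth xt l = if l == j then t else 1.
  by rewrite /xt !tnth_mktuple.
have xtc : cube xt by move=> l; rewrite xtE; case: ifP; rewrite ?t0// ler01 lexx.
have -> : P theta A = P theta (orthant xt).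
  rewrite !dens//; last exact: measurable_orthant.
  congr integral; apply/seteqP; split => y [/= ya yc]; split => //.
    move=> l; rewrite xtE; case: eqVneq => [->//|_].
    by case/andP: (yc l).
  by have := ya j; rewrite /A/= xtE eqxx.
rewrite cdf//= (dep_edge1 hdep j m0) ?t0// mulr0 addr0.
rewrite (bigD1 j)//= big1 => [|l /negbTE lj]; rewrite xtE ?eqxx ?mulr1// lj.
by [].
Qed.

End model_expectations.

(** * First-order expansion of a product *)

Section product_expansion.
Context (R : realType).

Lemma prod_but_lift m (U : 'I_m.+1 -> R) (i : 'I_m) :
  \prod_(l < m.+1 | l != lift ord0 i) U l =
  U ord0 * \prod_(l < m | l != i) U (lift ord0 l).
Proof.
rewrite big_mkcond big_ord_recl neq_lift; congr (_ * _).
rewrite [RHS]big_mkcond; apply: eq_bigr => l _.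
by rewrite (inj_eq (@lift_inj _ _)).
Qed.

Lemma prod_but0 m (U : 'I_m.+1 -> R) :
  \prod_(l < m.+1 | l != ord0) U l = \prod_(l < m) U (lift ord0 l).
Proof.
rewrite big_mkcond big_ord_recl eqxx /= mul1r.
by apply: eq_bigr.
Qed.

(** The two bounds are proved together: in the induction on the number of
    factors, the quadratic one uses the linear one for the remaining factors. *)
Lemma prod_expand m (U V : 'I_m -> R) :
  (forall j, 0 <= U j <= 1) -> (forall j, 0 <= V j <= 1) ->
  `|\prod_(j < m) V j - \prod_(j < m) U j| <= \sum_(j < m) `|V j - U j| /\
  `|\prod_(j < m) V j - \prod_(j < m) U j -
    \sum_(j < m) (V j - U j) * \prod_(l < m | l != j) U l| <=
  (\sum_(j < m) `|V j - U j|) ^+ 2.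
Proof.
elim: m U V => [|m IH] U V U01 V01.
  by rewrite !big_ord0 subrr subr0 normr0 lexx expr0n.
have [IH1 IH2] := IH (fun l => U (lift ord0 l)) (fun l => V (lift ord0 l))
  (fun l => U01 _) (fun l => V01 _).
rewrite !big_ord_recl prod_but0.
under [X in _ - (_ + X)]eq_bigr do rewrite prod_but_lift.
set pV := \prod_(i < m) _ in IH1 IH2 *; set pU := \prod_(i < m) _ in IH1 IH2 *.
have -> : \sum_(i < m) (V (lift ord0 i) - U (lift ord0 i)) *
    (U ord0 * \prod_(l < m | l != i) U (lift ord0 l)) =
    U ord0 * \sum_(i < m) (V (lift ord0 i) - U (lift ord0 i)) *
    \prod_(l < m | l != i) U (lift ord0 l).
  by rewrite mulr_sumr; apply: eq_bigr => i _; ring.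
set L := \sum_(i < m) _ in IH2 *; set S := \sum_(i < m) `| _ | in IH1 IH2 *.
set v := V ord0; set u := U ord0.
have /andP[v0 v1] : 0 <= v <= 1 by exact: V01.
have /andP[u0 u1] : 0 <= u <= 1 by exact: U01.
have pU0 : 0 <= pU by apply: prodr_ge0 => i _; case/andP: (U01 (lift ord0 i)).
have pU1 : pU <= 1 by apply: prodr_ile1 => i _; exact: U01.
have S0 : 0 <= S by apply: sumr_ge0 => i _.
split.
  have -> : v * pV - u * pU = v * (pV - pU) + (v - u) * pU by ring.
  rewrite (le_trans (ler_normD _ _))// addrC lerD// normrM.
    by rewrite (ger0_norm pU0) ler_piMr.
  by rewrite (ger0_norm v0) (le_trans _ IH1)// ler_piMl.
have -> : v * pV - u * pU - ((v - u) * pU + u * L) =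
  u * (pV - pU - L) + (v - u) * (pV - pU) by ring.
rewrite (le_trans (ler_normD _ _))//.
have h1 : `|u * (pV - pU - L)| <= S ^+ 2.
  by rewrite normrM (ger0_norm u0) (le_trans _ IH2)// ler_piMl.
have h2 : `|(v - u) * (pV - pU)| <= `|v - u| * S by rewrite normrM ler_wpM2l.
have : 0 <= `|v - u| * S by rewrite mulr_ge0.
have : 0 <= `|v - u| ^+ 2 by rewrite exprn_ge0.
have -> : (`|v - u| + S) ^+ 2 = `|v - u| ^+ 2 + 2 * (`|v - u| * S) + S ^+ 2 by ring.
by lra.
Qed.

Lemma sqr_sum_le m (e : 'I_m -> R) :
  (\sum_(j < m) `|e j|) ^+ 2 <= m%:R * \sum_(j < m) e j ^+ 2.
Proof.
rewrite expr2 big_distrlr/=.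
apply: (@le_trans _ _ (\sum_(i < m) \sum_(j < m) (e i ^+ 2 / 2 + e j ^+ 2 / 2))).
  apply: ler_sum => i _; apply: ler_sum => j _.
  rewrite -(real_normK (num_real (e i))) -(real_normK (num_real (e j))).
  have : 0 <= (`|e i| - `|e j|) ^+ 2 by rewrite sqr_ge0.
  have -> : (`|e i| - `|e j|) ^+ 2 = `|e i| ^+ 2 - 2 * (`|e i| * `|e j|) + `|e j| ^+ 2.
    by ring.
  by lra.
have -> : \sum_(i < m) \sum_(j < m) (e i ^+ 2 / 2 + e j ^+ 2 / 2) =
    m%:R * \sum_(j < m) e j ^+ 2.
  under eq_bigr => i _.
    rewrite big_split/= sumr_const card_ord -[_ *+ m]mulr_natl -mulr_suml.
    over.
  rewrite big_split/= -mulr_sumr -mulr_suml sumr_const card_ord.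
  by rewrite -[_ *+ m]mulr_natl; field.
by [].
Qed.

End product_expansion.

(** * Projection of the rank statistic *)

Section score.
Context (R : realType) (m : nat) (hm : (2 <= m)%N).
Context (Omega : forall k : nat, k.-tuple R -> R) (omega : m.-tuple R -> R).
Context (P : R -> probability (m.-tuple R) R).
Hypothesis hdep : dependence_conditions Omega omega.
Variable theta0 : R.
Hypothesis theta0_gt0 : 0 < theta0.
Hypothesis hP : model_upto Omega omega P theta0.
Notation lam := (lebesgue_tuple R m).
Notation cubem := (@cube R m).
Notation T := (m.-tuple R).
Implicit Types (x y : T) (theta : R) (j : 'I_m).

Let zero_ok : 0 <= (0 : R) <= theta0. Proof. by rewrite lexx ltW. Qed.
Let P1 theta := P_setT P theta.
Let margin theta j t th := @margin_uniform _ _ hm _ _ _ hdep _ hP theta j t th.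

(** The product over the coordinates of the [surv x j] replaces that of the
    rescaled ranks. *)
Definition surv x j : R := 1 - clamp (tnth x j).
Definition surv_but j x : R := \prod_(l < m | l != j) surv x l.
(** Minus the centred contribution of the observation z.2 to the j-th rank of
    the observation z.1. *)
Definition rank_dev j (z : T * T) : R :=
  clamp (tnth z.1 j) - (tnth z.2 j <= tnth z.1 j)%R%:R.
(** The mean effect of an observation y on the product for another observation,
    through the j-th rank of the latter. *)
Definition rank_score j y : R :=
  \int[P 0]_x (rank_dev j (x, y) * surv_but j x).
(** The projection of the statistic on a single observation: its own product,
    centred, plus its effect on the ranks of all the others. *)
Definition score x : R :=
  \prod_(l < m) surv x l - (2^-1) ^+ m + \sum_(j < m) rank_score j x.
(** The part of the linear term that projection does not capture. *)
Definition rank_kernel j (z : T * T) : R :=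
  rank_dev j z * surv_but j z.1 - rank_score j z.2.

Lemma surv_01 x j : 0 <= surv x j <= 1.
Proof. by rewrite /surv; move: (clamp_01 (tnth x j)); lra. Qed.

Lemma surv_but_01 j x : 0 <= surv_but j x <= 1.
Proof.
apply/andP; split; first by apply: prodr_ge0 => l _; case/andP: (surv_01 x l).
by apply: prodr_ile1 => l _; exact: surv_01.
Qed.

Lemma rank_dev_norm j z : `|rank_dev j z| <= 1.
Proof.
rewrite /rank_dev; move: (clamp_01 (tnth z.1 j)).
by case: (tnth z.2 j <= tnth z.1 j); rewrite /= ler_norml; lra.
Qed.

Lemma bm_surv j : bm (surv^~ j).
Proof.
apply: bmB; first exact: bm_cst.
by apply: (bm_comp _ (@bm_clamp R)); exact: measurable_tnth.
Qed.

Lemma bm_surv_but j : bm (surv_but j).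
Proof. by apply: bm_prod => l; exact: bm_surv. Qed.

Lemma bm_rank_dev j : bm (rank_dev j).
Proof.
have m1 : measurable_fun setT (fun z : T * T => tnth z.1 j).
  by apply: (measurableT_comp (measurable_tnth j)); exact: measurable_fst.
have m2 : measurable_fun setT (fun z : T * T => tnth z.2 j).
  by apply: (measurableT_comp (measurable_tnth j)); exact: measurable_snd.
by apply: bmB; [exact: (bm_comp m1 (@bm_clamp R))|exact: bm_ler].
Qed.

Let bm_devsurv j : bm (fun z : T * T => rank_dev j z * surv_but j z.1).
Proof.
apply: bmM; first exact: bm_rank_dev.
by apply: (bm_comp _ (bm_surv_but j)); exact: measurable_fst.
Qed.

Lemma bm_rank_score j : bm (rank_score j).
Proof. exact: (bm_expect1 (P1 0) (P1 0) (bm_devsurv j)). Qed.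

Lemma bm_rank_kernel j : bm (rank_kernel j).
Proof.
apply: bmB => //.
by apply: (bm_comp _ (bm_rank_score j)); exact: measurable_snd.
Qed.

Lemma bm_score : bm score.
Proof.
apply: bmD; last by apply: bm_sum => j; exact: bm_rank_score.
by apply: bmB; [apply: bm_prod => l; exact: bm_surv|exact: bm_cst].
Qed.

Lemma rank_score_norm j y : `|rank_score j y| <= 1.
Proof.
apply: (expect_norm_le (P1 0)).
  exact: (bm_section2 y (bm_devsurv j)).
move=> x; rewrite normrM -[leRHS]mul1r ler_pM ?rank_dev_norm//.
by rewrite ger0_norm; case/andP: (surv_but_01 j x).
Qed.

Lemma expect_rank_dev theta j x : 0 <= theta <= theta0 ->
  \int[P theta]_y rank_dev j (x, y) = 0.
Proof.
move=> th; rewrite /rank_dev/= (expectB (P1 theta)).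
- by rewrite (expect_cst (P1 theta)) margin// subrr.
- exact: bm_cst.
- by apply: bm_ler => //; exact: measurable_tnth.
Qed.

(** Exchange the integrals: [rank_dev] is centred in its second argument under
    P theta, whatever the law of the first, which is P 0 here. *)
Lemma expect_rank_score theta j : 0 <= theta <= theta0 ->
  \int[P theta]_y rank_score j y = 0.
Proof.
move=> th; rewrite /rank_score.
rewrite -(expect_swap (P1 0) (P1 theta) (bm_devsurv j)).
under eq_Rintegral => x _.
  rewrite /= (expectZr (P1 theta)); last exact: (bm_section1 x (bm_rank_dev j)).
  rewrite expect_rank_dev// mul0r.
  over.
by rewrite (expect_cst (P1 0)).
Qed.

Lemma rank_kernel_norm j z : `|rank_kernel j z| <= 2.
Proof.
rewrite (le_trans (ler_normB _ _))// (_ : 2 = 1 + 1)// lerD ?rank_score_norm//.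
rewrite normrM -[leRHS]mul1r ler_pM ?rank_dev_norm//.
by rewrite ger0_norm; case/andP: (surv_but_01 j z.1).
Qed.

Lemma expect_rank_kernel2 theta j x : 0 <= theta <= theta0 ->
  \int[P theta]_y rank_kernel j (x, y) = 0.
Proof.
move=> th; rewrite /rank_kernel/= (expectB (P1 theta)); last 2 first.
- exact: (bm_section1 x (bm_devsurv j)).
- exact: bm_rank_score.
rewrite expect_rank_score// subr0 (expectZr (P1 theta)).
  by rewrite expect_rank_dev// mul0r.
exact: (bm_section1 x (bm_rank_dev j)).
Qed.

(** Under P 0 this mean is zero by definition of [rank_score]; under P theta it
    differs from it by theta times a bounded quantity. *)
Lemma expect_rank_kernel1 theta j y : 0 <= theta <= theta0 ->
  `|\int[P theta]_x rank_kernel j (x, y)| <= theta * om_norm omega.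
Proof.
move=> th; have b1 := bm_section2 y (bm_devsurv j).
rewrite /rank_kernel/= (expectB (P1 theta)) => //; last exact: bm_cst.
rewrite (expect_cst (P1 theta)) (expect_theta hdep theta0_gt0 hP th b1).
rewrite /rank_score addrAC subrr add0r normrM ger0_norm; last by case/andP: th.
rewrite ler_wpM2l//; first by case/andP: th.
rewrite -[leRHS]mul1r; apply: (cross_norm hdep theta0_gt0 hP b1).
move=> x; rewrite normrM -[leRHS]mul1r ler_pM ?rank_dev_norm//.
by rewrite ger0_norm; case/andP: (surv_but_01 j x).
Qed.

Section sample.
Variable n : nat.
Implicit Types (X : n.-tuple T) (i : 'I_n).
Notation N := (n.+1%:R : R).

(** The empirical counterpart of [surv]. *)
Definition emp_surv X i j : R := (N - (rank X i j)%:R) / N.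

(** The statistic on the scale of ranks divided by n + 1; 2^-1 ^+ m is the mean
    of a product of m independent uniform variables. *)
Definition rank_mean X : R :=
  Num.sqrt n%:R * (n%:R^-1 * \sum_(i < n) \prod_(j < m) emp_surv X i j - (2^-1) ^+ m).

Definition remainder X : R :=
  rank_mean X - (Num.sqrt n%:R)^-1 * \sum_(i < n) score (tnth X i).

Let rankE X i j : (rank X i j)%:R =
  \sum_(k < n) (tnth (tnth X k) j <= tnth (tnth X i) j)%R%:R :> R.
Proof.
rewrite /rank -sum1_card natr_sum big_mkcond; apply: eq_bigr => k _.
by case: ifP; rewrite inE => ->.
Qed.

Lemma emp_surv_01 X i j : 0 <= emp_surv X i j <= 1.
Proof.
have r : (rank X i j <= n)%N by rewrite (leq_trans (max_card _))// card_ord.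
have N0 : 0 < N by rewrite ltr0n.
apply/andP; split; last by rewrite ler_pdivrMr// mul1r gerBl ler0n.
by rewrite divr_ge0 ?ler0n// subr_ge0 ler_nat (leq_trans r).
Qed.

Lemma bm_emp_surv i j : bm (fun X => emp_surv X i j).
Proof.
apply: bmM; last exact: bm_cst.
apply: bmB; first exact: bm_cst.
have mt (k : 'I_n) : measurable_fun setT (fun X => tnth (tnth X k) j).
  by apply: (measurableT_comp (measurable_tnth j)); exact: measurable_tnth.
have : bm (fun X => \sum_(k < n) (tnth (tnth X k) j <= tnth (tnth X i) j)%R%:R : R).
  by apply: bm_sum => k; exact: bm_ler.
by congr bm; apply/funext => X; rewrite rankE.
Qed.

Lemma bm_rank_mean : bm rank_mean.
Proof.
apply: bmM; first exact: bm_cst.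
apply: bmB; last exact: bm_cst.
apply: bmM; first exact: bm_cst.
by apply: bm_sum => i; apply: bm_prod => j; exact: bm_emp_surv.
Qed.

Lemma bm_remainder : bm remainder.
Proof.
apply: bmB; first exact: bm_rank_mean.
apply: bmM; first exact: bm_cst.
by apply: bm_sum => i; exact: (bm_tnth i bm_score).
Qed.

Definition row_dev X i j : R :=
  \sum_(k < n | k != i) rank_dev j (tnth X i, tnth X k).

(** The observation i counts in its own rank, but not in [row_dev]; the term
    2 clamp - 1 accounts for this and for the denominator n + 1, since the row
    only has n - 1 entries. *)
Lemma emp_surv_dev X i j : emp_surv X i j - surv (tnth X i) j =
  (row_dev X i j + (2 * clamp (tnth (tnth X i) j) - 1)) / N.
Proof.
have N0 : N != 0 by rewrite pnatr_eq0.
rewrite /emp_surv rankE (bigD1 i)//= lexx /row_dev /rank_dev /surv /=.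
set c := clamp _; rewrite sumrB sumr_const.
rewrite (_ : #|_| = n.-1); last first.
  by rewrite cardC1 card_ord.
set S := \sum_(k < n | k != i) _.
have n1 : (n.-1)%:R = N - 2 :> R.
  case: n i {S c X N0} => [[]//|n' i] /=.
  by rewrite -[n'.+2%:R]natr1 -[n'.+1%:R]natr1; ring.
by rewrite -[c *+ n.-1]mulr_natr n1; field.
Qed.

Definition ustat X j : R :=
  \sum_(i < n) \sum_(k < n | k != i) rank_kernel j (tnth X i, tnth X k).

(** Expand the product for each observation. The linear part in coordinate j is
    the double sum [ustat X j] up to sums of total size 3 n, divided by N; the
    quadratic part is bounded by [prod_expand]. *)
Lemma remainder_pointwise X : (0 < n)%N ->
  Num.sqrt n%:R * `|remainder X| <=
  \sum_(j < m) N^-1 * (`|ustat X j| + 3 * n%:R) +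
  \sum_(i < n) m%:R * \sum_(j < m) (emp_surv X i j - surv (tnth X i) j) ^+ 2.
Proof.
move=> n0; have N0 : N != 0 by rewrite pnatr_eq0.
have sn : 0 < Num.sqrt n%:R :> R by rewrite sqrtr_gt0 ltr0n.
have snn : Num.sqrt n%:R * Num.sqrt n%:R = n%:R :> R by rewrite -expr2 sqr_sqrtr ?ler0n.
pose rem i : R := \prod_(j < m) emp_surv X i j - \prod_(j < m) surv (tnth X i) j -
  \sum_(j < m) (emp_surv X i j - surv (tnth X i) j) * surv_but j (tnth X i).
pose lin j : R := \sum_(i < n)
  ((emp_surv X i j - surv (tnth X i) j) * surv_but j (tnth X i) -
   rank_score j (tnth X i)).
have E : Num.sqrt n%:R * remainder X = \sum_(j < m) lin j + \sum_(i < n) rem i.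
  rewrite /remainder /rank_mean mulrBr mulrA snn mulrA divff ?gt_eqF// mul1r.
  rewrite mulrBr mulrA divff ?pnatr_eq0 -?lt0n// mul1r.
  have -> : n%:R * 2^-1 ^+ m = \sum_(i < n) (2^-1) ^+ m :> R.
    by rewrite sumr_const card_ord mulr_natl.
  rewrite /lin exchange_big/= -big_split/= -!sumrB; apply: eq_bigr => i _.
  by rewrite /rem /score sumrB; ring.
rewrite -[Num.sqrt _]gtr0_norm// -normrM E (le_trans (ler_normD _ _))// lerD//.
- rewrite (le_trans (ler_norm_sum _ _ _))//; apply: ler_sum => j _.
  pose b := \sum_(i < n) (2 * clamp (tnth (tnth X i) j) - 1) * surv_but j (tnth X i).
  pose Q := \sum_(i < n) rank_score j (tnth X i).
  (* Each observation is the second argument of n - 1 = N - 2 kernels in the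
     double sum, whereas lin j counts its rank_score once, that is N / N times:
     this leaves - 2 Q. *)
  have linE : lin j = N^-1 * (ustat X j + b - 2 * Q).
    have uE : ustat X j = \sum_(i < n) row_dev X i j * surv_but j (tnth X i) -
        (N - 2) * Q.
      rewrite /ustat /rank_kernel /=.
      under eq_bigr do rewrite sumrB -mulr_suml.
      rewrite sumrB; congr (_ - _).
      have -> : \sum_(i < n) \sum_(k < n | k != i) rank_score j (tnth X k) =
          \sum_(i < n) (Q - rank_score j (tnth X i)).
        by apply: eq_bigr => i _; rewrite /Q [X in _ = X - _](bigD1 i)//= [RHS]addrC addKr.
      rewrite sumrB sumr_const card_ord -/Q -mulr_natl -natr1; ring.
    rewrite /lin sumrB -/Q uE.
    under eq_bigr do rewrite emp_surv_dev.
    have -> : \sum_(i < n) (row_dev X i j + (2 * clamp (tnth (tnth X i) j) - 1)) /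
        N * surv_but j (tnth X i) = N^-1 *
       (\sum_(i < n) row_dev X i j * surv_but j (tnth X i) + b).
      by rewrite /b -big_split/= mulr_sumr; apply: eq_bigr => i _; ring.
    by field.
  rewrite linE normrM ger0_norm ?invr_ge0 ?ler0n// ler_wpM2l ?invr_ge0 ?ler0n//.
  have sumn (F : 'I_n -> R) : (forall i, `|F i| <= 1) -> `|\sum_(i < n) F i| <= n%:R.
    move=> F1; rewrite (le_trans (ler_norm_sum _ _ _))//.
    have -> : n%:R = \sum_(i < n) 1 :> R by rewrite sumr_const card_ord.
    by apply: ler_sum => i _.
  have hb : `|b| <= n%:R.
    apply: sumn => i; rewrite normrM -[leRHS]mul1r ler_pM//.
      by move: (clamp_01 (tnth (tnth X i) j)); rewrite ler_norml; lra.
    by rewrite ger0_norm; case/andP: (surv_but_01 j (tnth X i)).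
  have hQ : `|Q| <= n%:R by apply: sumn => i; exact: rank_score_norm.
  move: hb hQ (ler_norm (ustat X j)) (ler_norm (- ustat X j)).
  by rewrite normrN !ler_norml; lra.
- rewrite (le_trans (ler_norm_sum _ _ _))//; apply: ler_sum => i _.
  have [_ h] := prod_expand (surv_01 (tnth X i)) (emp_surv_01 X i).
  by rewrite (le_trans h)// sqr_sum_le.
Qed.

End sample.

End score.

(** * Size of the remainder *)

Section score_moments.
Context (R : realType) (m : nat) (hm : (2 <= m)%N).
Context (Omega : forall k : nat, k.-tuple R -> R) (omega : m.-tuple R -> R).
Context (P : R -> probability (m.-tuple R) R).
Hypothesis hdep : dependence_conditions Omega omega.
Variable theta0 : R.
Hypothesis theta0_gt0 : 0 < theta0.
Hypothesis hP : model_upto Omega omega P theta0.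
Notation T := (m.-tuple R).
Implicit Types (x y : T) (theta : R) (j : 'I_m).

Let P1 theta := P_setT P theta.

Definition remainder_bound (h : R) : R :=
  m%:R * ((9 + h ^+ 2 * om_norm omega ^+ 2) / 2 + 3) + 2 * m%:R ^+ 2.

(** For theta = h / sqrt n the means of the kernels in their first argument are
    O(n^(-1/2)), so that [expect_sqr_ustat] bounds the second moment of each
    [ustat] by a multiple of n^2. The squares are bounded by [expect_sqr_row],
    with mean O(1 / n) each. *)
Lemma expect_remainder (n : nat) (h : R) : (0 < n)%N -> 0 <= h ->
  h / Num.sqrt n%:R <= theta0 ->
  Num.sqrt n%:R * \int[power_measure (P (h / Num.sqrt n%:R)) n]_X `|remainder P X| <=
  remainder_bound h.
Proof.
move=> n0 h0 hn; set theta := h / _ in hn *.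
have n0' : 0 < n%:R :> R by rewrite ltr0n.
have sn : 0 < Num.sqrt n%:R :> R by rewrite sqrtr_gt0.
have th : 0 <= theta <= theta0 by rewrite hn andbT divr_ge0// ltW.
have th2 : theta ^+ 2 * n%:R = h ^+ 2.
  by rewrite exprMn exprVn sqr_sqrtr ?ler0n// mulrVK// unitfE gt_eqF.
have En := power_measure_setT n (P1 theta).
set E := power_measure (P theta) n in En *.
pose N : R := n.+1%:R.
have N0 : 0 < N by rewrite ltr0n.
have nN : n%:R <= N by rewrite ler_nat.
have brow i j : bm (fun X : n.-tuple T => row_dev X i j).
  by apply: bm_sum => k; exact: (bm_tnth2 i k (bm_rank_dev R j)).
have bu j : bm (fun X : n.-tuple T => ustat P X j).
  apply: bm_sum => i; apply: bm_sum => k.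
  exact: (bm_tnth2 i k (bm_rank_kernel P j)).
have be i j : bm (fun X : n.-tuple T => emp_surv X i j - surv (tnth X i) j).
  by apply: bmB; [exact: bm_emp_surv|exact: (bm_tnth i (bm_surv R j))].
have bU : bm (fun X : n.-tuple T =>
    \sum_(j < m) N^-1 * (`|ustat P X j| + 3 * n%:R)).
  apply: bm_sum => j; apply: bmM; first exact: bm_cst.
  by apply: bmD; [exact: bm_norm|exact: bm_cst].
have bV : bm (fun X : n.-tuple T =>
    \sum_(i < n) m%:R * \sum_(j < m) (emp_surv X i j - surv (tnth X i) j) ^+ 2).
  apply: bm_sum => i; apply: bmM; first exact: bm_cst.
  by apply: bm_sum => j; exact: bmX.
have hU j : \int[E]_X `|ustat P X j| <= (9 + h ^+ 2 * om_norm omega ^+ 2) / 2 * n%:R.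
  have us : \int[E]_X (ustat P X j ^+ 2) <=
      (8 + h ^+ 2 * om_norm omega ^+ 2) * n%:R ^+ 2.
    have := expect_sqr_ustat (P1 theta) (bm_rank_kernel P j) (rank_kernel_norm P j)
      (fun x => expect_rank_kernel2 hm hdep hP j x th)
      (fun y => expect_rank_kernel1 hdep theta0_gt0 hP j y th) n.
    move=> /le_trans; apply; rewrite le_eqVlt; apply/predU1P; left.
    by rewrite -th2 exprMn; ring.
  have bu2 : bm (fun X : n.-tuple T => (2 * n%:R)^-1 * ustat P X j ^+ 2).
    by apply: bmM; [exact: bm_cst|exact: bmX].
  (* From the second to the first absolute moment by a <= a^2 / (2 n) + n / 2,
     which is balanced because a is of order n. *)
  apply: (@le_trans _ _ (\int[E]_X ((2 * n%:R)^-1 * ustat P X j ^+ 2 + n%:R / 2))).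
    apply: (expect_le En).
    - exact: bm_norm.
    - by apply: bmD => //; exact: bm_cst.
    - move=> X; rewrite -(real_normK (num_real (ustat P X j))).
      set a := `| _ |; have : 0 <= (2 * n%:R)^-1 * (a - n%:R) ^+ 2.
        by rewrite mulr_ge0 ?sqr_ge0// invr_ge0 mulr_ge0.
      have -> : (2 * n%:R)^-1 * (a - n%:R) ^+ 2 =
        (2 * n%:R)^-1 * a ^+ 2 + n%:R / 2 - a by field; rewrite gt_eqF.
      by lra.
  rewrite (expectD En)//; last exact: bm_cst.
  rewrite (expect_cst En) (expectZl En); last exact: bmX.
  have : (2 * n%:R)^-1 * \int[E]_X (ustat P X j ^+ 2) <=
      (2 * n%:R)^-1 * ((8 + h ^+ 2 * om_norm omega ^+ 2) * n%:R ^+ 2).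
    by rewrite ler_wpM2l// invr_ge0 mulr_ge0.
  have -> : (2 * n%:R)^-1 * ((8 + h ^+ 2 * om_norm omega ^+ 2) * n%:R ^+ 2) =
     (8 + h ^+ 2 * om_norm omega ^+ 2) / 2 * n%:R by field; rewrite gt_eqF.
  by lra.
have hV i j : \int[E]_X ((emp_surv X i j - surv (tnth X i) j) ^+ 2) <= 2 / N.
  have us := expect_sqr_row (P1 theta) (bm_rank_dev R j) (rank_dev_norm j)
      (fun x => expect_rank_dev hm hdep hP j x th) i.
  rewrite expr1n mul1r in us.
  apply: (@le_trans _ _ (\int[E]_X (2 / N ^+ 2 * (row_dev X i j ^+ 2) + 2 / N ^+ 2))).
    apply: (expect_le En).
    - exact: bmX.
    - apply: bmD; last exact: bm_cst.
      by apply: bmM; [exact: bm_cst|exact: bmX].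
    - move=> X; rewrite emp_surv_dev -/N; set S := row_dev X i j.
      set b := 2 * _ - 1.
      have hb : b ^+ 2 <= 1.
        rewrite -(real_normK (num_real b)) exprn_ile1//.
        by move: (clamp_01 (tnth (tnth X i) j)); rewrite /b ler_norml; lra.
      rewrite exprMn exprVn mulrC.
      have -> : 2 / N ^+ 2 * S ^+ 2 + 2 / N ^+ 2 = (N ^+ 2)^-1 * (2 * S ^+ 2 + 2).
        by field; rewrite gt_eqF.
      rewrite ler_wpM2l ?invr_ge0 ?sqr_ge0//.
      have : 0 <= (S - b) ^+ 2 by rewrite sqr_ge0.
      have -> : (S - b) ^+ 2 = 2 * S ^+ 2 + 2 * b ^+ 2 - (S + b) ^+ 2 by ring.
      by lra.
  rewrite (expectD En); [|by apply: bmM; [exact: bm_cst|exact: bmX]|exact: bm_cst].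
  rewrite (expect_cst En) (expectZl En); last exact: bmX.
  have -> : 2 / N = 2 / N ^+ 2 * n%:R + 2 / N ^+ 2.
    have -> : n%:R = N - 1 by rewrite /N -natr1 addrK.
    by field; rewrite gt_eqF.
  by rewrite lerD2r ler_wpM2l// divr_ge0 ?sqr_ge0.
rewrite -(expectZl En); last exact: (bm_norm (bm_remainder P n)).
apply: (@le_trans _ _ (\int[E]_X (\sum_(j < m) N^-1 * (`|ustat P X j| + 3 * n%:R) +
  \sum_(i < n) m%:R * \sum_(j < m) (emp_surv X i j - surv (tnth X i) j) ^+ 2))).
  apply: (expect_le En).
  - by apply: bmM; [exact: bm_cst|exact: (bm_norm (bm_remainder P n))].
  - exact: bmD.
  - by move=> X; exact: remainder_pointwise.
rewrite (expectD En bU bV) /remainder_bound; apply: lerD.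
  rewrite (expect_sum En); last first.
    move=> j; apply: bmM; first exact: bm_cst.
    by apply: bmD; [exact: bm_norm|exact: bm_cst].
  set A := _ / 2 in hU *.
  have -> : m%:R * (A + 3) = \sum_(j < m) (A + 3).
    by rewrite sumr_const card_ord mulr_natl.
  have A0 : 0 <= A by rewrite divr_ge0// addr_ge0// mulr_ge0 ?sqr_ge0.
  apply: ler_sum => j _; rewrite (expectZl En); last first.
    by apply: bmD; [exact: bm_norm|exact: bm_cst].
  rewrite (expectD En); [|exact: bm_norm|exact: bm_cst].
  rewrite (expect_cst En) mulrC ler_pdivrMr//.
  apply: (@le_trans _ _ ((A + 3) * n%:R)); first by have := hU j; lra.
  by rewrite ler_wpM2l// addr_ge0.
rewrite (expect_sum En); last first.
  move=> i; apply: bmM; first exact: bm_cst.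
  by apply: bm_sum => j; exact: bmX.
apply: (@le_trans _ _ (\sum_(i < n) m%:R * (m%:R * (2 / N)))).
  apply: ler_sum => i _; rewrite (expectZl En); last first.
    by apply: bm_sum => j; exact: bmX.
  rewrite ler_wpM2l//; rewrite (expect_sum En); last by move=> j; exact: bmX.
  have -> : m%:R * (2 / N) = \sum_(j < m) (2 / N).
    by rewrite sumr_const card_ord mulr_natl.
  by apply: ler_sum => j _; exact: hV.
rewrite sumr_const card_ord -[_ *+ n]mulr_natl.
have -> : n%:R * (m%:R * (m%:R * (2 / N))) = (n%:R / N) * (2 * m%:R ^+ 2) by ring.
rewrite ler_piMl ?mulr_ge0 ?sqr_ge0//.
by rewrite ler_pdivrMr// mul1r.
Qed.

End score_moments.

(** * The score in closed form *)

Section unit_interval_integrals.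
Context (R : realType).
Notation leb := (@lebesgue_measure R).

Lemma integral_clamp_below (f : R -> R) (t : R) : 0 <= t <= 1 ->
  \int[leb]_(x in `[0, 1]) ((clamp x <= t)%R%:R * f x) =
  \int[leb]_(x in `[0, t]) f x.
Proof.
move=> /andP[t0 t1].
have -> : (`[0, t] = `[0, 1] `&` `[0, t] :> set R)%classic.
  by apply/seteqP; split => x /=; rewrite !in_itv/=; [|case]; lra.
rewrite Rintegral_mkcondr; apply: eq_Rintegral => x.
rewrite inE /= in_itv/= => x01; rewrite patchE clamp_id//.
have [xt|xt] := leP x t.
  by rewrite mem_set ?mul1r//= in_itv/= xt andbT; case/andP: x01.
by rewrite memNset ?mul0r//= in_itv/= => /andP[_]; rewrite leNgt xt.
Qed.

Lemma integral_above (a : R) :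
  \int[leb]_(x in `[0, 1]) ((a <= x)%R%:R : R) = 1 - clamp a.
Proof.
have [a1|a1] := ltP 1 a.
  rewrite clamp_ge1 ?ltW// subrr.
  rewrite (_ : \int[leb]_(x in _) _ = \int[leb]_(x in `[0, 1]) 0).
    by rewrite Rintegral_cst// mul0r.
  apply: eq_Rintegral => x; rewrite inE /= in_itv/= => /andP[_ x1].
  by rewrite leNgt (le_lt_trans x1 a1).
have /andP[c0 c1] := clamp_01 a.
have -> : 1 - clamp a = \int[leb]_(x in `[clamp a, 1]) (1 + 0 * x + 0 * x ^+ 2).
  by rewrite integral_poly2//; ring.
have -> : (`[clamp a, 1] = `[0, 1] `&` `[clamp a, 1] :> set R)%classic.
  by apply/seteqP; split => x /=; rewrite !in_itv/=; [|case]; lra.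
rewrite Rintegral_mkcondr; apply: eq_Rintegral => x.
rewrite inE /= in_itv/= => /andP[x0 x1]; rewrite patchE.
have E : (a <= x) = (clamp a <= x).
  by rewrite /clamp ge_min ge_max x0 andbT leNgt; case: ltP => // h; apply/esym/negbTE; lra.
rewrite E; have [xt|xt] := leP (clamp a) x.
  by rewrite mem_set ?mul0r ?addr0//= in_itv/= xt.
by rewrite memNset//= in_itv/= => /andP[]; rewrite leNgt xt.
Qed.

(** The integral over [0, t] of (2 (1 - x))^a, for a <= 2 and t in [0, 1]. *)
Definition surv_moment (t : R) (a : nat) : R :=
  match a with
  | 0 => t
  | 1 => t * (2 - t)
  | _ => 4 * t - 4 * t ^+ 2 + 4 / 3 * t ^+ 3
  end.

Lemma integral_surv_moment (t : R) (a : nat) : 0 <= t <= 1 -> (a <= 2)%N ->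
  \int[leb]_(x in `[0, 1]) ((clamp x <= t)%R%:R * (2 * (1 - clamp x)) ^+ a) =
  surv_moment t a.
Proof.
move=> /andP[t0 t1] a2; rewrite integral_clamp_below ?t0//.
have E (f : R -> R) : (forall x, 0 <= x <= 1 -> (2 * (1 - clamp x)) ^+ a = f x) ->
    \int[leb]_(x in `[0, t]) ((2 * (1 - clamp x)) ^+ a) =
    \int[leb]_(x in `[0, t]) f x.
  move=> h; apply: eq_Rintegral => x; rewrite inE /= in_itv/= => /andP[x0 xt].
  by rewrite h// x0 (le_trans xt).
case: a a2 E => [|[|[|//]]] _ E /=.
- rewrite (E (fun x => 1 + 0 * x + 0 * x ^+ 2)).
    by rewrite integral_poly2//; field.
  by move=> x _; rewrite expr0; ring.
- rewrite (E (fun x => 2 + (- 2) * x + 0 * x ^+ 2)).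
    by rewrite integral_poly2//; field.
  by move=> x x01; rewrite clamp_id//; ring.
- rewrite (E (fun x => 4 + (- 8) * x + 4 * x ^+ 2)).
    by rewrite integral_poly2//; field.
  by move=> x x01; rewrite clamp_id//; ring.
Qed.

Lemma integral_surv : \int[leb]_(x in `[0, 1]) (1 - clamp x) = 2^-1.
Proof.
transitivity (\int[leb]_(x in `[0, 1]) (1 + (- 1) * x + 0 * x ^+ 2)).
  by apply: eq_Rintegral => x; rewrite inE /= in_itv/= => x01; rewrite clamp_id//; ring.
by rewrite integral_poly2//; field.
Qed.

Lemma integral_clamp : \int[leb]_(x in `[0, 1]) clamp x = 2^-1.
Proof.
transitivity (\int[leb]_(x in `[0, 1]) (0 + 1 * x + 0 * x ^+ 2)).
  by apply: eq_Rintegral => x; rewrite inE /= in_itv/= => x01; rewrite clamp_id//; ring.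
by rewrite integral_poly2//; field.
Qed.

End unit_interval_integrals.

Section explicit_score.
Context (R : realType) (m : nat) (hm : (2 <= m)%N).
Context (Omega : forall k : nat, k.-tuple R -> R) (omega : m.-tuple R -> R).
Context (P : R -> probability (m.-tuple R) R).
Hypothesis hdep : dependence_conditions Omega omega.
Variable theta0 : R.
Hypothesis theta0_gt0 : 0 < theta0.
Hypothesis hP : model_upto Omega omega P theta0.
Notation T := (m.-tuple R).
Implicit Types (x y : T) (theta : R) (j : 'I_m).

Let zero_ok : 0 <= (0 : R) <= theta0. Proof. by rewrite lexx ltW. Qed.
Let P1 theta := P_setT P theta.
Let expect0_prod := expect0_prod hdep theta0_gt0 hP.

Let bm_1clamp : bm (fun t : R => 1 - clamp t).
Proof. by apply: bmB; [exact: bm_cst|exact: bm_clamp]. Qed.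

Let clamp1_ge0 (t : R) : 0 <= 1 - clamp t.
Proof. by move: (clamp_01 t); lra. Qed.

Lemma expect0_coord_surv j (f : R -> R) : bm f -> (forall t, 0 <= f t) ->
  \int[P 0]_x (f (tnth x j) * surv_but j x) =
  (\int[@lebesgue_measure R]_(t in `[0, 1]) f t) * 2^-1 ^+ m.-1.
Proof.
move=> bf f0; pose F (l : 'I_m) : R -> R := if l == j then f else fun t => 1 - clamp t.
have bF l : bm (F l) by rewrite /F; case: ifP.
have F0 l t : 0 <= F l t by rewrite /F; case: ifP.
transitivity (\int[P 0]_x \prod_(l < m) F l (tnth x l)).
  apply: eq_Rintegral => x _; rewrite (bigD1 j)//= /F eqxx; congr (_ * _).
  by apply: eq_bigr => l /negbTE ->.
rewrite (expect0_prod bF F0) (bigD1 j)//= {1}/F eqxx; congr (_ * _).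
rewrite (eq_bigr (fun=> 2^-1)) => [|l /negbTE lj]; last first.
  by rewrite /F lj integral_surv.
by rewrite prodr_const cardC1 card_ord.
Qed.

(** By independence of the coordinates under P 0 the projection in coordinate j
    only retains the j-th coordinate of y, in which it is affine. *)
Lemma rank_scoreE j y : rank_score P j y = 2^-1 ^+ m * (1 - 2 * surv y j).
Proof.
rewrite /rank_score.
have bc : bm (fun x => clamp (tnth x j) * surv_but j x).
  apply: bmM; last exact: bm_surv_but.
  by apply: (bm_comp _ (bm_clamp R)); exact: measurable_tnth.
have bi : bm (fun x => (tnth y j <= tnth x j)%R%:R * surv_but j x : R).
  apply: bmM; last exact: bm_surv_but.
  by apply: bm_ler => //; exact: measurable_tnth.
transitivity (\int[P 0]_x (clamp (tnth x j) * surv_but j x -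
    (tnth y j <= tnth x j)%R%:R * surv_but j x)).
  by apply: eq_Rintegral => x _; rewrite /rank_dev/=; ring.
rewrite (expectB (P1 0) bc bi).
rewrite (expect0_coord_surv j (bm_clamp R)); last by move=> t; case/andP: (clamp_01 t).
have b2 : bm (fun t : R => (tnth y j <= t)%R%:R : R) by exact: bm_ler.
rewrite (expect0_coord_surv j b2); last by move=> t; rewrite ler0n.
rewrite integral_clamp integral_above /surv.
have -> : 2^-1 ^+ m = 2^-1 * 2^-1 ^+ m.-1 :> R.
  by rewrite -exprS prednK// (leq_trans _ hm).
by field.
Qed.

Lemma scoreE x : score P x = 2^-1 ^+ m *
  (\prod_(l < m) (2 * surv x l) - \sum_(l < m) 2 * surv x l + (m%:R - 1)).
Proof.
rewrite /score; under [X in _ + X]eq_bigr do rewrite rank_scoreE.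
rewrite -mulr_sumr sumrB sumr_const card_ord big_split/= prodr_const card_ord.
have -> : 2^-1 ^+ m * (2 ^+ m * \prod_(i < m) surv x i - \sum_(l < m) 2 * surv x l
    + (m%:R - 1)) = (2^-1 * 2) ^+ m * \prod_(i < m) surv x i
    + 2^-1 ^+ m * (- \sum_(l < m) 2 * surv x l + (m%:R - 1)).
  by rewrite exprMn; ring.
by rewrite mulVf// expr1n mul1r; ring.
Qed.

(** All the integrals of the score are sums of these products; the exponents
    select the factors that occur. *)
Lemma expect0_surv_moment (t : 'I_m -> R) (a : 'I_m -> nat) :
  (forall l, 0 <= t l <= 1) -> (forall l, (a l <= 2)%N) ->
  \int[P 0]_x (\prod_(l < m) ((clamp (tnth x l) <= t l)%R%:R * (2 * surv x l) ^+ a l)) =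
  \prod_(l < m) surv_moment (t l) (a l).
Proof.
move=> t01 a2.
rewrite (expect0_prod (F := fun l s => (clamp s <= t l)%R%:R * (2 * (1 - clamp s)) ^+ a l)).
- by apply: eq_bigr => l _; rewrite integral_surv_moment.
- move=> l; apply: bmM.
    by apply: bm_ler => //; exact: measurable_clamp.
  by apply: bmX; apply: bmM => //; exact: bm_cst.
- by move=> l s; rewrite mulr_ge0 ?ler0n// exprn_ge0// mulr_ge0.
Qed.

Let prod_delta (F : 'I_m -> R) j : \prod_(l < m) F l ^+ (l == j) = F j.
Proof.
by rewrite (bigD1 j)//= eqxx expr1 big1 ?mulr1// => l /negbTE ->; rewrite expr0.
Qed.

(** A product of functions of single coordinates that agrees on the cube with
    the indicator of the orthant below t. *)
Definition orthant_ind (t : 'I_m -> R) x : R :=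
  \prod_(l < m) (clamp (tnth x l) <= t l)%R%:R.

Lemma bm_orthant_ind t : bm (orthant_ind t).
Proof.
apply: bm_prod => l; apply: bm_ler => //.
by apply: measurableT_comp; [exact: measurable_clamp|exact: measurable_tnth].
Qed.

Let bm_2surv j : bm (fun x => 2 * surv x j).
Proof. by apply: bmM; [exact: bm_cst|exact: bm_surv]. Qed.

(** Each of the terms of the score has a product integral over the orthant. *)
Lemma expect0_orthant_score t : (forall l, 0 <= t l <= 1) ->
  \int[P 0]_x (orthant_ind t x * score P x) = 2^-1 ^+ m * (\prod_(l < m) t l *
    (\prod_(l < m) (2 - t l) + \sum_(l < m) t l - m.+1%:R)).
Proof.
move=> t01.
have bo := bm_orthant_ind t.
have e1 : \int[P 0]_x (orthant_ind t x * \prod_(l < m) (2 * surv x l)) =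
    \prod_(l < m) t l * \prod_(l < m) (2 - t l).
  rewrite -big_split/= -(expect0_surv_moment (a := fun=> 1%N) t01)//.
  by apply: eq_Rintegral => x _; rewrite /orthant_ind -big_split.
have e0 : \int[P 0]_x orthant_ind t x = \prod_(l < m) t l.
  rewrite -(expect0_surv_moment (a := fun=> 0%N) t01)//.
  by apply: eq_Rintegral => x _; apply: eq_bigr => l _; rewrite expr0 mulr1.
have ej j : \int[P 0]_x (orthant_ind t x * (2 * surv x j)) =
    \prod_(l < m) t l * (2 - t j).
  transitivity (\prod_(l < m) surv_moment (t l) (l == j)).
    rewrite -(expect0_surv_moment t01); last by move=> l; case: (_ == _).
    apply: eq_Rintegral => x _; rewrite big_split/=.
    by rewrite (prod_delta (fun l => 2 * surv x l)).
  rewrite (bigD1 j)//= [in RHS](bigD1 j)//= eqxx/=.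
  rewrite [X in _ * X = _](_ : _ = \prod_(l < m | l != j) t l); first by ring.
  by apply: eq_bigr => l /negbTE ->.
have b1 : bm (fun x => orthant_ind t x * \prod_(l < m) (2 * surv x l)).
  by apply: bmM => //; apply: bm_prod.
have bj j : bm (fun x => orthant_ind t x * (2 * surv x j)) by apply: bmM.
have bs : bm (fun x => \sum_(j < m) orthant_ind t x * (2 * surv x j)) by apply: bm_sum.
have b0 : bm (fun x => orthant_ind t x * (m%:R - 1)) by apply: bmM => //; exact: bm_cst.
transitivity (\int[P 0]_x (2^-1 ^+ m * (orthant_ind t x * \prod_(l < m) (2 * surv x l)
    - \sum_(j < m) orthant_ind t x * (2 * surv x j) + orthant_ind t x * (m%:R - 1)))).
  apply: eq_Rintegral => x _; rewrite scoreE.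
  have -> : \sum_(j < m) orthant_ind t x * (2 * surv x j) =
      orthant_ind t x * \sum_(j < m) 2 * surv x j by rewrite mulr_sumr.
  by ring.
rewrite (expectZl (P1 0)); last by apply: bmD => //; exact: bmB.
rewrite (expectD (P1 0))//; last exact: bmB.
rewrite (expectB (P1 0))// (expect_sum (P1 0))// (expectZr (P1 0))// e1 e0.
rewrite (eq_bigr _ (fun j _ => ej j)).
rewrite -mulr_sumr sumrB sumr_const card_ord -[2 *+ m]mulr_natl -natr1.
by ring.
Qed.

Let one01 (l : 'I_m) : 0 <= (1 : R) <= 1. Proof. by rewrite ler01 lexx. Qed.

Let orthant_ind1 x : orthant_ind (fun=> 1) x = 1.
Proof.
apply: big1 => l _; by case/andP: (clamp_01 (tnth x l)) => _ ->.
Qed.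

Lemma expect0_score : \int[P 0]_x score P x = 0.
Proof.
have := expect0_orthant_score one01.
under eq_Rintegral do rewrite orthant_ind1 mul1r.
move=> ->; rewrite big1// sumr_const card_ord big1 => [|l _]; last by ring.
by rewrite -natr1; ring.
Qed.

(** Expanding the square leaves the mixed moments of the variables
    2 (1 - x_l), which are independent with mean 1 and second moment 4 / 3. *)
Lemma expect0_score2 : \int[P 0]_x (score P x ^+ 2) =
  4^-1 ^+ m * ((4 / 3) ^+ m - m%:R / 3 - 1).
Proof.
have mom (a : 'I_m -> nat) : (forall l, (a l <= 2)%N) ->
    \int[P 0]_x (\prod_(l < m) (2 * surv x l) ^+ a l) =
    \prod_(l < m) surv_moment 1 (a l).
  move=> a2; rewrite -(expect0_surv_moment one01 a2).
  apply: eq_Rintegral => x _; apply: eq_bigr => l _.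
  by case/andP: (clamp_01 (tnth x l)) => _ ->; rewrite mul1r.
have s0 : surv_moment 1 0 = 1 :> R by [].
have s1 : surv_moment 1 1 = 1 :> R by rewrite /=; ring.
have s2 : surv_moment 1 2 = 4 / 3 :> R by rewrite /=; field.
pose A x : R := \prod_(l < m) (2 * surv x l).
pose v j x : R := 2 * surv x j.
have bA : bm A by apply: bm_prod.
have bv j : bm (v j) by exact: bm_2surv.
have EA : \int[P 0]_x A x = 1.
  transitivity (\prod_(l < m) surv_moment (1 : R) 1); last exact: big1.
  by rewrite -(mom (fun=> 1%N)).
have EA2 : \int[P 0]_x (A x * A x) = (4 / 3) ^+ m.
  transitivity (\prod_(l < m) surv_moment (1 : R) 2).
    rewrite -(mom (fun=> 2%N))//; apply: eq_Rintegral => x _.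
    by rewrite /A -big_split/=; apply: eq_bigr => l _; rewrite expr2.
  by rewrite s2 prodr_const card_ord.
have Ev j : \int[P 0]_x v j x = 1.
  transitivity (\prod_(l < m) surv_moment (1 : R) (l == j)).
    rewrite -mom; last by move=> l; case: (_ == _).
    by apply: eq_Rintegral => x _; rewrite (prod_delta (fun l => 2 * surv x l)).
  by apply: big1 => l _; case: (_ == _).
have EAv j : \int[P 0]_x (A x * v j x) = 4 / 3.
  transitivity (\prod_(l < m) surv_moment (1 : R) (1 + (l == j))).
    rewrite -mom; last by move=> l; case: (_ == _).
    apply: eq_Rintegral => x _; under [RHS]eq_bigr do rewrite exprD expr1.
    by rewrite big_split/= (prod_delta (fun l => 2 * surv x l)).
  rewrite (bigD1 j)// eqxx (_ : (1 + true)%N = 2%N)// s2 big1 => [|l /negbTE ->].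
    exact: mulr1.
  exact: s1.
have Evv j k : \int[P 0]_x (v j x * v k x) = 1 + (k == j)%:R / 3.
  transitivity (\prod_(l < m) surv_moment (1 : R) ((l == j) + (l == k))).
    rewrite -mom; last by move=> l; case: (_ == _); case: (_ == _).
    apply: eq_Rintegral => x _; under [RHS]eq_bigr do rewrite exprD.
    by rewrite big_split/= !(prod_delta (fun l => 2 * surv x l)).
  rewrite (bigD1 j)// eqxx eq_sym big1 => [|l /negbTE ->].
    rewrite [LHS]mulr1; case: (k == j).
      by rewrite (_ : (true + true)%N = 2%N)// s2 /=; field.
    by rewrite (_ : (true + false)%N = 1%N)// s1 /=; field.
  by case: (l == k); [exact: s1|exact: s0].
have bAv j : bm (fun x => A x * v j x) by exact: bmM.
have bvv j k : bm (fun x => v j x * v k x) by exact: bmM.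
have bAvs : bm (fun x => \sum_(j < m) A x * v j x) by exact: bm_sum.
have bvs : bm (fun x => \sum_(j < m) v j x) by exact: bm_sum.
have bvvs : bm (fun x => \sum_(j < m) \sum_(k < m) v j x * v k x).
  by apply: bm_sum => j; exact: bm_sum.
pose c : R := m%:R - 1.
transitivity (\int[P 0]_x (4^-1 ^+ m * (A x * A x
    + \sum_(j < m) \sum_(k < m) v j x * v k x
    - 2 * (\sum_(j < m) A x * v j x) + 2 * c * A x
    - 2 * c * (\sum_(j < m) v j x) + c ^+ 2))).
  apply: eq_Rintegral => x _; rewrite scoreE -/(A x) -/c exprMn.
  have -> : (2^-1 ^+ m) ^+ 2 = 4^-1 ^+ m :> R.
    by rewrite exprAC; congr (_ ^+ _); field.
  congr (_ * _).
  have -> : \sum_(j < m) \sum_(k < m) v j x * v k x = (\sum_(j < m) v j x) ^+ 2.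
    by rewrite expr2 big_distrlr.
  have -> : \sum_(j < m) A x * v j x = A x * \sum_(j < m) v j x.
    by rewrite mulr_sumr.
  have -> : \sum_(l < m) 2 * surv x l = \sum_(j < m) v j x by [].
  by ring.
have bZ (k : R) f : bm f -> bm (fun x => k * f x) by move=> bf; apply: bmM => //; exact: bm_cst.
have b2 : bm (fun x => A x * A x) by exact: bmM.
have b3 := bmD b2 bvvs.
have b4 := bmB b3 (bZ 2 _ bAvs).
have b5 := bmD b4 (bZ (2 * c) _ bA).
have b6 := bmB b5 (bZ (2 * c) _ bvs).
have b7 := bmD b6 (bm_cst T (c ^+ 2)).
rewrite (expectZl (P1 0) _ b7); congr (_ * _).
rewrite (expectD (P1 0) b6 (bm_cst _ _)) (expectB (P1 0) b5 (bZ _ _ bvs)).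
rewrite (expectD (P1 0) b4 (bZ _ _ bA)) (expectB (P1 0) b3 (bZ _ _ bAvs)).
rewrite (expectD (P1 0) b2 bvvs) (expect_cst (P1 0)).
rewrite (expectZl (P1 0) _ bAvs) (expectZl (P1 0) _ bA) (expectZl (P1 0) _ bvs).
have E1 : \int[P 0]_x (\sum_(j < m) \sum_(k < m) v j x * v k x) =
    m%:R * (m%:R + 1 / 3).
  rewrite (expect_sum (P1 0)); last by move=> j; exact: bm_sum.
  transitivity (\sum_(j < m) (m%:R + 1 / 3 : R)); last first.
    by rewrite sumr_const card_ord mulr_natl.
  apply: eq_bigr => j _; rewrite (expect_sum (P1 0))//.
  rewrite (eq_bigr _ (fun k _ => Evv j k)) big_split/= -mulr_suml sum_delta.
  by rewrite sumr_const card_ord.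
have E2 : \int[P 0]_x (\sum_(j < m) A x * v j x) = m%:R * (4 / 3).
  rewrite (expect_sum (P1 0))// (eq_bigr _ (fun k _ => EAv k)).
  by rewrite sumr_const card_ord -[LHS]mulr_natl.
have E3 : \int[P 0]_x (\sum_(j < m) v j x) = m%:R.
  rewrite (expect_sum (P1 0))// (eq_bigr _ (fun k _ => Ev k)).
  by rewrite sumr_const card_ord.
by rewrite EA EA2 E1 E2 E3 /c; field.
Qed.

Lemma expect_score theta : 0 <= theta <= theta0 ->
  \int[P theta]_x score P x = theta * cross omega (score P).
Proof.
move=> th; rewrite (expect_theta hdep theta0_gt0 hP th (bm_score P)).
by rewrite expect0_score add0r.
Qed.

End explicit_score.

(** * The normal distribution function *)

Section normal_cdf.
Context (R : realType).
Notation nu := (normal_prob (0 : R) 1).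
Implicit Types a b : R.

Lemma Phi_itv a b : a <= b -> Phi b - Phi a = fine (nu `]a, b]).
Proof.
move=> ab; rewrite /Phi.
have -> : (`]-oo, b] = `]-oo, a] `|` `]a, b] :> set R)%classic.
  apply/seteqP; split => x /=; rewrite !in_itv/=; last by case; lra.
  by case: (leP x a) => ? ?; [left|right]; lra.
rewrite measureU//=; last first.
  by apply/seteqP; split => // x [/=]; rewrite !in_itv/=; lra.
have fin (A : set (measurableTypeR R)) : measurable A -> nu A \is a fin_num.
  by move=> mA; exact: fin_num_measure.
by rewrite fineD ?fin// addrC addKr.
Qed.

Let nu_bound a b (p : R) : a <= b -> 0 <= p ->
  (forall x, a < x <= b -> normal_pdf 0 1 x <= p) ->
  fine (nu `]a, b]) <= p * (b - a).
Proof.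
move=> ab p0 pb.
have e : (\int[@lebesgue_measure R]_(x in `]a, b]) p%:E = (p * (b - a))%:E)%E.
  rewrite integral_cst//= lebesgue_measure_itv/= lte_fin; case: ltP => h.
    by rewrite -EFinB -EFinM.
  have -> : b = a by apply/eqP; rewrite eq_le h ab.
  by rewrite subrr mulr0 mule0.
rewrite -lee_fin fineK; last exact: fin_num_measure.
rewrite -e; apply: ge0_le_integral => //=.
- by move=> x _; rewrite lee_fin normal_pdf_ge0.
- apply/measurable_EFinP; apply: measurable_funTS; exact: measurable_normal_pdf.
Qed.

Lemma Phi_lipschitz a b : `|Phi a - Phi b| <= normal_peak 1 * `|a - b|.
Proof.
wlog ab : a b / a <= b.
  move=> h; have [|ba] := leP a b; first exact: h.
  by rewrite distrC [`|a - b|]distrC h// ltW.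
rewrite distrC [`|a - b|]distrC Phi_itv// (ger0_norm (_ : 0 <= b - a)) ?subr_ge0//.
rewrite ger0_norm ?fine_ge0//; apply: nu_bound => //; first exact: normal_peak_ge0.
by move=> x _; apply: normal_pdf_ub; rewrite oner_neq0.
Qed.

(** The normal density has a positive lower bound on ]a, b]. *)
Lemma Phi_lt a b : a < b -> Phi a < Phi b.
Proof.
move=> ab; rewrite -subr_gt0 Phi_itv ?ltW//.
pose M := Num.max `|a| `|b|; pose p := normal_peak 1 * expR (- M ^+ 2 / 2) : R.
have p0 : 0 < p by rewrite mulr_gt0 ?expR_gt0// normal_peak_gt0// oner_neq0.
have e : (\int[@lebesgue_measure R]_(x in `]a, b]) p%:E = (p * (b - a))%:E)%E.
  by rewrite integral_cst//= lebesgue_measure_itv/= lte_fin ab -EFinB -EFinM.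
rewrite -lte_fin fineK; last exact: fin_num_measure.
apply: (@lt_le_trans _ _ (p * (b - a))%:E).
  by rewrite lte_fin mulr_gt0// subr_gt0.
rewrite -e; apply: ge0_le_integral => //=.
- by move=> x _; rewrite lee_fin ltW.
- apply/measurable_EFinP; apply: measurable_funTS; exact: measurable_normal_pdf.
- move=> x; rewrite in_itv/= lee_fin => /andP[ax xb].
  rewrite normal_pdfE ?oner_neq0// /p ler_wpM2l ?normal_peak_ge0//.
  rewrite /normal_fun ler_expR subr0 expr1n !mulNr lerN2 ler_pM2r//.
  rewrite -(real_normK (num_real x)) lerXn2r ?nnegrE//.
    by rewrite le_max normr_ge0.
  rewrite /M le_max; have [x0|x0] := leP 0 x.
    by apply/orP; right; rewrite ger0_norm// (le_trans xb)// ler_norm.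
  apply/orP; left; rewrite ltr0_norm// -normrN.
  by rewrite (le_trans _ (ler_norm _))// lerN2 ltW.
Qed.

Lemma Phi_inj a b : Phi a = Phi b -> a = b.
Proof.
move=> ab; apply/eqP; rewrite eq_le !leNgt; apply/andP; split; apply/negP.
  by move/Phi_lt; rewrite ab ltxx.
by move/Phi_lt; rewrite ab ltxx.
Qed.

Lemma normal_tail a : \int[nu]_w ((a < w)%R%:R : R) = 1 - Phi a.
Proof.
transitivity (\int[nu]_w (\1_`]a, +oo[%classic w : R)).
  apply: eq_Rintegral => w _; rewrite indicE; have [aw|aw] := ltP a w.
    by rewrite mem_set//= in_itv/= aw.
  by rewrite memNset//= in_itv/= andbT; apply/negP; rewrite -leNgt.
rewrite expect_indic//.
have -> : (`]a, +oo[ = ~` `]-oo, a] :> set R)%classic.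
  by apply/seteqP; split => w /=; rewrite !in_itv/= andbT ltNge => /negP.
transitivity (fine (1 - nu `]-oo, a])%E).
  by congr fine; exact: probability_setC.
by rewrite /Phi fineB//; exact: fin_num_measure.
Qed.

End normal_cdf.

(** * Normalising constants of the statistic *)

Section constants.
Context (R : realType).

(** The variance of the score under P 0, by [expect0_score2]. *)
Definition score_var (m : nat) : R :=
  4^-1 ^+ m * ((4 / 3) ^+ m - m%:R / 3 - 1).

Lemma score_var_gt0 m : (2 <= m)%N -> 0 < score_var m.
Proof.
move=> m2; rewrite mulr_gt0 ?exprn_gt0//.
elim: m m2 => [//|m IH]; rewrite leq_eqVlt => /predU1P[<-|m2].
  by rewrite expr2; lra.
have := IH m2; set v := _ - 1 => v0.
have -> : (4 / 3) ^+ m.+1 - m.+1%:R / 3 - 1 = 4 / 3 * v + m%:R / 9.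
  by rewrite /v exprS -natr1; field.
by rewrite ltr_pwDl// ?mulr_gt0// mulr_ge0// ler0n.
Qed.

Lemma pow2_gt m : (2 <= m)%N -> m.+1%:R < 2 ^+ m :> R.
Proof.
move=> m2; rewrite -natrX ltr_nat; elim: m m2 => [//|m IH].
rewrite leq_eqVlt => /predU1P[<-//|/IH h]; rewrite expnS mul2n -addnn.
by rewrite (leq_trans (n := m.+1 + 2))//; [rewrite addn2|lia].
Qed.

(** Sum the bounds (m + 1) a^m <= b^(m + 1) - a^(m + 1) <= (m + 1) b^m for the
    consecutive numbers a and b = a + 1; the differences telescope. *)
Lemma pow_sum_bounds m n : (n%:R : R) ^+ m.+1 <= m.+1%:R * \sum_(1 <= i < n.+1) i%:R ^+ m /\
  m.+1%:R * \sum_(1 <= i < n.+1) i%:R ^+ m <= n.+1%:R ^+ m.+1 :> R.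
Proof.
have diff (a b : R) : 0 <= a -> a <= b -> b = a + 1 ->
    m.+1%:R * a ^+ m <= b ^+ m.+1 - a ^+ m.+1 /\
    b ^+ m.+1 - a ^+ m.+1 <= m.+1%:R * b ^+ m.
  move=> a0 ab ba; have b0 := le_trans a0 ab.
  rewrite subrXX (_ : b - a = 1) ?mul1r; last by rewrite ba; ring.
  have -> : m.+1%:R * a ^+ m = \sum_(i < m.+1) a ^+ m.
    by rewrite sumr_const card_ord mulr_natl.
  have -> : m.+1%:R * b ^+ m = \sum_(i < m.+1) b ^+ m.
    by rewrite sumr_const card_ord mulr_natl.
  split; apply: ler_sum => i _.
    have im : (i <= m)%N by rewrite -ltnS.
    rewrite -[X in a ^+ X <= _](subnK im) exprD ler_wpM2r ?exprn_ge0//=.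
    by rewrite lerXn2r ?nnegrE.
  have im : (i <= m)%N by rewrite -ltnS.
  rewrite -[X in _ <= b ^+ X](subnK im) exprD ler_wpM2l ?exprn_ge0//=.
  by rewrite lerXn2r ?nnegrE.
elim: n => [|n [IH1 IH2]].
  by rewrite big_geq// mulr0 expr0n/=; split => //; rewrite exprn_ge0.
rewrite big_nat_recr//= mulrDr.
have nn k : k%:R <= k.+1%:R :> R by rewrite ler_nat.
have [_ d1] := diff n%:R n.+1%:R (ler0n _ _) (nn n) (esym (natr1 _)).
have [d2 _] := diff n.+1%:R n.+2%:R (ler0n _ _) (nn n.+1) (esym (natr1 _)).
by split; lra.
Qed.

End constants.

Section normalisation.
Context (R : realType) (m : nat) (hm : (2 <= m)%N).

(** The normalising constant of the statistic on the scale of ranks divided by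
    n + 1, where it has a limit. *)
Definition spearman_ratio (n : nat) : R := spearman_const R m n / n.+1%:R ^+ m.

Definition spearman_ratio_lim : R := m.+1%:R^-1 - 2^-1 ^+ m.

Lemma spearman_ratio_lim_gt0 : 0 < spearman_ratio_lim.
Proof.
rewrite subr_gt0 exprVn ltf_pV2 ?posrE ?exprn_gt0 ?ltr0n//.
exact: pow2_gt.
Qed.

Lemma cvg_harmonic_ratio : n%:R / n.+1%:R @[n --> \oo] --> (1 : R).
Proof.
rewrite (_ : (fun _ => _) = (fun n => 1 - harmonic n : R)); last first.
  by apply/funext => n /=; rewrite /harmonic -natr1; field; rewrite natr1 pnatr_eq0.
by rewrite -[X in _ --> X]subr0; apply: cvgB; [exact: cvg_cst|exact: cvg_harmonic].
Qed.

Lemma cvg_spearman_ratio : spearman_ratio n @[n --> \oo] --> spearman_ratio_lim.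
Proof.
pose A n : R := (n%:R^-1 * \sum_(1 <= i < n.+1) i%:R ^+ m) / n.+1%:R ^+ m.
rewrite (_ : spearman_ratio = fun n => A n - 2^-1 ^+ m); last first.
  apply/funext => n; rewrite /spearman_ratio /spearman_const mulrBl -/(A n).
  have N0 : n.+1%:R ^+ m != 0 :> R by rewrite expf_neq0// pnatr_eq0.
  by congr (_ - _); rewrite exprMn mulrAC divff// mul1r.
apply: cvgB; last exact: cvg_cst.
apply: (@squeeze_cvgr _ _ _ _ (fun n : nat => (n%:R / n.+1%:R) ^+ m * m.+1%:R^-1)
  (fun n : nat => (n%:R / n.+1%:R)^-1 * m.+1%:R^-1 : R)).
- near=> n.
  have n0 : (0 < n)%N by near: n; exact: nbhs_infty_gt.
  have n0' : 0 < n%:R :> R by rewrite ltr0n.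
  have [h1 h2] := pow_sum_bounds R m n.
  set S := \sum_(1 <= i < n.+1) _ in h1 h2.
  have N0 : 0 < n.+1%:R :> R by rewrite ltr0n.
  have M0 : 0 < m.+1%:R :> R by rewrite ltr0n.
  have -> : A n = (m.+1%:R * S) * (n%:R * n.+1%:R ^+ m * m.+1%:R)^-1.
    by rewrite /A -/S; field; rewrite !gt_eqF// exprn_gt0.
  have D0 : 0 <= (n%:R * n.+1%:R ^+ m * m.+1%:R)^-1 :> R.
    by rewrite invr_ge0 !mulr_ge0// exprn_ge0// ltW.
  apply/andP; split.
    apply: le_trans (ler_wpM2r D0 h1).
    rewrite exprMn exprVn exprS le_eqVlt; apply/predU1P; left.
    by field; rewrite !gt_eqF// exprn_gt0.
  apply: le_trans (ler_wpM2r D0 h2) _.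
  rewrite invf_div exprS le_eqVlt; apply/predU1P; left.
  by field; rewrite !gt_eqF// exprn_gt0.
- rewrite -[X in _ --> X]mul1r; apply: cvgM; last exact: cvg_cst.
  rewrite -[X in _ --> X](expr1n _ m).
  elim: (m) => [|k IH]; first exact: cvg_cst.
  rewrite exprS (_ : (fun _ => _) = (fun n : nat =>
      n%:R / n.+1%:R * (n%:R / n.+1%:R) ^+ k : R)).
    by apply: cvgM => //; exact: cvg_harmonic_ratio.
  by apply/funext => n; rewrite exprS.
- rewrite -[X in _ --> X]mul1r; apply: cvgM; last exact: cvg_cst.
  rewrite -[X in _ --> X]invr1.
  by apply: cvgV; [exact: oner_neq0|exact: cvg_harmonic_ratio].
Unshelve. all: by end_near. Qed.

(** The asymptotic variance of the statistic is that of the score divided by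
    the square of the limit of the normalising constants. *)
Lemma sigma2_ratio : sigma2 R m * spearman_ratio_lim ^+ 2 = score_var R m.
Proof.
rewrite /sigma2 /spearman_ratio_lim /score_var.
have p2 : 2 ^+ m - m.+1%:R != 0 :> R by rewrite subr_eq0 gt_eqF// pow2_gt.
have -> : 4^-1 ^+ m = (2^-1 ^+ m) ^+ 2 :> R.
  by rewrite exprAC; congr (_ ^+ _); field.
rewrite exprVn; set p := 2 ^+ m in p2 *; set v := _ - m%:R / 3 - 1.
have p0 : p != 0 by rewrite expf_neq0// pnatr_eq0.
field.
by rewrite p0 addrC natr1 p2 pnatr_eq0.
Qed.

Definition spearman_scale (n : nat) : R :=
  (spearman_ratio n * Num.sqrt (sigma2 R m))^-1.

Lemma cvg_spearman_scale :
  spearman_scale n @[n --> \oo] --> (Num.sqrt (score_var R m))^-1.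
Proof.
have c0 := spearman_ratio_lim_gt0.
have <- : spearman_ratio_lim * Num.sqrt (sigma2 R m) = Num.sqrt (score_var R m).
  have v0 : 0 < sigma2 R m.
    have := score_var_gt0 R hm; rewrite -sigma2_ratio pmulr_lgt0//.
    by rewrite exprn_gt0.
  rewrite -sigma2_ratio mulrC [RHS]sqrtrM ?(ltW v0)//.
  by rewrite sqrtr_sqr ger0_norm// ltW.
apply: cvgV; last by apply: cvgM; [exact: cvg_spearman_ratio|exact: cvg_cst].
have v0 := score_var_gt0 R hm; rewrite -sigma2_ratio in v0.
rewrite mulf_neq0 ?gt_eqF// sqrtr_gt0.
by rewrite pmulr_lgt0 ?exprn_gt0 in v0.
Qed.

Lemma spearman_statE n
    (X : n.-tuple (m.-tuple R)) :
  Num.sqrt n%:R * spearman_stat X / Num.sqrt (sigma2 R m) =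
  spearman_scale n * rank_mean X.
Proof.
rewrite /spearman_scale /spearman_ratio /rank_mean /spearman_stat.
have N0 : n.+1%:R ^+ m != 0 :> R by rewrite expf_neq0// pnatr_eq0.
have -> : \sum_(i < n) \prod_(j < m) (n.+1%:R - (rank X i j)%:R) =
    n.+1%:R ^+ m * \sum_(i < n) \prod_(j < m) emp_surv X i j.
  rewrite mulr_sumr; apply: eq_bigr => i _.
  rewrite -[X in _ ^+ X](card_ord m) -prodr_const -big_split/=.
  by apply: eq_bigr => j _; rewrite /emp_surv mulrC divfK// pnatr_eq0.
rewrite exprMn !invfM invrK.
set a := (spearman_const R m n)^-1; set b := (Num.sqrt (sigma2 R m))^-1.
by ring.
Qed.

End normalisation.

(** * Limit of the power function *)

Section power_limit.
Context (R : realType) (m : nat) (hm : (2 <= m)%N).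
Context (Omega : forall k : nat, k.-tuple R -> R) (omega : m.-tuple R -> R).
Context (P : R -> probability (m.-tuple R) R).
Hypothesis hdep : dependence_conditions Omega omega.
Variable theta0 : R.
Hypothesis theta0_gt0 : 0 < theta0.
Hypothesis hP : model_upto Omega omega P theta0.
Notation T := (m.-tuple R).

Let P1 theta := P_setT P theta.

Definition score_sd : R := Num.sqrt (score_var R m).
Notation tau := score_sd.

Lemma score_sd_gt0 : 0 < tau. Proof. by rewrite sqrtr_gt0 score_var_gt0. Qed.

Lemma score_sd2 : tau ^+ 2 = score_var R m.
Proof. by rewrite sqr_sqrtr// ltW// score_var_gt0. Qed.

Definition slope : R := cross omega (score P) / tau.

(** With r = sqrt n, the summands xi of the linearised statistic, recentred
    under P theta, are O(1 / r) and have variance r^-2 + O(r^-3). Each of the n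
    replacements thus costs O(r^-3), and passing from the statistic to its
    linearisation costs the L1 norm of the remainder, which is O(1 / r). *)
Lemma smooth_limit_bound (K : R) (f f1 f2 : R -> R) (h : R) : 0 <= h -> C3 K f f1 f2 ->
  exists M, forall n, (0 < n)%N -> h / Num.sqrt n%:R <= theta0 ->
  `|\int[power_measure (P (h / Num.sqrt n%:R)) n]_X f (rank_mean X / tau) -
    \int[normal_prob 0 1]_w f (h * slope + w)| <= M / Num.sqrt n%:R.
Proof.
move=> h0 cf; have [bf _ _] := C3_bm cf.
have [mf _ _ [f01 _ _] _] := cf.
have K0 := C3_ge0 cf.
have t0 := score_sd_gt0.
have [_ [S SM]] := bm_score P.
have S0 : 0 <= S := le_trans (normr_ge0 _) (SM point).
pose c := h * slope; pose W := om_norm omega.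
have W0 : 0 <= W by exact: om_norm_ge0.
pose M1 := S / tau + `|c|.
pose K1 := h * (S ^+ 2 * W) / tau ^+ 2 + c ^+ 2.
exists ((1 + 3 * K) * (remainder_bound omega h / tau) + K * (K1 / 2 + M1 ^+ 3 + 16)).
move=> n n0 hn.
have n0' : 0 < n%:R :> R by rewrite ltr0n.
pose r := Num.sqrt n%:R : R.
have r0 : 0 < r by rewrite sqrtr_gt0.
have r2 : r ^+ 2 = n%:R by rewrite sqr_sqrtr// ltW.
have r1 : 1 <= r by rewrite -sqrtr1 ler_wsqrtr// ler1n.
have rn0 : r != 0 by rewrite gt_eqF.
have tn0 : tau != 0 by rewrite gt_eqF.
rewrite -/r in hn *; set theta := h / r in hn *.
have th : 0 <= theta <= theta0 by rewrite hn andbT divr_ge0// ltW.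
have En := power_measure_setT n (P1 theta).
have bs := bm_score P.
pose xi (x : T) : R := score P x / (tau * r) - c / n%:R.
have bxi : bm xi.
  by apply: bmB; [apply: bmM => //; exact: bm_cst|exact: bm_cst].
have xi0 : \int[P theta]_x xi x = 0.
  rewrite (expectB (P1 theta)); [|by apply: bmM => //; exact: bm_cst|exact: bm_cst].
  rewrite (expect_cst (P1 theta)) (expectZr (P1 theta))//.
  rewrite (expect_score hm hdep theta0_gt0 hP th) /c /slope /theta -r2.
  by field; rewrite rn0 tn0.
have xib x : `|xi x| <= M1 / r.
  have -> : M1 / r = S / tau / r + `|c| / r by rewrite /M1 mulrDl.
  apply: (le_trans (ler_normB _ _)); apply: lerD.
    rewrite normrM normfV (gtr0_norm (mulr_gt0 t0 r0)) invfM mulrA.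
    by rewrite ler_wpM2r ?invr_ge0 ?(ltW r0)// ler_wpM2r ?invr_ge0 ?(ltW t0).
  rewrite normrM normfV (gtr0_norm n0') ler_wpM2l// lef_pV2 ?posrE//.
  by rewrite -r2 expr2 ler_peMl// ltW.
have xi2 : `|\int[P theta]_x (xi x ^+ 2) - r^-1 ^+ 2| <= K1 / (r ^+ 3).
  have bs2 : bm (fun x => score P x ^+ 2) by exact: bmX.
  have e : \int[P theta]_x (xi x ^+ 2) =
      (score_var R m + theta * cross omega (fun x => score P x ^+ 2)) / (tau * r) ^+ 2 -
      (c / n%:R) ^+ 2.
    have -> : (score_var R m + theta * cross omega (fun x => score P x ^+ 2)) =
        \int[P theta]_x (score P x ^+ 2).
      rewrite (expect_theta hdep theta0_gt0 hP th bs2).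
      by rewrite (expect0_score2 hm hdep theta0_gt0 hP).
    have be : bm (fun x => (2 * (c / n%:R)) * xi x).
      by apply: bmM => //; exact: bm_cst.
    have bsc : bm (fun x => score P x ^+ 2 / (tau * r) ^+ 2).
      by apply: bmM => //; exact: bm_cst.
    transitivity (\int[P theta]_x (score P x ^+ 2 / (tau * r) ^+ 2
        - (2 * (c / n%:R)) * xi x - (c / n%:R) ^+ 2)).
      apply: eq_Rintegral => x _; rewrite /xi -exprVn -exprMn.
      set a := score P x / _; set b := c / n%:R.
      by ring.
    rewrite (expectB (P1 theta)); [|exact: bmB|exact: bm_cst].
    rewrite (expectB (P1 theta) bsc be) (expect_cst (P1 theta)).
    by rewrite (expectZl (P1 theta) _ bxi) xi0 mulr0 subr0 (expectZr (P1 theta) _ bs2).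
  rewrite e -score_sd2.
  set C := cross _ _.
  have hC : `|C| <= S ^+ 2 * W.
    apply: (cross_norm hdep theta0_gt0 hP bs2) => x.
    by rewrite normrX lerXn2r ?nnegrE.
  have -> : (tau ^+ 2 + theta * C) / (tau * r) ^+ 2 - (c / n%:R) ^+ 2 - r^-1 ^+ 2 =
      (h * C / tau ^+ 2 - c ^+ 2 / r) / r ^+ 3.
    by rewrite /theta -r2; field; rewrite rn0 tn0.
  have r3 : 0 < r ^+ 3 by rewrite exprn_gt0.
  rewrite normrM normfV (gtr0_norm r3) ler_wpM2r ?invr_ge0 ?(ltW r3)//.
  apply: (le_trans (ler_normB _ _)); apply: lerD.
    rewrite !normrM (ger0_norm h0) normfV (gtr0_norm (exprn_gt0 2 t0)).
    by rewrite ler_wpM2r ?invr_ge0 ?sqr_ge0// ler_wpM2l.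
  rewrite ger0_norm; last by rewrite divr_ge0 ?sqr_ge0// ltW.
  by rewrite ler_pdivrMr// ler_peMr ?sqr_ge0.
have rV0 : 0 < r^-1 by rewrite invr_gt0.
have lin := lindeberg (P1 theta) bxi xib rV0 xi0 xi2 n c cf.
have E0 : gauss_smooth r^-1 n f c = \int[normal_prob 0 1]_w f (c + w).
  case: n n0 @r r0 rn0 {hn th theta En xi bxi xi0 xib xi2 rV0 lin n0' r2 r1} => [//|n].
  by move=> _ r r0 rn0 /=; rewrite mulVf.
rewrite E0 in lin.
set E := power_measure (P theta) n in En lin *.
have sumE (X : n.-tuple T) : rank_mean X / tau - (c + \sum_(i < n) xi (tnth X i)) =
    remainder P X / tau.
  rewrite /remainder /xi sumrB sumr_const card_ord -/r -mulr_suml.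
  rewrite -[_ *+ n]mulr_natl.
  set A := \sum_(i < n) _; field.
  by rewrite (gt_eqF n0') rn0 tn0.
have bR : bm (fun X : n.-tuple T => f (rank_mean X / tau)).
  apply: (bm_comp _ bf); apply: measurable_funM => //.
  by case: (bm_rank_mean R m n).
have bL : bm (fun X : n.-tuple T => f (c + \sum_(i < n) xi (tnth X i))).
  apply: (bm_comp _ bf); apply: measurable_funD => //.
  by case: (bm_sum (index_enum 'I_n) xpredT (fun i => bm_tnth i bxi)).
have brem := bm_norm (bm_remainder P n).
have d1 : `|\int[E]_X f (rank_mean X / tau) -
    \int[E]_X f (c + \sum_(i < n) xi (tnth X i))| <=
    (1 + 3 * K) * (remainder_bound omega h / tau) / r.
  rewrite -(expectB En bR bL).
  apply: (le_trans (expect_norm En (bmB bR bL))).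
  apply: (@le_trans _ _ (\int[E]_X ((1 + 3 * K) / tau * `|remainder P X|))).
    apply: (expect_le En).
    - exact: (bm_norm (bmB bR bL)).
    - by apply: bmM => //; exact: bm_cst.
    - move=> X; apply: (le_trans (C3_lipschitz _ _ cf)).
      rewrite sumE normrM normfV (gtr0_norm t0) -mulrA [`|_| * _]mulrC.
      by rewrite mulrA.
  rewrite (expectZl En _ brem).
  have hr := expect_remainder hm hdep theta0_gt0 hP n0 h0 hn.
  rewrite -/r -/theta -/E in hr.
  have -> : (1 + 3 * K) * (remainder_bound omega h / tau) / r =
    (1 + 3 * K) / tau * (remainder_bound omega h / r) by ring.
  rewrite ler_wpM2l//; last by rewrite ler_pdivlMr// mulrC.
  by rewrite divr_ge0 ?(ltW t0)// addr_ge0// mulr_ge0.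
have d2 : n%:R * (K * (K1 / r ^+ 3 / 2 + (M1 / r) ^+ 3 + 16 * r^-1 ^+ 3)) =
    K * (K1 / 2 + M1 ^+ 3 + 16) / r.
  by rewrite -r2; field.
rewrite d2 in lin.
set a := \int[E]_X f (rank_mean X / tau) in d1 *.
set b := \int[E]_X f (c + _) in d1 lin.
set g := \int[normal_prob 0 1]_w _ in lin *.
have -> : a - g = (a - b) + (b - g) by ring.
by rewrite mulrDl; apply: (le_trans (ler_normD _ _)); apply: lerD.
Qed.

End power_limit.

Section power_limit_indicator.
Context (R : realType) (m : nat) (hm : (2 <= m)%N).
Context (Omega : forall k : nat, k.-tuple R -> R) (omega : m.-tuple R -> R).
Context (P : R -> probability (m.-tuple R) R).
Hypothesis hdep : dependence_conditions Omega omega.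
Variable theta0 : R.
Hypothesis theta0_gt0 : 0 < theta0.
Hypothesis hP : model_upto Omega omega P theta0.
Notation T := (m.-tuple R).
Notation tau := (score_sd R m).
Notation sl := (slope omega P).

Let P1 theta := P_setT P theta.
Let tau0 : 0 < tau := score_sd_gt0 R hm.

Lemma near_small_over_sqrt (M e : R) : 0 < e ->
  \forall n \near \oo, M / Num.sqrt n%:R <= e.
Proof.
move=> e0; near=> n.
have n0 : (0 < n)%N by near: n; exact: nbhs_infty_gt.
have r0 : 0 < Num.sqrt n%:R :> R by rewrite sqrtr_gt0 ltr0n.
rewrite ler_pdivrMr// mulrC -ler_pdivrMr// (le_trans (ler_norm _))//.
rewrite -sqrtr_sqr ler_wsqrtr//.
by near: n; exact: nbhs_infty_ger.
Unshelve. all: by end_near. Qed.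

Lemma smooth_limit (f f1 f2 : R -> R) (K h e : R) : 0 <= h -> 0 < e -> C3 K f f1 f2 ->
  \forall n \near \oo,
  `|\int[power_measure (P (h / Num.sqrt n%:R)) n]_X f (rank_mean X / tau) -
    \int[normal_prob 0 1]_w f (h * sl + w)| <= e.
Proof.
move=> h0 e0 cf.
have [M HM] := smooth_limit_bound hm hdep theta0_gt0 hP h0 cf.
near=> n; apply: le_trans (HM n _ _) _.
- by near: n; exact: nbhs_infty_gt.
- by near: n; exact: near_small_over_sqrt.
- by near: n; exact: near_small_over_sqrt.
Unshelve. all: by end_near. Qed.

Lemma power_functionE (z : R) n (h : R) :
  power_function P z n h =
  \int[power_measure (P h) n]_X ((z < spearman_scale R m n * rank_mean X)%R%:R : R).
Proof.
rewrite /power_function.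
pose A := [set X : n.-tuple T | z < spearman_scale R m n * rank_mean X].
have mA : measurable A.
  rewrite -[X in measurable X]setTI; apply: (measurable_fun_ltr) => //.
  by apply: measurable_funM => //; case: (bm_rank_mean R m n).
transitivity (\int[power_measure (P h) n]_X (\1_A X : R)); last first.
  apply: eq_Rintegral => X _; rewrite indicE.
  have [zX|zX] := boolP (z < spearman_scale R m n * rank_mean X).
    by rewrite mem_set.
  by rewrite memNset//; exact/negP.
rewrite expect_indic//; congr fine.
have -> // : [set X | z < Num.sqrt n%:R * spearman_stat X / Num.sqrt (sigma2 R m)] = A.
by apply/seteqP; split => X /=; rewrite spearman_statE.
Qed.

Lemma cvg_threshold (z : R) :
  z / (spearman_scale R m n * tau) @[n --> \oo] --> z.
Proof.
rewrite -[X in _ --> X]mulr1; apply: cvgM; first exact: cvg_cst.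
rewrite -[X in _ --> X]invr1; apply: cvgV; first exact: oner_neq0.
rewrite -(mulVf (lt0r_neq0 tau0)).
by apply: cvgM; [exact: cvg_spearman_scale|exact: cvg_cst].
Qed.

Lemma near_scale_gt0 : \forall n \near \oo, 0 < spearman_scale R m n.
Proof.
have h : (0 : R) < (Num.sqrt (score_var R m))^-1 by rewrite invr_gt0.
by apply: cvgr_gt h; exact: cvg_spearman_scale.
Qed.

(** The indicator of a half-line is squeezed between two splines, for which the
    limit is known. The cut-off for the rescaled statistic depends on n, but
    converges to z; widening the splines absorbs its fluctuation, and Phi is
    Lipschitz. *)
Lemma cvg_power_function (z h : R) : 0 <= h ->
  power_function P z n (h / Num.sqrt n%:R) @[n --> \oo] --> 1 - Phi (z - h * sl).
Proof.
move=> h0; set c := h * sl.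
have p0 : 0 < normal_peak (1 : R) by rewrite normal_peak_gt0// oner_neq0.
apply/cvgrPdist_le => e e0.
(* Replacing z by z - 2 d or z + 2 d changes the limit by at most 2 d times the
   Lipschitz constant of Phi, which is at most e / 2 for this d. *)
pose d := e / (2 * (2 * normal_peak 1 + 1)).
have d0 : 0 < d by rewrite divr_gt0// mulr_gt0// ltr_wpDl// mulr_ge0// ltW.
pose k := 3 / d; have k0 : 0 <= k by rewrite divr_ge0// ltW.
have kd : k * d = 3 by rewrite /k divfK// gt_eqF.
(* With k = 3 / d the spline based at a rises on [a, a + d]: for fu it is
   complete at z - d, for fl it starts at z + d. The cut-off will be within d / 2
   of z. *)
pose fu y := step_spline (k * (y - (z - 2 * d))).
pose fl y := step_spline (k * (y - (z + d))).
have cu : C3 _ fu _ _ := C3_step (z - 2 * d) k0.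
have cl : C3 _ fl _ _ := C3_step (z + d) k0.
have e2 : 0 < e / 2 by rewrite divr_gt0.
have [bfu _ _] := C3_bm cu; have [bfl _ _] := C3_bm cl.
have n1 := normal_prob_setT (1 : R).
have bind (a : R) : bm (fun w : R => (a < w)%R%:R : R).
  have := bmB (bm_cst R 1) (@bm_ler R _ R (fun w => w) (fun=> a)
    (@measurable_id _ _ _) (measurable_cst _)).
  by congr bm; apply/funext => w; rewrite ltNge; case: (w <= a); rewrite /= ?subrr ?subr0.
have bfuc : bm (fun w : R => fu (c + w)) by exact: bm_shift.
have bflc : bm (fun w : R => fl (c + w)) by exact: bm_shift.
have ub : \int[normal_prob 0 1]_w fu (c + w) <= 1 - Phi (z - c) + normal_peak 1 * (2 * d).
  apply: (@le_trans _ _ (1 - Phi (z - 2 * d - c))).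
    rewrite -normal_tail; apply: (expect_le n1 bfuc (bind _)) => w.
    have [cw|cw] := ltP (z - 2 * d - c) w.
      by rewrite /fu; case/andP: (step_spline_bounds (k * (c + w - (z - 2 * d)))).
    rewrite /fu step_spline_le0//; rewrite mulr_ge0_le0//; lra.
  have := Phi_lipschitz (z - c) (z - 2 * d - c).
  rewrite (_ : z - c - (z - 2 * d - c) = 2 * d); last by ring.
  rewrite (ger0_norm (_ : 0 <= 2 * d)); last by rewrite mulr_ge0// ltW.
  by rewrite ler_norml; lra.
have lb : 1 - Phi (z - c) - normal_peak 1 * (2 * d) <= \int[normal_prob 0 1]_w fl (c + w).
  apply: (@le_trans _ _ (1 - Phi (z + 2 * d - c))).
    have := Phi_lipschitz (z - c) (z + 2 * d - c).
    rewrite (_ : z - c - (z + 2 * d - c) = - (2 * d)); last by ring.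
    rewrite normrN (ger0_norm (_ : 0 <= 2 * d)); last by rewrite mulr_ge0// ltW.
    by rewrite ler_norml; lra.
  rewrite -normal_tail; apply: (expect_le n1 (bind _) bflc) => w.
  have [cw|cw] := ltP (z + 2 * d - c) w.
    rewrite /fl step_spline_ge3// -kd ler_wpM2l//; lra.
  by rewrite /fl; case/andP: (step_spline_bounds (k * (c + w - (z + d)))).
near=> n.
rewrite power_functionE.
have K0 : 0 < spearman_scale R m n by near: n; exact: near_scale_gt0.
have zn : `|z - z / (spearman_scale R m n * tau)| <= d / 2.
  near: n; move/cvgrPdist_le : (@cvg_threshold z); apply.
  by rewrite divr_gt0.
have hu : `|\int[power_measure (P (h / Num.sqrt n%:R)) n]_X fu (rank_mean X / tau) -
    \int[normal_prob 0 1]_w fu (c + w)| <= e / 2.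
  by near: n; exact: (smooth_limit h0 e2 cu).
have hl : `|\int[power_measure (P (h / Num.sqrt n%:R)) n]_X fl (rank_mean X / tau) -
    \int[normal_prob 0 1]_w fl (c + w)| <= e / 2.
  by near: n; exact: (smooth_limit h0 e2 cl).
set kp := spearman_scale R m n in K0 zn *.
set E := power_measure _ n in hu hl *.
have En : E setT = 1%E := power_measure_setT n (P1 _).
have brm : measurable_fun setT (fun X : n.-tuple T => rank_mean X).
  by case: (bm_rank_mean R m n).
have bpow : bm (fun X : n.-tuple T => (z < kp * rank_mean X)%R%:R : R).
  by apply: (bm_comp _ (bind z)); exact: measurable_funM.
have mrt : measurable_fun setT (fun X : n.-tuple T => rank_mean X / tau).
  exact: measurable_funM.
have buX := bm_comp mrt bfu; have blX := bm_comp mrt bfl.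
have thr (X : n.-tuple T) : (z < kp * rank_mean X) = (z / (kp * tau) < rank_mean X / tau).
  rewrite ltr_pdivrMr ?mulr_gt0//; congr (_ < _).
  by field; rewrite gt_eqF.
have up : \int[E]_X ((z < kp * rank_mean X)%R%:R : R) <= \int[E]_X fu (rank_mean X / tau).
  apply: (expect_le En bpow buX) => X; rewrite thr.
  have [lt|_] := ltP (z / (kp * tau)) (rank_mean X / tau); last first.
    by rewrite /fu; case/andP: (step_spline_bounds (k * (rank_mean X / tau - (z - 2 * d)))).
  rewrite /fu step_spline_ge3// -kd ler_wpM2l//.
  by move: zn; rewrite ler_norml; lra.
have lo : \int[E]_X fl (rank_mean X / tau) <= \int[E]_X ((z < kp * rank_mean X)%R%:R : R).
  apply: (expect_le En blX bpow) => X; rewrite thr.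
  have [_|ge] := ltP (z / (kp * tau)) (rank_mean X / tau).
    by rewrite /fl; case/andP: (step_spline_bounds (k * (rank_mean X / tau - (z + d)))).
  rewrite /fl step_spline_le0// mulr_ge0_le0//.
  by move: zn; rewrite ler_norml; lra.
have de : normal_peak 1 * (2 * d) <= e / 2.
  rewrite /d; set p := normal_peak 1 in p0 *.
  have q0 : 0 < 2 * p + 1 by rewrite ltr_wpDl// mulr_ge0// ltW.
  rewrite (_ : p * (2 * (e / (2 * (2 * p + 1)))) = e / 2 * (2 * p / (2 * p + 1))).
    by rewrite ler_piMr ?(ltW e2)// ler_pdivrMr// mul1r lerDl.
  by field; rewrite gt_eqF.
move: hu hl ub lb up lo de; rewrite !ler_norml.
set A := \int[E]_X fu _; set B := \int[E]_X fl _.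
set C := \int[E]_X _; set U := \int[normal_prob 0 1]_w fu _.
set L := \int[normal_prob 0 1]_w fl _; set F := Phi (z - c).
set p := normal_peak 1 * _.
by move=> /andP[? ?] /andP[? ?] ? ? ? ? ?; apply/andP; split; lra.
Unshelve. all: by end_near. Qed.

End power_limit_indicator.

(** * Mixed partial derivatives of sums of products *)

Section mixed_partials.
Context (R : realType) (m : nat).
Implicit Types (x : m.-tuple R) (s : seq 'I_m).

(** A product of functions of single coordinates, stored together with the
    derivatives of its factors: differentiating in some coordinates replaces
    the corresponding factors, as in [eval_term]. *)
Record product_term := ProductTerm {
  coef : R ; factor : 'I_m -> R -> R ; dfactor : 'I_m -> R -> R }.

Definition term_ok (r : product_term) : Prop :=
  forall j (t : R), is_derive t 1 (factor r j) (dfactor r j t).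

Definition eval_term s x (r : product_term) : R :=
  coef r * \prod_(j < m) (if j \in s then dfactor r j (tnth x j) else factor r j (tnth x j)).

Definition open_cube x : Prop := forall j, 0 < tnth x j < 1.

Lemma tnth_set_coord x i (t : R) j :
  tnth (set_coord x i t) j = if j == i then t else tnth x j.
Proof. by rewrite tnth_mktuple. Qed.

Lemma is_derive_bigsum I (r : seq I) (F : I -> R -> R) (dF : I -> R) (t : R) :
  (forall i, is_derive t 1 (F i) (dF i)) ->
  is_derive t 1 (fun u => \sum_(i <- r) F i u) (\sum_(i <- r) dF i).
Proof.
move=> h; elim: r => [|i r IH].
  rewrite big_nil (_ : (fun _ => _) = cst 0); first exact: is_derive_cst.
  by apply/funext => u; rewrite big_nil.
rewrite big_cons (_ : (fun _ => _) = F i \+ (fun u => \sum_(j <- r) F j u)).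
  exact: is_deriveD.
by apply/funext => u; rewrite big_cons.
Qed.

(** By induction on s. On the open cube the formula for the inner derivative
    holds along a whole interval of the line on which the next derivative is
    taken. *)
Lemma mixed_partial_products I (L : seq I) (r : I -> product_term)
    (F : m.-tuple R -> R) :
  (forall i, term_ok (r i)) ->
  (forall x, open_cube x -> F x = \sum_(i <- L) eval_term [::] x (r i)) ->
  forall s, uniq s -> forall x, open_cube x ->
    mixed_partial s F x = \sum_(i <- L) eval_term s x (r i).
Proof.
move=> rok Fx; elim=> [|i s IH] /=; first by move=> _ x; exact: Fx.
move=> /andP[iNs us] x xo; rewrite /partial.
pose K j0 := coef (r j0) * \prod_(j < m | j != i)
  (if j \in s then dfactor (r j0) j (tnth x j) else factor (r j0) j (tnth x j)).
pose G (t : R) := \sum_(j0 <- L) factor (r j0) i t * K j0.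
have GE : \forall t \near tnth x i, mixed_partial s F (set_coord x i t) = G t.
  have : \forall t \near tnth x i, t \in `]0, 1[ by apply: near_in_itvoo; rewrite in_itv/= xo.
  apply: filterS => t; rewrite in_itv/= => t01.
  have xto : open_cube (set_coord x i t).
    by move=> j; rewrite tnth_set_coord; case: ifP.
  rewrite (IH us _ xto); apply: eq_bigr => j0 _.
  rewrite /eval_term (bigD1 i)//= (negbTE iNs) tnth_set_coord eqxx /K.
  rewrite mulrCA; congr (_ * (_ * _)); apply: eq_bigr => j /negbTE ji.
  by rewrite tnth_set_coord ji.
have dG : is_derive (tnth x i) 1 G (\sum_(j0 <- L) dfactor (r j0) i (tnth x i) * K j0).
  apply: is_derive_bigsum => j0; have ? := rok j0 i (tnth x i).
  by apply: is_derive_eq; rewrite scaler0 add0r /GRing.scale/= mulrC.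
rewrite derive1E (near_eq_derive _ GE) ?oner_neq0// derive_val.
apply: eq_bigr => j0 _; rewrite /eval_term [in RHS](bigD1 i)//= mem_head /K.
rewrite mulrCA; congr (_ * (_ * _)); apply: eq_bigr => j /negbTE ji.
by rewrite inE ji.
Qed.

Lemma mixed_partial_score (C : R) (F : m.-tuple R -> R) :
  (forall x, cube x -> F x = C * \prod_(j < m) tnth x j *
      (\prod_(j < m) (2 - tnth x j) + \sum_(j < m) tnth x j - m.+1%:R)) ->
  forall x, open_cube x -> mixed_partial (enum 'I_m) F x =
    C * (\prod_(j < m) (2 * (1 - tnth x j)) - \sum_(j < m) 2 * (1 - tnth x j) + (m%:R - 1)).
Proof.
move=> FE.
(* The polynomial as a sum of products: the product of the x_j (2 - x_j), the
   constant m + 1, and one term for each x_k of the sum. *)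
pose r (o : option (option 'I_m)) : product_term :=
  match o with
  | None => ProductTerm C (fun _ t => t * (2 - t)) (fun _ t => 2 * (1 - t))
  | Some None => ProductTerm (- C * m.+1%:R) (fun _ t => t) (fun _ _ => 1)
  | Some (Some k) => ProductTerm C (fun j t => if j == k then t * t else t)
      (fun j t => if j == k then 2 * t else 1)
  end.
have rok o : term_ok (r o).
  case: o => [[k|]|] j t /=.
  - case: (j == k); last exact: is_derive_id.
    by apply: is_derive_eq; rewrite /GRing.scale/=; ring.
  - exact: is_derive_id.
  - by apply: is_derive_eq; rewrite /GRing.scale/=; ring.
pose L := [:: None, Some None & [seq Some (Some k) | k <- enum 'I_m]].
have FL x : open_cube x -> F x = \sum_(o <- L) eval_term [::] x (r o).
  move=> xo; have xc : cube x by move=> j; case/andP: (xo j) => /ltW -> /ltW ->.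
  rewrite (FE x xc) !big_cons big_map big_enum/= /eval_term/=.
  have -> : \sum_(k < m) C * \prod_(j < m) (if j == k then tnth x j * tnth x j else tnth x j)
     = C * (\prod_(j < m) tnth x j * \sum_(k < m) tnth x k).
    rewrite -mulr_sumr; congr (_ * _); rewrite mulr_sumr; apply: eq_bigr => k _.
    rewrite (bigD1 k)//= eqxx [in RHS](bigD1 k)//=.
    rewrite (eq_bigr (fun j => tnth x j)) => [|j /negbTE ->//].
    by ring.
  rewrite big_split/=; ring.
move=> x xo; rewrite (mixed_partial_products rok FL (enum_uniq _) xo).
rewrite !big_cons big_map big_enum/= /eval_term/=.
have e (f g : 'I_m -> R) : \prod_(j < m) (if j \in enum 'I_m then f j else g j) =
    \prod_(j < m) f j by apply: eq_bigr => j _; rewrite mem_enum.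
rewrite !e.
have -> : \sum_(k < m) C * \prod_(j < m) (if j \in enum 'I_m then
    (if j == k then 2 * tnth x j else 1) else (if j == k then tnth x j * tnth x j else tnth x j))
     = C * (2 * \sum_(k < m) tnth x k).
  rewrite -mulr_sumr; congr (_ * _); rewrite mulr_sumr; apply: eq_bigr => k _.
  rewrite e (bigD1 k)//= eqxx big1 ?mulr1// => j /negbTE -> //.
have -> : \sum_(j < m) 2 * (1 - tnth x j) = 2 * (m%:R - \sum_(k < m) tnth x k).
  by rewrite -mulr_sumr sumrB sumr_const card_ord.
by rewrite big1_eq -natr1; ring.
Qed.

End mixed_partials.

(** * Equality in the Cauchy-Schwarz inequality *)

Section optimality.
Context (R : realType) (m : nat) (hm : (2 <= m)%N).
Context (Omega : forall k : nat, k.-tuple R -> R) (omega : m.-tuple R -> R).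
Context (P : R -> probability (m.-tuple R) R).
Hypothesis hdep : dependence_conditions Omega omega.
Variable theta0 : R.
Hypothesis theta0_gt0 : 0 < theta0.
Hypothesis hP : model_upto Omega omega P theta0.
Notation T := (m.-tuple R).
Notation lam := (lebesgue_tuple R m).
Notation cubem := (@cube R m).
Notation tau := (score_sd R m).
Notation sl := (slope omega P).
Notation I0 := (fisher_information omega).
Implicit Types x : T.

Let zero_ok : 0 <= (0 : R) <= theta0. Proof. by rewrite lexx ltW. Qed.
Let theta0_ok : 0 <= theta0 <= theta0. Proof. by rewrite lexx andbT ltW. Qed.
Let P1 theta := P_setT P theta.
Let tau0 : 0 < tau := score_sd_gt0 R hm.
Let mcube : measurable cubem := @measurable_cube R m.

(** As Phi is injective, the limit at h = 1 determines the slope. *)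
Lemma slope_unique (z s1 s2 : R) (gamma : nat -> R -> R) :
  has_slope gamma z s1 -> has_slope gamma z s2 -> s1 = s2.
Proof.
move=> /(_ 1 ler01) h1 /(_ 1 ler01) h2.
have e : 1 - Phi (z - 1 * s1) = 1 - Phi (z - 1 * s2).
  exact: (cvg_unique _ h1 h2).
rewrite !mul1r in e; have /Phi_inj : Phi (z - s1) = Phi (z - s2) by lra.
by lra.
Qed.

Lemma pitman_optimal_slope alpha : pitman_optimal P omega alpha <-> sl = Num.sqrt I0.
Proof.
have hs z : has_slope (power_function P z) z sl.
  by move=> h h0; exact: (cvg_power_function hm hdep theta0_gt0 hP).
split=> [opt|e]; first exact: (slope_unique (hs _) opt).
by rewrite /pitman_optimal -e; exact: hs.
Qed.

Let om2E x : om omega x ^+ 2 = (omega x ^+ 2) * \1_cubem x.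
Proof.
by rewrite /om exprMn indicE; case: (_ \in _); rewrite /= ?expr1n ?expr0n.
Qed.

Let integrable_om2 : lam.-integrable setT (EFin \o (fun x => om omega x ^+ 2)).
Proof.
have := integrable_omega2 hdep; rewrite integrable_mkcond//.
congr integrable; apply/funext => x /=.
by rewrite patchE om2E indicE; case: (_ \in _); rewrite ?mulr1 ?mulr0.
Qed.

Let fisherE : I0 = \int[lam]_x (om omega x ^+ 2).
Proof.
rewrite /fisher_information Rintegral_mkcond; apply: eq_Rintegral => x _.
by rewrite patchE om2E indicE; case: (_ \in _); rewrite ?mulr1 ?mulr0.
Qed.

Lemma fisher_ge0 : 0 <= I0.
Proof. by rewrite fisherE; apply: Rintegral_ge0 => x _; rewrite sqr_ge0. Qed.

Let bs := bm_score P.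

Let score_varE : \int[lam]_x (score P x ^+ 2 * \1_cubem x) = tau ^+ 2.
Proof.
rewrite -(expect0_lebesgue hdep theta0_gt0 hP (bmX 2 bs)) score_sd2//.
exact: (expect0_score2 hm hdep theta0_gt0 hP).
Qed.

(** With k = sqrt I0 / tau, the square of om - k score integrates to
    I0 - 2 k (sqrt I0 tau) + k^2 tau^2 = 0. *)
Lemma ae_eq_of_slope : sl = Num.sqrt I0 ->
  ae_eq lam setT (EFin \o om omega)
    (EFin \o (fun x => Num.sqrt I0 / tau * (score P x * \1_cubem x))).
Proof.
move=> e; set k := Num.sqrt I0 / tau.
have crossE : cross omega (score P) = Num.sqrt I0 * tau by rewrite -e divfK// gt_eqF.
have io := integrable_om2.
have ix := integrable_mul_om hdep theta0_gt0 hP bs.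
have is2 := integrable_mul_cube theta0_gt0 hP (bmX 2 bs).
have ix' := integrableZl measurableT (2 * k) ix.
have is' := integrableZl measurableT (k ^+ 2) is2.
have i1 := integrableB measurableT io ix'.
have i2 := integrableD measurableT i1 is'.
pose D x : R := om omega x ^+ 2 - 2 * k * (score P x * om omega x)
  + k ^+ 2 * (score P x ^+ 2 * \1_cubem x).
have iD : lam.-integrable setT (EFin \o D) by exact: i2.
have DE x : D x = (om omega x - k * (score P x * \1_cubem x)) ^+ 2.
  rewrite /D /om indicE; case: (_ \in _) => /=; ring.
have D0 : \int[lam]_x D x = 0.
  rewrite /D (RintegralD measurableT i1 is') (RintegralB measurableT io ix').
  rewrite (RintegralZl _ measurableT ix) (RintegralZl _ measurableT is2).
  rewrite -fisherE score_varE -/(cross omega (score P)) crossE /k.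
  rewrite -{1}(sqr_sqrtr fisher_ge0); field.
  by rewrite gt_eqF.
have aeD : ae_eq lam setT (EFin \o D) (cst 0%E).
  apply/ae_eq_integral_abs => //; first exact: measurable_int iD.
  rewrite (eq_integral (EFin \o D)); last first.
    by move=> x _; rewrite /= ger0_norm// DE sqr_ge0.
  have := integrable_fin_num measurableT iD => /fineK <-.
  by rewrite -[fine _]/(\int[lam]_x D x) D0.
apply: filterS aeD => x /(_ I) [Dx] _ /=; congr EFin.
move/eqP: Dx; rewrite DE sqrf_eq0 subr_eq0 => /eqP //.
Qed.

Lemma slope_eq_of_ae (k : R) : 0 <= k ->
  ae_eq lam setT (EFin \o om omega)
    (EFin \o (fun x => k * (score P x * \1_cubem x))) ->
  sl = Num.sqrt I0.
Proof.
move=> k0 ae.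
have is2 := integrable_mul_cube theta0_gt0 hP (bmX 2 bs).
have mom : measurable_fun setT (om omega).
  by apply/measurable_EFinP; exact: measurable_int (integrable_om hdep theta0_gt0 hP).
have ms := proj1 bs.
have mi : measurable_fun setT (\1_cubem : T -> R) by exact: measurable_indic.
have msi : measurable_fun setT (fun x => score P x ^+ 2 * \1_cubem x).
  by apply: measurable_funM => //; exact: measurable_funX.
have ind2 x : (\1_cubem x : R) * \1_cubem x = \1_cubem x.
  by rewrite indicE; case: (_ \in _); rewrite ?mulr1 ?mulr0.
have c : cross omega (score P) = k * tau ^+ 2.
  rewrite -score_varE -RintegralZl// /cross /Rintegral; congr fine.
  apply: ae_eq_integral => //.
  - by apply/measurable_EFinP; exact: measurable_funM.
  - by apply/measurable_EFinP; exact: measurable_funM.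
  apply: filterS ae => x /(_ I) [->] _; congr EFin; ring.
have i : I0 = k ^+ 2 * tau ^+ 2.
  rewrite fisherE -score_varE -RintegralZl// /Rintegral; congr fine.
  apply: ae_eq_integral => //.
  - by apply/measurable_EFinP; exact: measurable_funX.
  - by apply/measurable_EFinP; exact: measurable_funM.
  apply: filterS ae => x /(_ I) [->] _; congr EFin.
  by rewrite !exprMn [\1_cubem x ^+ 2]expr2 ind2.
rewrite i -exprMn sqrtr_sqr ger0_norm; last by rewrite mulr_ge0// ltW.
by rewrite /slope c; field; rewrite gt_eqF.
Qed.

Let orthant_cube theta x : 0 <= theta <= theta0 -> cube x ->
  \int[P theta]_y orthant_ind (tnth x) y = \prod_(j < m) tnth x j + theta * Omega x.
Proof.
move=> th xc; have [cdf _] := hP th.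
have mo := measurable_orthant x.
have b1 := bm_orthant_ind (tnth x).
have b2 := bm_indic R mo.
have -> : \int[P theta]_y orthant_ind (tnth x) y = \int[P theta]_y (\1_(orthant x) y : R).
  rewrite (expect_theta_lebesgue hdep theta0_gt0 hP th b1).
  rewrite (expect_theta_lebesgue hdep theta0_gt0 hP th b2).
  have e y : orthant_ind (tnth x) y * \1_cubem y = \1_(orthant x) y * \1_cubem y :> R.
    rewrite [\1_cubem y]indicE; have [yc|] := boolP (y \in cubem); last by rewrite !mulr0.
    congr (_ * _); rewrite inE in yc; rewrite /orthant_ind indicE.
    have [yo|yo] := boolP (y \in orthant x).
      rewrite inE in yo; apply: big1 => j _; rewrite clamp_id; last exact: yc.
      by rewrite yo.
    apply/eqP; rewrite prodf_seq_eq0; apply/hasP.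
    apply: contrapT => h; move/negP : yo; apply; rewrite inE => j.
    apply: contrapT => yj; apply: h; exists j; rewrite ?mem_index_enum//=.
    rewrite clamp_id; last exact: yc.
    by rewrite pnatr_eq0 eqb0; exact/negP.
  congr (_ + _ * _); first by apply: eq_Rintegral => y _; exact: e.
  rewrite /cross; apply: eq_Rintegral => y _.
  by rewrite /om mulrCA e mulrCA.
rewrite expect_indic//; have h := cdf x xc.
exact: (congr1 fine h).
Qed.

(** Compare the values of the cdf at theta0 and at 0. *)
Lemma Omega_cross x : cube x -> Omega x = cross omega (orthant_ind (tnth x)).
Proof.
move=> xc; have b1 := bm_orthant_ind (tnth x).
have := orthant_cube theta0_ok xc.
rewrite (expect_theta hdep theta0_gt0 hP theta0_ok b1) (orthant_cube zero_ok xc).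
rewrite mul0r addr0 => /addrI e.
exact/esym/(mulfI (lt0r_neq0 theta0_gt0) e).
Qed.

(** Integrate omega = k score over the orthant below x. *)
Lemma Omega_of_ae (k : R) :
  ae_eq lam setT (EFin \o om omega)
    (EFin \o (fun x => k * (score P x * \1_cubem x))) ->
  forall x, cube x -> Omega x = (k * 2^-1 ^+ m) * \prod_(j < m) tnth x j *
      (\prod_(j < m) (2 - tnth x j) + \sum_(j < m) tnth x j - m.+1%:R).
Proof.
move=> ae x xc; rewrite (Omega_cross xc).
have b1 := bm_orthant_ind (tnth x).
have bos := bmM b1 bs.
have mom : measurable_fun setT (om omega).
  by apply/measurable_EFinP; exact: measurable_int (integrable_om hdep theta0_gt0 hP).
have mi : measurable_fun setT (\1_cubem : T -> R) by exact: measurable_indic.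
have io := integrable_mul_cube theta0_gt0 hP bos.
transitivity (k * \int[P 0]_y (orthant_ind (tnth x) y * score P y)); last first.
  rewrite (expect0_orthant_score hm hdep theta0_gt0 hP)//.
  by ring.
rewrite (expect0_lebesgue hdep theta0_gt0 hP bos) -RintegralZl//.
rewrite /cross /Rintegral; congr fine; apply: ae_eq_integral => //.
- by apply/measurable_EFinP; apply: measurable_funM => //; case: b1.
- apply/measurable_EFinP; apply: measurable_funM => //.
  by apply: measurable_funM => //; case: bos.
apply: filterS ae => y /(_ I) [->] _; congr EFin; ring.
Qed.

(** The faces of the cube are null sets because each coordinate is uniform
    under P 0. *)
Lemma ae_open_cube : {ae lam, forall x, cube x -> open_cube x}.
Proof.
have null (A : set T) : measurable A -> P 0 A = 0%E -> lam (A `&` cubem) = 0%E.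
  move=> mA; have [_ /(_ A mA) ->] := hP zero_ok.
  under eq_integral do rewrite mul0r addr0.
  by rewrite integral_cst ?mul1e//; exact: measurableI.
have fin0 (A : set T) : measurable A -> \int[P 0]_x (\1_A x : R) <= 0 -> P 0 A = 0%E.
  move=> mA; rewrite expect_indic// => A0.
  have fA : P 0 A \is a fin_num by exact: fin_num_measure.
  apply/eqP; rewrite eq_le measure_ge0 andbT -(fineK fA) lee_fin.
  exact: A0.
pose A0 j := [set x : T | tnth x j <= 0]; pose A1 j := [set x : T | 1 <= tnth x j].
have mA0 j : measurable (A0 j).
  have := @measurable_coord R m j `]-oo, 0]%classic (measurable_itv _).
  by congr measurable; apply/seteqP; split => y /=; rewrite in_itv.
have mA1 j : measurable (A1 j).
  have := @measurable_coord R m j `[1, +oo[%classic (measurable_itv _).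
  by congr measurable; apply/seteqP; split => y /=; rewrite in_itv/= andbT.
have n0 j : lam (A0 j `&` cubem) = 0%E.
  apply: null => //; apply: fin0 => //.
  rewrite (_ : \int[P 0]_x _ = \int[P 0]_x ((tnth x j <= 0)%R%:R : R)); last first.
    apply: eq_Rintegral => x _; rewrite indicE.
    by have [h|h] := boolP (tnth x j <= 0); [rewrite mem_set|rewrite memNset//; exact/negP].
  by rewrite (margin_uniform hm hdep hP)// clamp_le0.
have n1 j : lam (A1 j `&` cubem) = 0%E.
  apply: null => //; apply: fin0 => //.
  pose F (l : 'I_m) (t : R) : R := if l == j then (1 <= t)%R%:R else 1.
  have bF l : bm (F l).
    rewrite /F; case: (l == j); last exact: bm_cst.
    exact: (@bm_ler R _ R (fun=> 1) id).
  have F0 l t : 0 <= F l t by rewrite /F; case: ifP.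
  rewrite (_ : \int[P 0]_x _ = \int[P 0]_x \prod_(l < m) F l (tnth x l)); last first.
    apply: eq_Rintegral => x _; rewrite indicE (bigD1 j)//= {1}/F eqxx big1 ?mulr1.
      by have [h|h] := boolP (1 <= tnth x j); [rewrite mem_set|rewrite memNset//; exact/negP].
    by move=> l /negbTE lj; rewrite /F lj.
  rewrite (expect0_prod hdep theta0_gt0 hP bF F0) (bigD1 j)//= {1}/F eqxx.
  by rewrite integral_above clamp_ge1// subrr mul0r.
have null_all (A : 'I_m -> set T) : (forall j, lam.-negligible (A j)) ->
    lam.-negligible [set x | exists j, A j x].
  move=> nA; rewrite (_ : [set x | _] = \big[setU/set0]_(j < m) A j).
    by apply: (big_ind (fun B => lam.-negligible B)) => //;
       [exact: negligible_set0|exact: negligibleU].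
  apply/seteqP; split => x /=.
    by case=> j Aj; rewrite -bigcup_seq/=; exists j => //=; rewrite mem_index_enum.
  by rewrite -bigcup_seq/= => -[j _ Aj]; exists j.
have neg : lam.-negligible [set x | exists j, ((A0 j `&` cubem) `|` (A1 j `&` cubem)) x].
  apply: null_all => j; apply: negligibleU.
    by exists (A0 j `&` cubem); split; [exact: measurableI|exact: n0|].
  by exists (A1 j `&` cubem); split; [exact: measurableI|exact: n1|].
apply: negligibleS neg => x /= /not_implyP[xc xo].
apply: contrapT => h; apply: xo => j; have /andP[x0 x1] := xc j.
have [x0'|x0'] := ltP 0 (tnth x j); last first.
  by exfalso; apply: h; exists j; left.
have [x1'|x1'] := ltP (tnth x j) 1; first by [].
by exfalso; apply: h; exists j; right.
Qed.

(** The formula determines Omega on the cube only, so its mixed derivative is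
    computed in the open cube, which has full measure in the cube. *)
Lemma ae_of_Omega (C : R) :
  (forall x, cube x -> Omega x = C * \prod_(j < m) tnth x j *
      (\prod_(j < m) (2 - tnth x j) + \sum_(j < m) tnth x j - m.+1%:R)) ->
  ae_eq lam setT (EFin \o om omega)
    (EFin \o (fun x => (C * 2 ^+ m) * (score P x * \1_cubem x))).
Proof.
move=> OE; move: (dep_mixed hdep) ae_open_cube; apply: filterS2 => x mx ox _ /=.
congr EFin; rewrite /om indicE; have [xc|] := boolP (x \in cubem); last by rewrite !mulr0.
rewrite inE in xc; have xo := ox xc.
have [_ <-] := mx xc (enum 'I_m) (perm_refl _).
rewrite (mixed_partial_score OE xo) !mulr1 (scoreE hm hdep theta0_gt0 hP).
rewrite mulrA -[C * 2 ^+ m * _]mulrA -exprMn mulfV// expr1n mulr1; congr (_ * (_ - _ + _)).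
  by apply: eq_bigr => j _; rewrite /surv clamp_id//; exact: xc.
by apply: eq_bigr => j _; rewrite /surv clamp_id//; exact: xc.
Qed.

End optimality.

Theorem mainTheorem1 (R : realType) (m : nat) (hm : (2 <= m)%N)
  (Omega : forall k : nat, k.-tuple R -> R) (omega : m.-tuple R -> R)
  (P : R -> probability (m.-tuple R) R)
  (hmodel : is_model Omega omega P)
  (alpha : R) (halpha : 0 < alpha < 1) :
  pitman_optimal P omega alpha <->
  exists2 C : R, 0 < C & forall x : m.-tuple R, cube x ->
    Omega m x = C * \prod_(j < m) tnth x j *
      (\prod_(j < m) (2 - tnth x j) + \sum_(j < m) tnth x j - m.+1%:R).
Proof.
have [hdep [theta0 theta0_gt0 hP]] := hmodel.
rewrite (pitman_optimal_slope hm hdep theta0_gt0 hP).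
split=> [opt|[C C0 OE]]; last first.
  apply: (slope_eq_of_ae hm hdep theta0_gt0 hP) (ae_of_Omega hm hdep theta0_gt0 hP OE).
  by rewrite mulr_ge0 ?exprn_ge0// ltW.
have ae := ae_eq_of_slope hm hdep theta0_gt0 hP opt.
exists (Num.sqrt (fisher_information omega) / score_sd R m * 2^-1 ^+ m); last first.
  exact: (Omega_of_ae hm hdep theta0_gt0 hP ae).
(* If the constant were zero, omega would vanish almost everywhere. *)
rewrite mulr_gt0 ?exprn_gt0// divr_gt0 ?score_sd_gt0// lt_def sqrtr_ge0 andbT.
apply/eqP => s0; apply: (dep_neq0 hdep).
apply: filterS ae => x /(_ I) [+] xc; rewrite /om indicE mem_set// mulr1 => ->.
by rewrite s0 !mul0r.
Qed.
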